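(* Let $A$ be an $m\times n$ matrix with i.i.d. standard normal components. Let $n$ be large and let $k=\beta n$, $m=\alpha n$, where $\beta,\alpha>0$ are constants independent of $n$, with $k<m<n$ (i.e. $\beta<\alpha<1$). Let $\xi_{lric}=\min_{\mathbf{x}\in S_{ric}}\|A\mathbf{x}\|_2$. Then $$\lim_{n\rightarrow\infty}\frac{E\,\xi_{lric}}{\sqrt{m}}=\lim_{n\rightarrow\infty}\frac{E\left(\min_{\mathbf{x}\in S_{ric}}\|A\mathbf{x}\|_2\right)}{\sqrt{m}}\geq 1-\frac{1}{\sqrt{\alpha}}\sqrt{\beta+\frac{2\,\mathrm{erfinv}(1-\beta)}{\sqrt{\pi}\,e^{(\mathrm{erfinv}(1-\beta))^2}}}.$$ Moreover, let $\xi_{lric}^{(l)}$ be a quantity such that $$1-\frac{1}{\sqrt{\alpha}}\sqrt{\beta+\frac{2\,\mathrm{erfinv}(1-\beta)}{\sqrt{\pi}\,e^{(\mathrm{erfinv}(1-\beta))^2}}}>\xi_{lric}^{(l)}.$$ Then $$\lim_{n\rightarrow\infty}P\left(\min_{\mathbf{x}\in S_{ric}}\|A\mathbf{x}\|_2\geq \xi_{lric}^{(l)}\sqrt{m}\right)\geq 1$$ $$\Leftrightarrow\quad \lim_{n\rightarrow\infty}P\left(\xi_{lric}\geq \xi_{lric}^{(l)}\sqrt{m}\right)\geq 1$$ $$\Leftrightarrow\quad \lim_{n\rightarrow\infty}P\left(\xi_{lric}^2\geq (\xi_{lric}^{(l)})^2 m\right)\geq 1.$$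
   Context: $S_{ric}=\{\mathbf{x}\in S^{n-1} : \|\mathbf{x}\|_{\ell_0}=k\}$, where $S^{n-1}$ is the Euclidean unit sphere in $\mathbb{R}^n$ and $\|\mathbf{x}\|_{\ell_0}$ is the number of nonzero components of $\mathbf{x}$. $E$ and $P$ denote expectation and probability with respect to the random matrix $A$. $\mathrm{erfinv}$ is the inverse of the error function $\mathrm{erf}(x)=\frac{2}{\sqrt{\pi}}\int_0^x e^{-t^2}dt$.
   Formalization: The last equivalence, with squares, is stated for nonnegative ξ^(l) only, since it is false for very negative values such as −100; the limit of Eξ/√m is read as a lim inf, existence of that limit not being asserted. *)

(* Defs.v *)
From HB Require Import structures.
From mathcomp Require Import all_boot all_order all_algebra.
From mathcomp Require Import all_classical all_reals all_analysis.

Set Implicit Arguments.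
Unset Strict Implicit.
Unset Printing Implicit Defensive.

Import Order.TTheory GRing.Theory Num.Theory.
Import numFieldNormedType.Exports.

Local Open Scope classical_set_scope.
Local Open Scope ring_scope.

Section error_function.
Context {R : realType}.

(* The case split renders the oriented integral from 0 to x when x < 0. *)
Definition erf (x : R) : R :=
  2 / Num.sqrt pi *
  (if 0 <= x
   then \int[lebesgue_measure]_(t in `[0, x]) expR (- t ^+ 2)
   else - \int[lebesgue_measure]_(t in `[x, 0]) expR (- t ^+ 2)).

(* The value outside ]-1, 1[, the range of erf, is the junk value 0. *)
Definition erfinv : R -> R := 'pinv_(fun=> 0) [set: R] erf.

End error_function.

Section sparse_sphere.
Context {R : realType}.

(* The library norm on matrices is the sup norm. *)
Definition l2norm (n : nat) (x : 'cV[R]_n) : R :=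
  Num.sqrt (\sum_(i < n) x i 0 ^+ 2).

Definition l0norm (n : nat) (x : 'cV[R]_n) : nat := #|[set i | x i 0 != 0]%SET|.

Definition S_ric (n k : nat) : set 'cV[R]_n :=
  [set x | l2norm x = 1 /\ l0norm x = k].

(* S_ric is not closed, so the minimum is rendered as the infimum; the two
   agree whenever the minimum is attained. *)
Definition min_l2norm (m n : nat) (M : 'M[R]_(m, n)) (S : set 'cV[R]_n) : R :=
  inf [set l2norm (M *m x) | x in S].

End sparse_sphere.

Section gaussian_matrix.
Context d (T : measurableType d) (R : realType) (P : probability T R).
Local Open Scope ereal_scope.

Definition mutually_independent (I : finType) (X : I -> {RV P >-> R}) : Prop :=
  forall (J : {set I}) (B : I -> set R),
    (forall i, i \in J -> measurable (B i)) ->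
    P (\bigcap_(i in [set` J]) (X i @^-1` B i)) =
    \prod_(i in J) P (X i @^-1` B i).

Definition standard_normal (X : {RV P >-> R}) : Prop :=
  forall B : set R, measurable B -> distribution P X B = normal_prob 0 1 B.

Definition iid_standard_normal (m n : nat) (A : 'M[{RV P >-> R}]_(m, n)) : Prop :=
  (forall i j, standard_normal (A i j)) /\
  mutually_independent (fun ij : 'I_m * 'I_n => A ij.1 ij.2).

Definition realization (m n : nat) (A : 'M[{RV P >-> R}]_(m, n)) (w : T) :
    'M[R]_(m, n) :=
  \matrix_(i < m, j < n) A i j w.

End gaussian_matrix.

Section limits.
Context {R : realType}.
Local Open Scope ereal_scope.

(* "lim u >= c", existence of the limit being part of the claim. *)
Definition lim_ge (u : (\bar R)^nat) (c : \bar R) : Prop :=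
  cvgn u /\ c <= limn u.

End limits.

Section lower_ric_bound.
Context {R : realType}.

Definition lric_bound (alpha beta : R) : R :=
  1 - 1 / Num.sqrt alpha *
      Num.sqrt (beta + 2 * erfinv (1 - beta) /
                       (Num.sqrt pi * expR (erfinv (1 - beta) ^+ 2))).

End lower_ric_bound.

(* Main.v *)
Require Import Defs.
From HB Require Import structures.
From mathcomp Require Import all_boot all_order all_algebra.
From mathcomp Require Import all_classical all_reals all_analysis.
From mathcomp Require Import measurable_realfun.
From mathcomp Require Import ring lra.

Set Implicit Arguments.
Unset Strict Implicit.
Unset Printing Implicit Defensive.

Import Order.TTheory GRing.Theory Num.Theory.
Import numFieldNormedType.Exports.

Local Open Scope classical_set_scope.
Local Open Scope ring_scope.

(** Gordon's comparison reduces the minimum of |A x| over a set of unit vectors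
to a minimum over the same set of |g| + <h, x>, where g and h are independent
standard normal vectors in dimensions m and n.  The norm |g| is close to
sqrt m.  The minimum of <h, x> over k-sparse unit vectors is minus the norm of
the k largest entries of h, which is close to - sqrt (n V) with
V = beta + 2 e / (sqrt pi exp (e^2)) and e = erfinv (1 - beta).  Since
n is about m / alpha, the minimum of |A x| is at least about
(1 - sqrt (V / alpha)) sqrt m.

The comparison is made for finitely many unit vectors x_a and for a smooth
substitute of exp (- min), namely F = (sum_a exp (- q L_a))^(1/q), where
L_a = sqrt (1 + |A x_a + g|^2) + gamma + <h, x_a> and gamma is one more normal
variable.  A Gaussian average of F over one coordinate with standard deviation
s is F + (s^2/2) F'' + O(s^3 F), uniformly because log F is Lipschitz
([gavgs_taylor]).  Summed over the coordinates of (A, gamma), the second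
derivatives of F are at most their sum over the coordinates of (g, h): the
difference is governed by (1 - N) (1 - X) >= 0, where X = <x_a, x_b> and N is
the inner product of two vectors of norm at most 1 ([softmin_gordon]).  A
standard normal variable is a sum of 1/s^2 independent ones of standard
deviation s, and the averaging operators commute, so the infinitesimal
inequality can be used 1/s^2 times; the accumulated factor (1 + K s^3)^(1/s^2)
tends to 1 with s ([gavgs_comparison]).  Markov's inequality then
bounds the probability that some |A x_a| is small ([prob_small_le]), and the
extra gamma only helps, as E exp (- gamma) >= 1.

On the side of (g, h) no minimisation over supports is needed.  For every
k-sparse unit vector x, - <h, x> <= r/2 + k tau / (2r) + sum_j huber (h_j), a
sum of functions of single variables, so its exponential moment factors.  With
r = sqrt (n V) and tau = 2 e^2 the exponent is sqrt (n V) + O(1), because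
V = beta tau + E max (Z^2 - tau) 0 ([truncated_moment]).  A truncated Laplace
transform controls the event that |g| is well below sqrt m ([rhs_bound]).
The resulting bound does not depend on the number of vectors, so it passes to
a countable dense family in the sparse sphere ([min_l2norm_lt_prob]).  For xi
below the claimed constant, the probability that the minimum is below xi sqrt m
is exponentially small in sqrt m ([small_min_prob]), and the bound on the
expectation is Markov's inequality once more. *)

(** * Integration against the standard normal law *)

Section normal_integral.
Context {R : realType}.
Local Notation mu := (@lebesgue_measure R).
Local Notation nu := (normal_prob (0 : R) 1).
Local Notation phi := (normal_pdf (0 : R) 1).

(** The Radon-Nikodym derivative of the normal law agrees with the Gaussian
density almost everywhere, and integrals do not see the difference. *)
Lemma ge0_integral_normal (f : R -> \bar R) : (forall x, 0 <= f x)%E ->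
  measurable_fun setT f ->
  (\int[nu]_x f x = \int[mu]_x (f x * (phi x)%:E))%E.
Proof.
move=> f0 mf.
have dom := normal_prob_dominates (0 : R) 1.
rewrite -(Radon_Nikodym_SigmaFinite.change_of_variables dom)//.
set g := Radon_Nikodym_SigmaFinite.f _ _.
have ig : mu.-integrable setT g by exact: Radon_Nikodym_SigmaFinite.f_integrable.
have mphi : measurable_fun [set: R] (EFin \o phi).
  by apply/measurable_EFinP; exact: measurable_normal_pdf.
apply: ae_eq_integral => //.
- by apply: emeasurable_funM => //; exact: (measurable_int mu).
- exact: emeasurable_funM.
- apply: ae_eqe_mul2l => /=.
  apply: integral_ae_eq => //= E _ mE.
  by rewrite -Radon_Nikodym_SigmaFinite.f_integral.
Qed.

Lemma phiE (x : R) : phi x = normal_peak 1 * expR (- x ^+ 2 / 2).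
Proof. by rewrite normal_pdfE ?oner_neq0// /normal_fun subr0 expr1n. Qed.

(** Completing the square turns exp (l x) times the density into a
multiple of the density centred at l. *)
Lemma normal_mgf (l : R) :
  (\int[nu]_x (expR (l * x))%:E = (expR (l ^+ 2 / 2))%:E)%E.
Proof.
have mexp : measurable_fun setT (fun x : R => expR (l * x)).
  by apply: measurableT_comp => //; exact: mulrl_measurable.
rewrite ge0_integral_normal//; last exact/measurable_EFinP.
transitivity (\int[mu]_x ((expR (l ^+ 2 / 2))%:E * (normal_pdf l 1 x)%:E))%E.
  apply: eq_integral => x _; rewrite phiE -!EFinM normal_pdfE ?oner_neq0//.
  rewrite /normal_fun expr1n mulrCA [in RHS]mulrCA -!expRD; congr (_ * expR _)%:E.
  by field.
rewrite ge0_integralZl//; last 2 first.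
- by apply/measurable_EFinP; exact: measurable_normal_pdf.
- by move=> x _; rewrite lee_fin normal_pdf_ge0.
by rewrite integral_normal_pdf mule1.
Qed.

End normal_integral.

Section normal_expectation.
Context {R : realType}.
Local Notation nu := (normal_prob (0 : R) 1).
Implicit Types (f g : R -> R) (C K : R).

Definition nexp (f : R -> R) : R := \int[nu]_z f z.
Definition nint (f : R -> R) : Prop := nu.-integrable setT (EFin \o f).

Lemma measurable_expabs C : measurable_fun setT (fun z : R => expR (C * `|z|)).
Proof.
apply: measurableT_comp => //; exact: measurable_funM.
Qed.

Lemma nint_expM C : nint (fun z => expR (C * z)).
Proof.
have me : measurable_fun setT (fun z : R => expR (C * z)).
  by apply: measurableT_comp => //; exact: mulrl_measurable.
apply/integrableP; split; first exact/measurable_EFinP.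
under eq_integral do rewrite /= ger0_norm ?expR_ge0//.
by rewrite normal_mgf ltry.
Qed.

Lemma nint_dom g f : nint g -> measurable_fun setT f ->
  (forall z, `|f z| <= g z) -> nint f.
Proof.
move=> ig mf fg; apply: le_integrable ig => //; first exact/measurable_EFinP.
by move=> z _ /=; rewrite lee_fin (le_trans (fg z))// ler_norm.
Qed.

Lemma nintD f g : nint f -> nint g -> nint (fun z => f z + g z).
Proof. by move=> fi gi; have := integrableD measurableT fi gi. Qed.

Lemma nintB f g : nint f -> nint g -> nint (fun z => f z - g z).
Proof. by move=> fi gi; have := integrableB measurableT fi gi. Qed.

Lemma nintZ K f : nint f -> nint (fun z => K * f z).
Proof. by move=> fi; have := integrableZl measurableT K fi. Qed.

Lemma nint_cst K : nint (fun=> K).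
Proof.
apply: (nint_dom (nintZ `|K| (nint_expM 0))) => // z.
by rewrite mul0r expR0 mulr1.
Qed.

Lemma nint_expabs C : nint (fun z => expR (C * `|z|)).
Proof.
apply: (nint_dom (nintD (nint_expM C) (nint_expM (- C)))).
  exact: measurable_expabs.
move=> z; rewrite ger0_norm ?expR_ge0//.
case: (ger0P z) => _; rewrite -?mulNrN ?mulrN -?mulNr ?lerDl ?lerDr expR_ge0//.
Qed.

Lemma nint_growth K C f : measurable_fun setT f ->
  (forall z, `|f z| <= K * expR (C * `|z|)) -> nint f.
Proof. by move=> mf; apply: nint_dom => //; apply: nintZ; exact: nint_expabs. Qed.

Lemma nexpE f : nint f -> (\int[nu]_z (f z)%:E = (nexp f)%:E)%E.
Proof.
move=> fi; rewrite /nexp /Rintegral fineK//; exact: integrable_fin_num fi.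
Qed.

Lemma nexpD f g : nint f -> nint g ->
  nexp (fun z => f z + g z) = nexp f + nexp g.
Proof. by move=> fi gi; exact: RintegralD. Qed.

Lemma nexpB f g : nint f -> nint g ->
  nexp (fun z => f z - g z) = nexp f - nexp g.
Proof. by move=> fi gi; exact: RintegralB. Qed.

Lemma nexpZ K f : nint f -> nexp (fun z => K * f z) = K * nexp f.
Proof. by move=> fi; exact: RintegralZl. Qed.

Lemma le_nexp f g : nint f -> nint g -> (forall z, f z <= g z) ->
  nexp f <= nexp g.
Proof. by move=> fi gi fg; apply: le_Rintegral => // z _; exact: fg. Qed.

Lemma ler_norm_nexp f g : nint f -> nint g -> (forall z, `|f z| <= g z) ->
  `|nexp f| <= nexp g.
Proof.
move=> fi gi fg; apply: (le_trans (le_normr_Rintegral _ fi)) => //.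
by apply: le_nexp => //; exact: (integrable_norm fi).
Qed.

Lemma nexp_expM l : nexp (fun z => expR (l * z)) = expR (l ^+ 2 / 2).
Proof. by rewrite /nexp /Rintegral normal_mgf. Qed.

Lemma nexp_cst K : nexp (fun=> K) = K.
Proof.
transitivity (nexp (fun z => K * expR (0 * z))).
  by congr nexp; apply/funext => z; rewrite mul0r expR0 mulr1.
by rewrite nexpZ ?nexp_expM; [rewrite expr0n mul0r expR0 mulr1|exact: nint_expM].
Qed.

End normal_expectation.

(** * Taylor estimates in one variable *)

Section taylor.
Context {R : realType}.
Implicit Types (f g : R -> R).

Lemma lipschitz_from0 f f' (z M : R) :
  (forall x : R, is_derive x 1 f (f' x)) ->
  (forall x, `|x| <= `|z| -> `|f' x| <= M) -> `|f z - f 0| <= M * `|z|.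
Proof.
move=> df fM.
have cf (a b : R) : {within `[a, b], continuous f}.
  apply: derivable_within_continuous => x _.
  by have := df x => -[].
have dM (a b : R) : a <= b -> (forall x, x \in `[a, b] -> `|x| <= `|z|) ->
    `|f b - f a| <= M * (b - a).
  move=> ab xab.
  have [c cab ->] := MVT_segment ab (fun x _ => df x) (cf a b).
  by rewrite normrM (ger0_norm (x := b - a)) ?subr_ge0// ler_wpM2r ?subr_ge0// fM// xab.
have [z0|z0] := leP 0 z.
  have := dM _ _ z0; rewrite subr0 (ger0_norm z0); apply => x.
  by rewrite in_itv/= => /andP[x0 xz]; rewrite ger0_norm.
have := dM _ _ (ltW z0); rewrite sub0r distrC (ltr0_norm z0); apply => x.
by rewrite in_itv/= => /andP[xz x0]; rewrite ler0_norm// lerN2.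
Qed.

(** The increment of the second derivative is allowed to grow
exponentially, which is all that functions with Lipschitz logarithm provide;
two applications of the mean value theorem turn it into a cubic remainder. *)
Lemma taylor2 f f1 f2 (K C : R) : 0 <= K -> 0 <= C ->
  (forall x : R, is_derive x 1 f (f1 x)) ->
  (forall x : R, is_derive x 1 f1 (f2 x)) ->
  (forall x, `|f2 x - f2 0| <= K * `|x| * expR (C * `|x|)) ->
  forall z, `|f z - f 0 - z * f1 0 - z ^+ 2 / 2 * f2 0|
     <= K * `|z| ^+ 3 * expR (C * `|z|).
Proof.
move=> K0 C0 df df1 f2K z.
have mono (x y : R) : `|x| <= `|y| ->
    K * `|x| * expR (C * `|x|) <= K * `|y| * expR (C * `|y|).
  move=> xy; apply: ler_pM => //; rewrite ?mulr_ge0 ?expR_ge0//.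
    by rewrite ler_wpM2l.
  by rewrite ler_expR ler_wpM2l.
have r1 x : `|f1 x - f1 0 - x * f2 0| <= K * `|x| * expR (C * `|x|) * `|x|.
  have d (x0 : R) : is_derive x0 1 (fun y => f1 y - y * f2 0) (f2 x0 - f2 0).
    have := df1 x0 => d1.
    apply: is_derive_eq.
    by rewrite scaler0 add0r /GRing.scale/= mulr1.
  have := lipschitz_from0 (z := x) d.
  rewrite mul0r subr0 addrAC; apply => y yx.
  exact: le_trans (f2K y) (mono _ _ yx).
have d (x0 : R) : is_derive x0 1 (fun y => f y - y * f1 0 - y ^+ 2 / 2 * f2 0)
    (f1 x0 - f1 0 - x0 * f2 0).
  have := df x0 => d1.
  apply: is_derive_eq.
  rewrite !scaler0 !add0r /GRing.scale/=; by field.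
have := lipschitz_from0 (z := z) d.
rewrite mul0r expr0n/= !mul0r !subr0.
have -> : K * `|z| ^+ 3 * expR (C * `|z|)
   = (K * `|z| * expR (C * `|z|) * `|z|) * `|z| by ring.
have -> : f z - f 0 - z * f1 0 - z ^+ 2 / 2 * f2 0
   = f z - z * f1 0 - z ^+ 2 / 2 * f2 0 - f 0 by ring.
apply => x xz; apply: (le_trans (r1 x)).
by apply: ler_pM => //; rewrite ?mulr_ge0 ?expR_ge0// mono.
Qed.

Lemma expR_sub1_le (x : R) : `|expR x - 1| <= `|x| * expR `|x|.
Proof.
have := @lipschitz_from0 expR expR x (expR `|x|).
rewrite expR0 mulrC; apply => y yx.
by rewrite ger0_norm ?expR_ge0// ler_expR (le_trans (ler_norm _)).
Qed.

Lemma expR_taylor2 (x : R) :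
  `|expR x - 1 - x - x ^+ 2 / 2| <= `|x| ^+ 3 * expR `|x|.
Proof.
have := @taylor2 expR expR expR 1 1 ler01 ler01 _ _ _ x.
rewrite expR0 !mul1r !mulr1; apply => y.
by rewrite !mul1r; exact: expR_sub1_le.
Qed.

Lemma normX_le_expR n (z : R) : `|z| ^+ n <= expR (n%:R * `|z|).
Proof.
rewrite expRM_natl; apply: lerXn2r; rewrite ?nnegrE ?expR_ge0//.
by apply: le_trans (expR_ge1Dx _); rewrite lerDr.
Qed.

End taylor.

(** * Moments and stability of the standard normal law *)

Section moments.
Context {R : realType}.
Implicit Types (f g : R -> R) (C K : R).

Lemma nint_normX n C : nint (fun z : R => `|z| ^+ n * expR (C * `|z|)).
Proof.
apply: (@nint_growth _ 1 (n%:R + C)).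
  apply: measurable_funM; last exact: measurable_expabs.
  by apply: measurable_funX; exact: normr_measurable.
move=> z; rewrite mul1r mulrDl expRD normrM (ger0_norm (expR_ge0 _)).
by rewrite ler_wpM2r ?expR_ge0// normrX normr_id normX_le_expR.
Qed.

Lemma nint_X n : nint (fun z : R => z ^+ n).
Proof.
apply: (nint_dom (nint_normX n 0)); first exact: measurable_funX.
by move=> z; rewrite mul0r expR0 mulr1 normrX.
Qed.

Lemma nint_id : nint (fun z : R => z).
Proof. exact: (nint_X 1). Qed.

Definition abs3exp C : R := nexp (fun z => `|z| ^+ 3 * expR (C * `|z|)).

Lemma abs3exp_ge0 C : 0 <= abs3exp C.
Proof. by apply: Rintegral_ge0 => z _; rewrite mulr_ge0// expR_ge0. Qed.

Let small_moment (l : R) : `|l| <= 1 ->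
  `|l * nexp id + l ^+ 2 / 2 * (nexp (fun z => z ^+ 2) - 1)|
    <= (abs3exp 1 + expR 1) * `|l| ^+ 3.
Proof.
move=> l1.
have h1 : `|expR (l ^+ 2 / 2) - 1 - l * nexp id
      - l ^+ 2 / 2 * nexp (fun z => z ^+ 2)| <= abs3exp 1 * `|l| ^+ 3.
  rewrite -nexp_expM -[X in _ - X - _ * _ - _](nexp_cst 1).
  rewrite -(nexpZ l nint_id) -(nexpZ (l ^+ 2 / 2) (nint_X 2)).
  rewrite -nexpB; [|exact: nint_expM|exact: nint_cst].
  rewrite -nexpB; [|by apply: nintB;[exact: nint_expM|exact: nint_cst]|
    by apply: nintZ; exact: nint_id].
  have i2 : nint (fun z : R => l ^+ 2 / 2 * z ^+ 2) by apply: nintZ; exact: nint_X.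
  have i1 : nint (fun z : R => expR (l * z) - 1 - l * z).
    apply: nintB; last by apply: nintZ; exact: nint_id.
    by apply: nintB; [exact: nint_expM|exact: nint_cst].
  rewrite -nexpB// (mulrC (abs3exp 1)) -nexpZ; last exact: nint_normX.
  apply: ler_norm_nexp; first exact: nintB.
    by apply: nintZ; exact: nint_normX.
  move=> z; have := expR_taylor2 (l * z).
  rewrite exprMn mulrAC => /le_trans; apply.
  rewrite normrM exprMn -mulrA ler_wpM2l ?exprn_ge0// ler_wpM2l ?exprn_ge0//.
  by rewrite ler_expR ler_wpM2r.
have h2 : `|expR (l ^+ 2 / 2) - 1 - l ^+ 2 / 2| <= expR 1 * `|l| ^+ 3.
  have l2 : l ^+ 2 = `|l| ^+ 2 by rewrite real_normK// num_real.
  have e2 : 1 + 1 <= expR 1 :> R by exact: expR_ge1Dx.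
  have := expR_taylor2 (l ^+ 2 / 2); rewrite l2.
  have := normr_ge0 l; move: l1; set a := `|l| => a1 a0.
  have a20 : 0 <= a ^+ 2 by rewrite sqr_ge0.
  have a21 : a ^+ 2 <= 1 by rewrite expr_le1.
  have a30 : 0 <= a ^+ 3 by rewrite exprn_ge0.
  have a31 : a ^+ 3 <= 1 by rewrite expr_le1.
  rewrite (ger0_norm (x := a ^+ 2 / 2)) ?divr_ge0//.
  have ele : expR (a ^+ 2 / 2) <= expR 1 by rewrite ler_expR; lra.
  set X := expR (a ^+ 2 / 2) in ele *.
  have -> : (a ^+ 2 / 2) ^+ 3 * X = a ^+ 3 * (a ^+ 3 / 8 * X) by field.
  have -> : (a ^+ 2 / 2) ^+ 2 / 2 = a ^+ 3 * (a / 8) by field.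
  have h3 : a ^+ 3 / 8 * X <= expR 1 / 8.
    have : a ^+ 3 * X <= 1 * expR 1 by apply: ler_pM => //; exact: expR_ge0.
    by rewrite mul1r => ?; rewrite mulrAC ler_wpM2r.
  have h4 : a ^+ 3 * (a ^+ 3 / 8 * X) <= a ^+ 3 * (expR 1 / 8) by rewrite ler_wpM2l.
  have h5 : a ^+ 3 * (a / 8) <= a ^+ 3 * (1 / 8) by rewrite ler_wpM2l//; lra.
  have h6 : 0 <= a ^+ 3 * (a / 8) by rewrite mulr_ge0// divr_ge0.
  have h7 : a ^+ 3 * (1 + 1) <= a ^+ 3 * expR 1 by rewrite ler_wpM2l.
  by rewrite !ler_norml => /andP[? ?]; apply/andP; split; lra.
set a := nexp id in h1 *; set b := nexp _ in h1 *.
have -> : l * a + l ^+ 2 / 2 * (b - 1) =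
  (expR (l ^+ 2 / 2) - 1 - l ^+ 2 / 2) -
  (expR (l ^+ 2 / 2) - 1 - l * a - l ^+ 2 / 2 * b) by ring.
apply: (le_trans (ler_normB _ _)); rewrite mulrDl addrC; exact: lerD.
Qed.

Let zero_of_small (x M : R) : 0 <= M ->
  (forall l, 0 < l -> l <= 1 -> `|x| <= M * l) -> x = 0.
Proof.
move=> M0 h; apply/eqP; rewrite -normr_le0; apply/ler_addgt0Pr => e e0; rewrite add0r.
have M1 : 0 < M + 1 by lra.
have [h1|h1] := leP (e / (M + 1)) 1.
  apply: (le_trans (h _ _ h1)); first by rewrite divr_gt0.
  by rewrite mulrCA ler_piMr ?(ltW e0)// ler_pdivrMr ?mul1r//; lra.
apply: (le_trans (h 1 _ _)) => //.
by move: h1; rewrite ltr_pdivlMr// mul1r mulr1 => ?; lra.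
Qed.

(** Both moments are read off exp (l^2 / 2), the moment generating
function, by comparing it with its second order expansion at small l of either
sign. *)
Lemma normal_moments : nexp (id : R -> R) = 0 /\ nexp (fun z : R => z ^+ 2) = 1.
Proof.
set M := abs3exp 1 + expR 1; set a := nexp id; set b := nexp _.
have M0 : 0 <= M by rewrite addr_ge0 ?abs3exp_ge0 ?expR_ge0.
have hl l : 0 < l -> l <= 1 -> (`|l * a + l ^+ 2 / 2 * (b - 1)| <= M * l ^+ 3) /\
   (`|- l * a + l ^+ 2 / 2 * (b - 1)| <= M * l ^+ 3).
  move=> l0 l1; split.
    by have := @small_moment l; rewrite (gtr0_norm l0); exact.
  by have := @small_moment (- l); rewrite normrN (gtr0_norm l0) sqrrN; exact.
split; last first.
  apply/eqP; rewrite -subr_eq0; apply/eqP; apply: (@zero_of_small _ (2 * M)).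
    by rewrite mulr_ge0.
  move=> l l0 l1; have [h1 h2] := hl l l0 l1.
  have l20 : 0 < l ^+ 2 by rewrite exprn_gt0.
  have e : `|l ^+ 2 * (b - 1)| = l ^+ 2 * `|b - 1| by rewrite normrM gtr0_norm.
  suff : l ^+ 2 * `|b - 1| <= l ^+ 2 * (2 * M * l) by rewrite ler_pM2l.
  move: h1 h2; rewrite -e.
  have -> : l ^+ 2 * (2 * M * l) = M * l ^+ 3 + M * l ^+ 3 by ring.
  by rewrite !ler_norml => /andP[? ?] /andP[? ?]; apply/andP; split; lra.
apply: (@zero_of_small _ M) => // l l0 l1; have [h1 h2] := hl l l0 l1.
have e : `|l * a| = l * `|a| by rewrite normrM gtr0_norm.
have h3 : l * (M * l) >= M * l ^+ 3.
  have -> : l * (M * l) = M * l ^+ 2 by ring.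
  by rewrite ler_wpM2l// ler_wiXn2l// ltW.
suff : l * `|a| <= l * (M * l) by rewrite ler_pM2l.
move: h1 h2; rewrite -e.
by rewrite !ler_norml => /andP[? ?] /andP[? ?]; apply/andP; split; lra.
Qed.

End moments.

Section stability.
Context {R : realType}.
Local Notation mu := (@lebesgue_measure R).
Local Notation nu := (normal_prob (0 : R) 1).
Local Notation phi := (normal_pdf (0 : R) 1).

Lemma continuous_phi : continuous phi.
Proof. by apply: continuous_normal_pdf; exact: oner_neq0. Qed.

Lemma lin_derive1 (a b : R) : (fun w : R => a + b * w)^`()%classic = cst b.
Proof.
apply/funext => x; rewrite derive1E; apply: derive_val.
by apply: is_derive_eq; rewrite add0r mul1r /GRing.scale/= mulr1.
Qed.

Lemma substitution_affine (g : R -> R) (a b : R) : 0 < b ->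
  continuous g -> (forall x, 0 <= g x) ->
  (\int[mu]_y (g y)%:E = \int[mu]_w (g (a + b * w) * b)%:E)%E.
Proof.
move=> b0 cg g0.
have affE (w : R) : a + b * w = (w + a / b) * b.
  by rewrite mulrDl divfK ?gt_eqF// addrC mulrC.
rewrite (@increasing_ge0_integration_by_substitutionT _ (fun w => a + b * w) g)//.
- by apply: eq_integral => w _; rewrite lin_derive1.
- by move=> x y xy; rewrite ltrD2l ltr_pM2l.
- by rewrite lin_derive1 => ?; exact: cvg_cst.
- by rewrite lin_derive1; exact: is_cvg_cst.
- by rewrite lin_derive1; exact: is_cvg_cst.
- under eq_fun do rewrite affE.
  by apply: gt0_cvgMlNy => //; exact: cvg_addrr_Ny.
- under eq_fun do rewrite affE.
  by apply: gt0_cvgMly => //; exact: cvg_addrr.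
Qed.

(** The joint density of X and Y = a X + b W, written as the law of X times
the conditional law of Y, and as the law of Y times the conditional law of X:
Y is standard normal, and X given Y = y has mean a y and standard deviation
b. *)
Lemma phi_stable (a b x y : R) : 0 < b -> a ^+ 2 + b ^+ 2 = 1 ->
  phi x * (phi ((y - a * x) / b) / b) = phi y * normal_pdf (a * y) b x.
Proof.
move=> b0 ab; have b0' : b != 0 by rewrite gt_eqF.
rewrite !phiE normal_pdfE//.
have -> : normal_peak b = normal_peak 1 / b.
  rewrite /normal_peak expr1n mul1r -mulrnAr sqrtrM ?sqr_ge0// sqrtr_sqr.
  by rewrite gtr0_norm// invfM mulrC.
rewrite /normal_fun.
set p := normal_peak 1.
transitivity (p * p / b * (expR (- x ^+ 2 / 2) * expR (- ((y - a * x) / b) ^+ 2 / 2))).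
  by ring.
transitivity (p * p / b * (expR (- y ^+ 2 / 2) * expR (- (x - a * y) ^+ 2 / (b ^+ 2 *+ 2)))).
  rewrite -!expRD; congr (_ * expR _).
  have -> : (b ^+ 2 *+ 2) = 2 * b ^+ 2 by rewrite -mulr_natl.
  have a2 : a ^+ 2 = 1 - b ^+ 2 by rewrite -ab; ring.
  suff : (x ^+ 2 + ((y - a * x) / b) ^+ 2) = (y ^+ 2 + (x - a * y) ^+ 2 / b ^+ 2).
    move=> h; transitivity (- (x ^+ 2 + ((y - a * x) / b) ^+ 2) / 2); first by field.
    by rewrite h; field.
  rewrite expr_div_n; apply: (mulfI (_ : b ^+ 2 != 0)); first by rewrite expf_neq0.
  rewrite !mulrDr !(mulrC (b ^+ 2) (_ / _)) !divfK ?expf_neq0//.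
  rewrite !sqrrB !exprMn a2; ring.
by ring.
Qed.

Lemma continuous_affine (a b : R) : continuous (fun w : R => a + b * w).
Proof.
move=> x; apply: cvgD; first exact: cvg_cst.
by apply: cvgM; [exact: cvg_cst|exact: cvg_id].
Qed.

(** After an affine change of variable in the inner integral, Fubini's
theorem integrates first over X given Y, whose conditional density has total
mass one. *)
Lemma normal_stable (f : R -> R) (a b : R) : 0 < b -> a ^+ 2 + b ^+ 2 = 1 ->
  continuous f -> (forall x, 0 <= f x) ->
  (\int[nu]_x \int[nu]_w (f (a * x + b * w))%:E = \int[nu]_y (f y)%:E)%E.
Proof.
move=> b0 ab cf f0; have b0' : b != 0 by rewrite gt_eqF.
have mf : measurable_fun setT f by exact: continuous_measurable_fun.
have mphi : measurable_fun setT phi by exact: measurable_normal_pdf.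
pose G x y := f y * (phi ((y - a * x) / b) / b).
have G0 x y : 0 <= G x y.
  by rewrite mulr_ge0// divr_ge0 ?normal_pdf_ge0// ltW.
have inner x : (\int[nu]_w (f (a * x + b * w))%:E = \int[mu]_y (G x y)%:E)%E.
  rewrite ge0_integral_normal; last 2 first.
  - by move=> w; rewrite lee_fin.
  - apply/measurable_EFinP; apply: measurableT_comp => //.
    by apply: continuous_measurable_fun; exact: continuous_affine.
  rewrite [RHS](@substitution_affine (G x) (a * x) b)//.
    apply: eq_integral => w _; rewrite -EFinM /G.
    have -> : (a * x + b * w - a * x) / b = w by field.
    by rewrite -mulrA divfK.
  move=> y; apply: cvgM; first exact: cf.
  apply: cvgM; last exact: cvg_cst.
  apply: (@continuous_comp _ _ _ (fun y => (y - a * x) / b) phi); last exact: continuous_phi.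
  apply: cvgM; last exact: cvg_cst.
  by apply: cvgB; [exact: cvg_id|exact: cvg_cst].
have mG1 : measurable_fun setT (fun p : R * R => G p.1 p.2).
  apply: measurable_funM; first exact: measurableT_comp.
  apply: measurable_funM => //; apply: measurableT_comp => //.
  apply: measurable_funM => //; apply: measurable_funB => //.
  exact: measurable_funM.
have mG2 : measurable_fun setT (fun p : R * R => G p.1 p.2 * phi p.1).
  by apply: measurable_funM => //; exact: measurableT_comp.
under eq_integral do rewrite inner.
have mG : measurable_fun setT (fun p : R * R => (G p.1 p.2)%:E).
  exact/measurable_EFinP.
transitivity (\int[mu]_x ((\int[mu]_y (G x y)%:E) * (phi x)%:E))%E.
  apply: ge0_integral_normal.
  by move=> x; apply: integral_ge0 => y _; rewrite lee_fin.
  apply: (@measurable_fun_fubini_tonelli_F _ _ _ _ _ mu (fun p : R * R => (G p.1 p.2)%:E)) => //.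
  by move=> p; rewrite lee_fin.
transitivity (\int[mu]_x \int[mu]_y (G x y * phi x)%:E)%E.
  apply: eq_integral => x _; rewrite -ge0_integralZr//.
  - by apply/measurable_EFinP; exact: (measurableT_comp mG1 (pair1_measurable x)).
  - by move=> y _; rewrite lee_fin.
  - by rewrite lee_fin normal_pdf_ge0.
transitivity (\int[mu]_y \int[mu]_x (G x y * phi x)%:E)%E.
  apply: (@fubini_tonelli _ _ _ _ _ mu mu
    (fun p : R * R => (G p.1 p.2 * phi p.1)%:E)); first exact/measurable_EFinP.
  by move=> p; rewrite lee_fin mulr_ge0// normal_pdf_ge0.
rewrite ge0_integral_normal; last 2 first.
- by move=> y; rewrite lee_fin.
- exact/measurable_EFinP.
apply: eq_integral => y _.
transitivity (\int[mu]_x ((f y * phi y)%:E * (normal_pdf (a * y) b x)%:E))%E.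
  apply: eq_integral => x _; rewrite -EFinM /G -[in LHS]mulrA -[in RHS]mulrA; congr (_ * _)%:E.
  by rewrite mulrC phi_stable.
rewrite ge0_integralZl//.
- by rewrite integral_normal_pdf mule1.
- by apply/measurable_EFinP; exact: measurable_normal_pdf.
- by move=> x _; rewrite lee_fin normal_pdf_ge0.
- by rewrite lee_fin mulr_ge0// normal_pdf_ge0.
Qed.

End stability.

(** * The error function and the truncated second moment *)

Section erf_facts.
Context {R : realType}.
Local Notation mu := (@lebesgue_measure R).

Definition gint (a x : R) : R := \int[mu]_(s in `[a, x]) gauss_fun s.

Lemma gauss_integrable (a b : R) : mu.-integrable `[a, b] (EFin \o @gauss_fun R).
Proof. exact: (integrableS _ _ (subsetT _) integrableT_gauss). Qed.

Lemma is_derive_gint (a x : R) : a < x -> is_derive x 1 (gint a) (gauss_fun x).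
Proof.
move=> ax; have xx : x < x + 1 by rewrite ltrDl.
have [] := continuous_FTC1_closed xx (gauss_integrable a _) ax (@continuous_gauss_fun R x).
by move=> dx d1; split; [exact: dx|rewrite -d1 derive1E].
Qed.

Lemma gint_sub (x : R) : 0 <= x -> gint 0 x = gint (-1) x - gint (-1) 0.
Proof.
move=> x0; rewrite /gint (Rintegral_itvB (gauss_integrable (-1) x)) ?bnd_simp//.
rewrite Rintegral_itv_obnd_cbnd//.
exact: (integrableS _ _ (subsetT _) integrableT_gauss).
Qed.

Lemma erf_ge0E (x : R) : 0 <= x -> erf x = 2 / Num.sqrt pi * gint 0 x.
Proof. by move=> x0; rewrite /erf x0. Qed.

Lemma gint_cvg : (gint 0 n%:R @[n --> \oo] --> (Num.sqrt pi / 2 : R)).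
Proof.
have := @ge0_cvgn_integral R mu _ (@gauss_fun_ge0 R) (@measurable_gauss_fun R).
rewrite integral0y_gauss => h.
exact: (fine_cvg h).
Qed.

Lemma erf_surj01 (y : R) : 0 <= y < 1 -> exists2 x : R, 0 <= x & erf x = y.
Proof.
move=> /andP[y0 y1].
have sp : 0 < Num.sqrt pi :> R by rewrite sqrtr_gt0 pi_gt0.
have ylt : y * (Num.sqrt pi / 2) < Num.sqrt pi / 2.
  by rewrite -[ltRHS]mul1r ltr_pM2r// divr_gt0.
have [n _ /(_ n (leqnn n)) /= hn] := cvgr_gt _ gint_cvg _ ylt.
have [|||x] := @IVT R (gint 0) 0 n%:R (y * (Num.sqrt pi / 2)).
- exact: ler0n.
- exact: (parameterized_integral_continuous _ (gauss_integrable 0 _)).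
- have g0 : gint 0 0 = 0 by rewrite /gint set_itv1 Rintegral_set1.
  by rewrite g0 ge_min le_max (ltW hn) orbT andbT mulr_ge0// divr_ge0// ltW.
rewrite in_itv/= => /andP[x0 _] hx; exists x => //.
by rewrite erf_ge0E// hx; field; rewrite gt_eqF.
Qed.

Lemma erf_lt0_le0 (x : R) : x <= 0 -> erf x <= 0.
Proof.
move=> x0; rewrite /erf; case: ifPn => [x0'|_].
  have -> : x = 0 by apply/eqP; rewrite eq_le x0 x0'.
  by rewrite set_itv1 Rintegral_set1 mulr0.
rewrite mulrN oppr_le0 mulr_ge0 ?divr_ge0 ?sqrtr_ge0//.
by apply: Rintegral_ge0 => t _; exact: expR_ge0.
Qed.

(** The pseudo-inverse is a right inverse on the range of erf, which
contains [0, 1[ by the intermediate value theorem; erf is nonpositive on the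
negative half-line, whence the sign. *)
Lemma erfinv_spec (y : R) : 0 < y < 1 -> 0 < erfinv y /\ erf (erfinv y) = y.
Proof.
move=> /andP[y0 y1].
have [|x x0 xy] := @erf_surj01 y; first by rewrite ltW.
have e : erf (erfinv y) = y.
  by apply: pinvK; rewrite inE; exists x.
split => //; rewrite ltNge; apply/negP => /erf_lt0_le0.
by rewrite e leNgt y0.
Qed.

End erf_facts.

Section truncated_moment.
Context {R : realType}.
Local Notation mu := (@lebesgue_measure R).
Local Notation phi := (normal_pdf (0 : R) 1).

Lemma phi_gauss (z : R) : phi z = gauss_fun (z / Num.sqrt 2) / (Num.sqrt 2 * Num.sqrt pi).
Proof.
rewrite phiE mulrC /gauss_fun; congr (expR _ * _).
  by rewrite expr_div_n sqr_sqrtr// mulNr.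
by rewrite /normal_peak expr1n mul1r -mulr_natr mulrC sqrtrM.
Qed.

Lemma is_derive_phi (z : R) : is_derive z 1 phi (- z * phi z).
Proof.
rewrite (_ : phi = fun z => normal_peak 1 * expR (- z ^+ 2 / 2)); last first.
  by apply/funext => y; rewrite phiE.
apply: is_derive_eq.
by rewrite /GRing.scale/=; field.
Qed.

Section fixed_level.
Variable (e : R).
Hypothesis e0 : 0 < e.
Let s2 : R := Num.sqrt 2.
Let sp : R := Num.sqrt pi.
Let t := s2 * e.
Let s20 : 0 < s2. Proof. by rewrite sqrtr_gt0. Qed.
Let sp0 : 0 < sp. Proof. by rewrite sqrtr_gt0 pi_gt0. Qed.
Let t0 : 0 < t. Proof. by rewrite mulr_gt0. Qed.
Let t2 : t ^+ 2 = 2 * e ^+ 2. Proof. by rewrite exprMn sqr_sqrtr. Qed.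
(* The base point -1 makes the primitive differentiable at 0 as well. *)
Let U (z : R) : R := z * phi z + (t ^+ 2 - 1) / sp * gint (-1) (z / s2).

Let dU (z : R) : - s2 < z -> is_derive z 1 U ((t ^+ 2 - z ^+ 2) * phi z).
Proof.
move=> zs; have dphi := is_derive_phi z.
have hz : -1 < z / s2 by rewrite ltr_pdivlMr// mulN1r.
have dg : is_derive z 1 (fun z => gint (-1) (z / s2)) (gauss_fun (z / s2) * s2^-1).
  apply: (@is_derive1_comp _ (gint (-1)) (fun z => z / s2)).
    exact: is_derive_gint.
  by apply: is_derive_eq; rewrite scaler0 add0r /GRing.scale/= mulr1.
apply: is_derive_eq; rewrite !phi_gauss -/s2 -/sp /GRing.scale/=.
by field; rewrite !gt_eqF.
Qed.

Let int_half : (\int[mu]_(z in `[0%R, t]) ((t ^+ 2 - z ^+ 2) * phi z)%:E =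
  (t * phi t + (t ^+ 2 - 1) / 2 * erf e)%:E)%E.
Proof.
have s2N : - s2 < 0 by rewrite oppr_lt0.
have cU z : - s2 < z -> {for z, continuous U}.
  move=> /dU [dz _]; apply: differentiable_continuous.
  exact/derivable1_diffP.
rewrite (@continuous_FTC2 _ _ U)//.
- rewrite -EFinB; congr EFin; rewrite /U mul0r add0r mul0r.
  have -> : t / s2 = e by rewrite /t mulrC mulrA mulVf ?mul1r// gt_eqF.
  rewrite erf_ge0E ?(ltW e0)// gint_sub ?(ltW e0)// -/sp.
  by field; rewrite gt_eqF.
- apply: continuous_subspaceT => z; apply: cvgM; last exact: continuous_phi.
  by apply: cvgB; [exact: cvg_cst|exact: exprn_continuous].
- split.
  + move=> z; rewrite in_itv/= => /andP[z0 _].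
    by have [] := dU (lt_trans s2N z0).
  + by apply: cvg_at_right_filter; exact: cU.
  + by apply: cvg_at_left_filter; apply: cU; exact: lt_trans t0.
- move=> z; rewrite in_itv/= => /andP[z0 _].
  by rewrite derive1E; have [_ ->] := dU (lt_trans s2N z0).
Qed.

Let f (z : R) := Num.max (t ^+ 2 - z ^+ 2) 0.

Let cf : continuous f.
Proof.
move=> z; apply: (@continuous_max R R (fun z => t ^+ 2 - z ^+ 2) (fun=> 0) z).
  by apply: cvgB; [exact: cvg_cst|exact: exprn_continuous].
exact: cvg_cst.
Qed.

Let f0 z : 0 <= f z. Proof. by rewrite /f le_max lexx orbT. Qed.

Let int_full : (\int[normal_prob (0 : R) 1]_z (f z)%:E =
  (2 * (t * phi t) + (t ^+ 2 - 1) * erf e)%:E)%E.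
Proof.
rewrite ge0_integral_normal//; last first.
  by apply/measurable_EFinP; exact: continuous_measurable_fun.
transitivity (\int[mu]_z (f z * phi z)%:E)%E; first by [].
rewrite ge0_symfun_integralT//.
- have -> : (\int[mu]_(x in [set x | (0 <= x)%R]) (f x * phi x)%:E =
     \int[mu]_(z in `[0%R, t]) ((t ^+ 2 - z ^+ 2) * phi z)%:E)%E.
    rewrite -set_itvcy integral_mkcond [RHS]integral_mkcond.
    apply: eq_integral => z _; rewrite !patchE !mem_setE /= !in_itv/= andbT.
    have [z0|//] := leP 0 z; rewrite /f /=.
    have [zt|tz] := leP z t.
      by rewrite max_l// subr_ge0 ler_pXn2r ?nnegrE ?(ltW t0).
    by rewrite max_r ?mul0r// subr_le0 ler_pXn2r ?nnegrE ?(ltW t0) ?(ltW tz).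
  by rewrite int_half -EFinM; congr EFin; field.
- by move=> x; rewrite mulr_ge0// normal_pdf_ge0.
- by move=> z; apply: cvgM; [exact: cf|exact: continuous_phi].
- by move=> z /=; rewrite /f !phiE !sqrrN.
Qed.

(** Since phi' (z) = - z phi (z), the function (t^2 - z^2) phi has the
elementary primitive z phi + (t^2 - 1) int phi.  It gives the mean of
max (t^2 - Z^2) 0, and E (Z^2 - t^2) = 1 - t^2 converts it into the mean of
max (Z^2 - t^2) 0; here t^2 = 2 e^2. *)
Lemma truncated_moment :
  nexp (fun z : R => Num.max (z ^+ 2 - 2 * e ^+ 2) 0) =
  (1 - 2 * e ^+ 2) * (1 - erf e) + 2 * e / (sp * expR (e ^+ 2)).
Proof.
have fi : nint f.
  apply/integrableP; split.
    by apply/measurable_EFinP; exact: continuous_measurable_fun.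
  under eq_integral do rewrite /= ger0_norm//.
  by rewrite int_full ltry.
have zi : nint (fun z : R => z ^+ 2 - t ^+ 2).
  by apply: nintB; [exact: nint_X|exact: nint_cst].
transitivity (nexp (fun z => (z ^+ 2 - t ^+ 2) + f z)).
  congr nexp; apply/funext => z; rewrite -t2 /f.
  by have [h|h] := leP (t ^+ 2 - z ^+ 2) 0; have [h1|h1] := leP (z ^+ 2 - t ^+ 2) 0; lra.
rewrite nexpD// nexpB; [|exact: nint_X|exact: nint_cst].
rewrite normal_moments.2 nexp_cst.
have -> : nexp f = 2 * (t * phi t) + (t ^+ 2 - 1) * erf e.
  by rewrite /nexp /Rintegral int_full.
have -> : t * phi t = e / (sp * expR (e ^+ 2)).
  rewrite phi_gauss -/s2 -/sp /t.
  have -> : s2 * e / s2 = e by field; rewrite gt_eqF.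
  by rewrite /gauss_fun expRN; field; rewrite !gt_eqF ?expR_gt0.
by rewrite t2; ring.
Qed.

End fixed_level.
End truncated_moment.

(** * Functions with Lipschitz logarithm *)

Section nudge.
Context {R : realType} {I : eqType}.
Implicit Types (u v : I -> R) (i j : I) (f g : (I -> R) -> R).

Definition nudge u i (z : R) : I -> R := fun j => u j + (if j == i then z else 0).

Lemma nudge0 u i : nudge u i 0 = u.
Proof. by apply/funext => j; rewrite /nudge; case: ifP; rewrite addr0. Qed.

Lemma nudge_nudge u i a b : nudge (nudge u i a) i b = nudge u i (a + b).
Proof.
by apply/funext => j; rewrite /nudge; case: ifP => _; rewrite ?addr0 ?addrA.
Qed.

Lemma nudgeC u i j a b : nudge (nudge u i a) j b = nudge (nudge u j b) i a.
Proof. by apply/funext => k; rewrite /nudge addrAC. Qed.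

(** The logarithm of f is C-Lipschitz along each coordinate.  This single
condition yields measurability, integrability against Gaussian variables and
error terms proportional to f, and it survives averaging. *)
Definition loglip (C : R) f := [/\ 0 <= C, forall u, 0 < f u &
  forall u i z, f (nudge u i z) <= expR (C * `|z|) * f u].

Lemma loglip_ge (C : R) f : loglip C f -> forall u i z,
  expR (- (C * `|z|)) * f u <= f (nudge u i z).
Proof.
move=> [C0 f0 fC] u i z; have := fC (nudge u i z) i (- z).
rewrite nudge_nudge subrr nudge0 normrN => h.
by rewrite -(ler_pM2l (expR_gt0 (C * `|z|))) mulrA -expRD subrr expR0 mul1r.
Qed.

Lemma loglip_dist (C : R) f : loglip C f -> forall u i z,
  `|f (nudge u i z) - f u| <= C * `|z| * expR (C * `|z|) * f u.
Proof.
move=> fl u i z; have := loglip_ge fl u i z; have [C0 f0 /(_ u i z) h1 h2] := fl.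
have Cz0 : 0 <= C * `|z| by rewrite mulr_ge0.
have h3 : expR (C * `|z|) - 1 <= C * `|z| * expR (C * `|z|).
  have := expR_sub1_le (C * `|z|); rewrite (ger0_norm Cz0).
  exact: le_trans (ler_norm _).
have h4 : 1 - expR (- (C * `|z|)) <= C * `|z| * expR (C * `|z|).
  have := expR_ge1Dx (- (C * `|z|)) => h.
  apply: (@le_trans _ _ (C * `|z|)); first by lra.
  by rewrite ler_peMr// -expR0 ler_expR.
have := ler_wpM2r (ltW (f0 u)) h3; have := ler_wpM2r (ltW (f0 u)) h4.
by rewrite !mulrBl !mul1r ler_norml => ? ?; apply/andP; split; lra.
Qed.

Lemma loglipW C C' f : C <= C' -> loglip C f -> loglip C' f.
Proof.
move=> CC' [C0 f0 fC]; split => //; first exact: le_trans CC'.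
move=> u i z; apply: (le_trans (fC _ _ _)).
by rewrite ler_wpM2r ?(ltW (f0 _))// ler_expR ler_wpM2r.
Qed.

Lemma loglipD C f g : loglip C f -> loglip C g -> loglip C (fun u => f u + g u).
Proof.
move=> [C0 f0 fC] [_ g0 gC]; split=> // [u|u i z]; first by rewrite addr_gt0.
by rewrite mulrDr lerD.
Qed.

Lemma loglipZ C a f : 0 < a -> loglip C f -> loglip C (fun u => a * f u).
Proof.
move=> a0 [C0 f0 fC]; split=> // [u|u i z]; first by rewrite mulr_gt0.
by rewrite mulrCA ler_wpM2l// ltW.
Qed.

Lemma loglip_exp C f : 0 <= C -> (forall u i z, f (nudge u i z) <= f u + C * `|z|) ->
  loglip C (fun u => expR (f u)).
Proof.
move=> C0 fC; split=> // [u|u i z]; first exact: expR_gt0.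
by rewrite -expRD ler_expR addrC.
Qed.

Lemma loglipM C C' f g : loglip C f -> loglip C' g ->
  loglip (C + C') (fun u => f u * g u).
Proof.
move=> [C0 f0 fC] [C'0 g0 gC]; split=> [|u|u i z]; first exact: addr_ge0.
  exact: mulr_gt0.
rewrite mulrDl expRD mulrACA; apply: ler_pM => //; exact: ltW.
Qed.

End nudge.

Section loglip_finite.
Context {R : realType} {I : finType}.
Implicit Types (u v : I -> R) (i j : I) (f g : (I -> R) -> R) (s : seq I).

Lemma loglip_dist_all C f u v : loglip C f ->
  f u <= expR (C * \sum_i `|u i - v i|) * f v.
Proof.
move=> fl; have [C0 f0 fC] := fl.
pose mix s i := if i \in s then u i else v i.
have main s : uniq s -> f (mix s) <= expR (C * \sum_(i <- s) `|u i - v i|) * f v.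
  elim: s => [_|i s IH /= /andP[is_ us]].
    by rewrite big_nil mulr0 expR0 mul1r.
  rewrite big_cons mulrDr expRD -mulrA.
  have -> : mix (i :: s) = nudge (mix s) i (u i - v i).
    apply/funext => j; rewrite /mix /nudge inE.
    have [->|ji] /= := eqVneq j i; last by rewrite addr0.
    by rewrite (negbTE is_) addrC subrK.
  by apply: (le_trans (fC _ _ _)); rewrite ler_wpM2l ?expR_ge0// IH.
have := main (enum I) (enum_uniq _).
by rewrite big_enum; congr (f _ <= _); apply/funext => j; rewrite /mix mem_enum.
Qed.

(** f is the supremum over rational points r of the measurable functions
u |-> exp (- C |u - r|_1) f (r). *)
Lemma measurable_loglip d (T : measurableType d) C f (X : I -> T -> R) :
  loglip C f -> (forall i, measurable_fun setT (X i)) ->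
  measurable_fun setT (fun w => f (fun i => X i w)).
Proof.
move=> fl mX; have [C0 f0 _] := fl.
pose rt (r : {ffun I -> rat}) : I -> R := fun i => ratr (r i).
pose g (r : {ffun I -> rat}) (w : T) : R :=
  expR (- (C * \sum_i `|X i w - rt r i|)) * f (rt r).
have mg r : measurable_fun setT (g r).
  apply: measurable_funM => //; apply: measurableT_comp => //.
  apply: measurableT_comp => //; apply: measurable_funM => //.
  by apply: measurable_sum => i; apply: measurableT_comp => //; exact: measurable_funB.
have gf r w : g r w <= f (fun i => X i w).
  rewrite /g expRN -(ler_pM2l (expR_gt0 (C * \sum_i `|X i w - rt r i|))).
  rewrite mulrA mulfV ?mul1r ?gt_eqF ?expR_gt0//.
  have := loglip_dist_all (rt r) (fun i => X i w) fl.
  by under eq_bigr do rewrite distrC.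
move=> _; apply: (measurability _ (RGenOInfty.measurableE R)) => //.
move=> /= _ [_ [a ->] <-]; rewrite setTI.
have -> : (fun w => f (fun i => X i w)) @^-1` `]a, +oo[%classic
    = \bigcup_(r in setT) (g r @^-1` `]a, +oo[%classic).
  apply/seteqP; split => [w|w [r _]] /=; rewrite !in_itv/= !andbT; last first.
    by move=> h; exact: lt_le_trans (gf r w).
  move=> h; set fw := f _ in h.
  have fw0 : 0 < fw by exact: f0.
  (* The accuracy del makes the loss from passing to a rational point and
     back smaller than the margin f - a. *)
  pose N : R := 2 * C * #|I|%:R + 1.
  have N0 : 0 < N by rewrite ltr_wpDl// !mulr_ge0.
  pose del := (fw - a) / (fw * N).
  have del0 : 0 < del by rewrite divr_gt0 ?subr_gt0// mulr_gt0.
  have ex i : {q : rat | `|X i w - ratr q| <= del}.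
    apply: cid; have [|q] := @rat_in_itvoo R (X i w - del) (X i w + del).
      by rewrite ltrBlDr -addrA ltrDl addr_gt0.
    rewrite in_itv/= => /andP[h1 h2]; exists q.
    by rewrite ler_norml; apply/andP; split; lra.
  exists [ffun i => sval (ex i)] => //=; rewrite in_itv/= andbT.
  set r := [ffun i => _].
  have sr : C * \sum_i `|X i w - rt r i| <= C * #|I|%:R * del.
    rewrite -mulrA ler_wpM2l//; apply: (@le_trans _ _ (\sum_(i : I) del)).
      by apply: ler_sum => i _; rewrite /rt ffunE; exact: (svalP (ex i)).
    by rewrite sumr_const mulr_natl.
  have := loglip_dist_all (fun i => X i w) (rt r) fl; rewrite -/fw => hfw.
  set S := C * _ in sr hfw.
  have e1 : expR (- S) * fw <= f (rt r).
    rewrite -(ler_pM2l (expR_gt0 S)) mulrA -expRD subrr expR0 mul1r.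
    exact: hfw.
  have e2 : expR (- S) * (expR (- S) * fw) <= g r w.
    by rewrite /g ler_wpM2l ?expR_ge0.
  apply: lt_le_trans e2; rewrite mulrA -expRD.
  have e3 : (1 - (S + S)) * fw <= expR (- S - S) * fw.
    by rewrite ler_pM2r//; apply: le_trans (expR_ge1Dx _); lra.
  apply: lt_le_trans e3.
  suff : (S + S) * fw < fw - a by rewrite mulrBl mul1r; lra.
  apply: (@lt_le_trans _ _ (N * del * fw)).
    rewrite ltr_pM2r// /N mulrDl mul1r.
    have -> : 2 * C * #|I|%:R * del = C * #|I|%:R * del + C * #|I|%:R * del by ring.
    by lra.
  by rewrite /del le_eqVlt; apply/orP; left; apply/eqP; field; rewrite !gt_eqF.
apply: countable_bigcupT_measurable; first exact: countableP.
by move=> r; have := mg r measurableT _ (measurable_itv `]a, +oo[); rewrite setTI.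
Qed.

End loglip_finite.

(** * Gaussian averaging operators *)

Section gavg.
Context {R : realType} {I : finType}.
Local Notation nu := (normal_prob (0 : R) 1).
Implicit Types (u v : I -> R) (i j : I) (f g : (I -> R) -> R).

Definition gavg (s : R) i f u : R := nexp (fun z => f (nudge u i (s * z))).

Lemma measurable_nudge f C u i d (T : measurableType d) (h : T -> R) :
  loglip C f -> measurable_fun setT h ->
  measurable_fun setT (fun w => f (nudge u i (h w))).
Proof.
move=> fl mh; apply: (measurable_loglip (X := fun j w => u j + (if j == i then h w else 0)) fl).
by move=> j; apply: measurable_funD => //; case: (j == i).
Qed.

Lemma loglip_nint C f u i s : loglip C f ->
  nint (fun z => f (nudge u i (s * z))).
Proof.
move=> fl; have [C0 f0 fC] := fl.
apply: (@nint_growth _ (f u) (C * `|s|)).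
  apply: (measurable_nudge u i fl); exact: mulrl_measurable.
by move=> z; rewrite gtr0_norm// -[C * _ * _]mulrA -normrM [leRHS]mulrC.
Qed.

Lemma nexp_jensen (h : R -> R) : nint h -> nint (fun z => expR (h z)) ->
  expR (nexp h) <= nexp (fun z => expR (h z)).
Proof.
move=> hi ei; set m := nexp h.
have ii : nint (fun z => 1 - m + h z) by apply: nintD => //; exact: nint_cst.
apply: (@le_trans _ _ (nexp (fun z => expR m * (1 - m + h z)))).
  rewrite nexpZ//.
  have -> : nexp (fun z => 1 - m + h z) = nexp (fun=> 1 - m) + m.
    by apply: nexpD => //; exact: nint_cst.
  by rewrite nexp_cst subrK mulr1.
apply: le_nexp => [||z] //; first exact: nintZ.
have := expR_ge1Dx (h z - m); rewrite -(ler_pM2l (expR_gt0 m)) -expRD.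
by rewrite (addrC m) subrK (addrC (h z)) addrA.
Qed.

(** Averages commute with translations, so the Lipschitz constant of the
logarithm is kept; positivity comes from Jensen's inequality applied to the
exponential lower bound of f. *)
Lemma gavg_loglip C f s i : loglip C f -> loglip C (gavg s i f).
Proof.
move=> fl; have [C0 f0 fC] := fl.
split => // [u|u j z].
  pose h (z : R) := (- (C * `|s|)) * `|z|.
  have hi : nint h.
    apply: nintZ; apply: (nint_dom (nint_expabs 1)); first exact: normr_measurable.
    by move=> z; rewrite normr_id mul1r -[X in X <= _]expr1 -[X in expR X]mul1r normX_le_expR.
  have ei : nint (fun z => expR (h z)) by exact: nint_expabs.
  apply: (@lt_le_trans _ _ (f u * expR (nexp h))); first by rewrite mulr_gt0 ?expR_gt0.
  apply: (@le_trans _ _ (nexp (fun z => f u * expR (h z)))).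
    by rewrite nexpZ// ler_wpM2l ?(ltW (f0 u))// nexp_jensen.
  apply: le_nexp => [||z]; [exact: nintZ|exact: loglip_nint fl|].
  by rewrite mulrC /h mulNr -mulrA -normrM; exact: loglip_ge.
rewrite /gavg -nexpZ; last exact: loglip_nint fl.
apply: le_nexp => [||w]; first exact: loglip_nint fl.
  by apply: nintZ; exact: loglip_nint fl.
by rewrite nudgeC.
Qed.

Lemma continuous_loglip C f u i (s : R) : loglip C f ->
  continuous (fun z => f (nudge u i (s * z))).
Proof.
move=> fl z0; have [C0 f0 fC] := fl.
set v := nudge u i (s * z0).
have e z : f (nudge u i (s * z)) = f (nudge v i (s * (z - z0))).
  by rewrite /v nudge_nudge; congr (f (nudge _ _ _)); ring.
have cn : (fun z => C * `|s * (z - z0)|) @ z0 --> (0 : R).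
  have -> : (0 : R) = C * `|s * (z0 - z0)| by rewrite subrr mulr0 normr0 mulr0.
  apply: cvgM; first exact: cvg_cst.
  apply: cvg_norm; apply: cvgM; first exact: cvg_cst.
  by apply: cvgB; [exact: cvg_id|exact: cvg_cst].
apply: (@squeeze_cvgr _ _ _ _ (fun z => expR (- (C * `|s * (z - z0)|)) * f v)
   (fun z => expR (C * `|s * (z - z0)|) * f v)).
- by apply: nearW => z; rewrite e (loglip_ge fl) fC.
- rewrite -[X in _ --> X](mul1r (f v)); apply: cvgM; last exact: cvg_cst.
  have cn' : (fun z => - (C * `|s * (z - z0)|)) @ z0 --> (0 : R).
    by rewrite -oppr0; exact: cvgN.
  by rewrite -expR0; apply: (cvg_comp _ _ cn'); exact: continuous_expR.
- rewrite -[X in _ --> X](mul1r (f v)); apply: cvgM; last exact: cvg_cst.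
  by rewrite -expR0; apply: (cvg_comp _ _ cn); exact: continuous_expR.
Qed.

(** The sum of two independent normal variables is normal. *)
Lemma gavg_add C f s t r i u : loglip C f -> 0 < t -> 0 < r ->
  s ^+ 2 + t ^+ 2 = r ^+ 2 -> gavg s i (gavg t i f) u = gavg r i f u.
Proof.
move=> fl t0 r0 str; have [C0 f0 fC] := fl.
have gl := gavg_loglip t i fl.
apply: EFin_inj; rewrite -nexpE; last exact: loglip_nint gl.
rewrite /gavg -nexpE; last exact: loglip_nint fl.
rewrite -(@normal_stable _ (fun z => f (nudge u i (r * z))) (s / r) (t / r)).
- apply: eq_integral => x _; rewrite /gavg -nexpE; last exact: loglip_nint fl.
  apply: eq_integral => w _; rewrite nudge_nudge mulrDr !mulrA.
  by congr (f (nudge _ _ (_ + _)))%:E; field; rewrite gt_eqF.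
- exact: divr_gt0.
- by rewrite !expr_div_n -mulrDl str mulfV// expf_neq0// gt_eqF.
- exact: continuous_loglip fl.
- by move=> z; exact: ltW.
Qed.

(** Fubini's theorem. *)
Lemma gavgC C f s t i j u : loglip C f ->
  gavg s i (gavg t j f) u = gavg t j (gavg s i f) u.
Proof.
move=> fl; have [C0 f0 fC] := fl.
have gl := gavg_loglip t j fl; have gl' := gavg_loglip s i fl.
apply: EFin_inj; rewrite -nexpE; last exact: loglip_nint gl.
rewrite -nexpE; last exact: loglip_nint gl'.
pose F (p : R * R) := f (nudge (nudge u i (s * p.1)) j (t * p.2)).
have mF : measurable_fun setT F.
  apply: (measurable_loglip (X := fun k (p : R * R) =>
     u k + (if k == i then s * p.1 else 0) + (if k == j then t * p.2 else 0)) fl).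
  move=> k; apply: measurable_funD; first apply: measurable_funD => //.
    by case: (_ == _) => //; exact: measurable_funM.
  by case: (_ == _) => //; exact: measurable_funM.
transitivity (\int[nu]_x \int[nu]_y (F (x, y))%:E)%E.
  by apply: eq_integral => x _; rewrite /gavg -nexpE//; exact: loglip_nint fl.
transitivity (\int[nu]_y \int[nu]_x (F (x, y))%:E)%E.
  apply: (@fubini_tonelli _ _ _ _ _ nu nu (fun p => (F p)%:E)).
    exact/measurable_EFinP.
  by move=> p; rewrite lee_fin; exact: ltW (f0 _).
apply: eq_integral => y _; rewrite /gavg -nexpE; last exact: loglip_nint fl.
by apply: eq_integral => x _; rewrite /F nudgeC.
Qed.

Lemma gavgD C f g s i u : loglip C f -> loglip C g ->
  gavg s i (fun v => f v + g v) u = gavg s i f u + gavg s i g u.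
Proof. by move=> fl gl; apply: nexpD; [exact: loglip_nint fl|exact: loglip_nint gl]. Qed.

Lemma gavgZ C f a s i u : loglip C f ->
  gavg s i (fun v => a * f v) u = a * gavg s i f u.
Proof. by move=> fl; apply: nexpZ; exact: loglip_nint fl. Qed.

Lemma le_gavg C f g s i u : loglip C f -> loglip C g ->
  (forall z, f (nudge u i z) <= g (nudge u i z)) ->
  gavg s i f u <= gavg s i g u.
Proof.
by move=> fl gl fg; apply: le_nexp => [||z]; [exact: loglip_nint fl|exact: loglip_nint gl|].
Qed.

Definition gavgs (s : R) (l : seq I) f : (I -> R) -> R := foldr (gavg s) f l.

Lemma gavgs_loglip C f s l : loglip C f -> loglip C (gavgs s l f).
Proof. by move=> fl; elim: l => //= i l IH; exact: gavg_loglip. Qed.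

Lemma gavgs_cat f s l1 l2 : gavgs s (l1 ++ l2) f = gavgs s l1 (gavgs s l2 f).
Proof. by rewrite /gavgs foldr_cat. Qed.

Lemma gavg_gavgsC C f s t i l : loglip C f ->
  gavg s i (gavgs t l f) = gavgs t l (gavg s i f).
Proof.
move=> fl; elim: l => //= j l IH; rewrite -IH; apply/funext => u.
by apply: gavgC; exact: gavgs_loglip fl.
Qed.

Lemma gavgsC C f s t l1 l2 : loglip C f ->
  gavgs s l1 (gavgs t l2 f) = gavgs t l2 (gavgs s l1 f).
Proof.
move=> fl; elim: l1 => //= j l IH; rewrite IH.
by apply: gavg_gavgsC; exact: gavgs_loglip fl.
Qed.

Lemma gavgs_add C f s t r l : loglip C f -> 0 < t -> 0 < r ->
  s ^+ 2 + t ^+ 2 = r ^+ 2 -> gavgs s l (gavgs t l f) = gavgs r l f.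
Proof.
move=> fl t0 r0 str; elim: l => //= i l IH; rewrite -IH.
rewrite -(gavg_gavgsC t s i l (gavgs_loglip t l fl)).
apply/funext => u; apply: gavg_add => //.
by apply: gavgs_loglip; exact: gavgs_loglip fl.
Qed.

Lemma gavgsZ C f a s l : loglip C f ->
  gavgs s l (fun v => a * f v) = (fun v => a * gavgs s l f v).
Proof.
move=> fl; elim: l => //= i l ->; apply/funext => u.
by apply: gavgZ; exact: gavgs_loglip fl.
Qed.

Lemma gavgsD C f g s l : loglip C f -> loglip C g ->
  gavgs s l (fun v => f v + g v) = (fun v => gavgs s l f v + gavgs s l g v).
Proof.
move=> fl gl; elim: l => //= i l ->; apply/funext => u.
by apply: (@gavgD C); exact: gavgs_loglip.
Qed.

(** Averaging over l only evaluates f at points reached by moving the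
coordinates in l, so the inequality is needed on a set closed under these
moves and nowhere else. *)
Lemma le_gavgs_on C f g s l (Q : (I -> R) -> Prop) : loglip C f -> loglip C g ->
  (forall u i z, i \in l -> Q u -> Q (nudge u i z)) ->
  (forall u, Q u -> f u <= g u) ->
  forall u, Q u -> gavgs s l f u <= gavgs s l g u.
Proof.
move=> fl gl; elim: l => [//|i l IH] Ql fg u Qu /=.
apply: (@le_gavg C); [exact: gavgs_loglip|exact: gavgs_loglip|move=> z].
apply: IH => //.
  by move=> v j y jl; apply: Ql; rewrite inE jl orbT.
by apply: Ql; rewrite ?mem_head.
Qed.

Lemma le_gavgs C f g s l : loglip C f -> loglip C g ->
  (forall u, f u <= g u) -> forall u, gavgs s l f u <= gavgs s l g u.
Proof. by move=> fl gl fg u; apply: (@le_gavgs_on C f g s l (fun=> True)). Qed.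

End gavg.

(** * Comparison of two families of coordinates *)

Section swap.
Context {R : realType} {I : finType}.
Implicit Types (u v : I -> R) (i j : I) (f g b : (I -> R) -> R) (l : seq I).

(** A sign-free companion of log-Lipschitz functions, relative to a
positive weight g: the form in which second derivatives of g are controlled by
g itself. *)
Definition lipw C g b := (forall u, `|b u| <= C * g u) /\
  (forall u i z, `|b (nudge u i z) - b u| <= C * `|z| * expR (C * `|z|) * g u).

(** A multiple of g makes b positive with Lipschitz logarithm, so that b
inherits measurability and integrability as a difference of two such
functions. *)
Lemma lipw_loglip C g b : loglip C g -> lipw C g b ->
  exists C', loglip C' (fun u => b u + (C + 1) * g u).
Proof.
move=> gl [b1 b2]; have [C0 g0 gC] := gl.
pose D := C * (C + 2); have D0 : 0 <= D by rewrite mulr_ge0// addr_ge0.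
have gF u : g u <= b u + (C + 1) * g u.
  by have := b1 u; rewrite ler_norml => /andP[h _]; rewrite mulrDl mul1r; lra.
exists (D + C); split => [|u|u i z]; first exact: addr_ge0.
  exact: lt_le_trans (gF u).
set F := b u + _.
have F0 : 0 <= F by rewrite (le_trans _ (gF u))// ltW.
have x0 : 0 <= `|z| by [].
set x := `|z| in x0 *.
have e0 : 0 <= x * expR (C * x) by rewrite mulr_ge0// expR_ge0.
have h1 : b (nudge u i z) + (C + 1) * g (nudge u i z) <=
    F + D * (x * expR (C * x)) * g u.
  have := b2 u i z; have := loglip_dist gl u i z.
  rewrite -/x !ler_norml => /andP[_ h2] /andP[_ h3].
  have h4 : (C + 1) * (g (nudge u i z) - g u) <= (C + 1) * (C * x * expR (C * x) * g u).
    by rewrite ler_wpM2l// addr_ge0.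
  rewrite /F /D; lra.
apply: (le_trans h1); apply: (@le_trans _ _ (F + D * (x * expR (C * x)) * F)).
  by rewrite lerD2l ler_wpM2l// mulr_ge0.
have -> : F + D * (x * expR (C * x)) * F = (1 + D * x * expR (C * x)) * F by ring.
rewrite ler_wpM2r//; apply: (@le_trans _ _ ((1 + D * x) * expR (C * x))).
  by rewrite mulrDl mul1r lerD2r -expR0 ler_expR mulr_ge0.
by rewrite [(D + C) * _]mulrDl expRD ler_wpM2r ?expR_ge0// expR_ge1Dx.
Qed.

Lemma lipw_nint C g b u i s : loglip C g -> lipw C g b ->
  nint (fun z => b (nudge u i (s * z))).
Proof.
move=> gl bl; have [C' fl] := lipw_loglip gl bl.
have i1 := loglip_nint u i s fl.
have i2 := nintZ (C + 1) (loglip_nint u i s gl).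
have := nintB i1 i2; congr nint; apply/funext => z; ring.
Qed.

Lemma lipwD C g b b' : loglip C g -> lipw C g b -> lipw C g b' ->
  lipw (2 * C) g (fun u => b u + b' u).
Proof.
move=> [C0 g0 _] [b1 b2] [b1' b2']; split => [u|u i z].
  by rewrite (le_trans (ler_normD _ _))// (le_trans (lerD (b1 u) (b1' u)))//; lra.
rewrite opprD addrACA (le_trans (ler_normD _ _))//.
apply: (le_trans (lerD (b2 u i z) (b2' u i z))).
have -> : forall a c d e : R, a * c * d * e + a * c * d * e = 2 * a * c * d * e by move=> *; ring.
rewrite ler_wpM2r ?(ltW (g0 u))// ler_wpM2l ?mulr_ge0// ler_expR ler_wpM2r//; lra.
Qed.

Lemma lipwW C C' g b : 0 <= C -> (forall u, 0 < g u) -> C <= C' ->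
  lipw C g b -> lipw C' g b.
Proof.
move=> C0 g0 CC' [b1 b2]; split => [u|u i z].
  by rewrite (le_trans (b1 u))// ler_wpM2r// ltW.
apply: (le_trans (b2 u i z)); rewrite ler_wpM2r ?(ltW (g0 u))//.
by apply: ler_pM; rewrite ?mulr_ge0 ?expR_ge0 ?ler_wpM2r// ler_expR ler_wpM2r.
Qed.

Variables (C : R) (F : (I -> R) -> R) (D H : I -> (I -> R) -> R).
Hypothesis Fl : loglip C F.
Hypothesis dF : forall i u (z : R),
  is_derive z 1 (fun z => F (nudge u i z)) (D i (nudge u i z)).
Hypothesis dD : forall i u (z : R),
  is_derive z 1 (fun z => D i (nudge u i z)) (H i (nudge u i z)).
Hypothesis Hl : forall i, lipw C F (H i).

Let C0 : 0 <= C. Proof. by case: Fl. Qed.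
Let F0 u : 0 < F u. Proof. by case: Fl. Qed.

(** The linear term disappears because the normal law is centred, and its
unit variance gives the coefficient s^2 / 2. *)
Lemma gavg_taylor s i u : 0 <= s <= 1 ->
  `|gavg s i F u - F u - s ^+ 2 / 2 * H i u| <= C * abs3exp C * s ^+ 3 * F u.
Proof.
move=> /andP[s0 s1].
have Fi := loglip_nint u i s Fl.
have [m1 m2] := @normal_moments R.
pose r z := F (nudge u i (s * z)) - F u - s * D i u * z - s ^+ 2 / 2 * H i u * z ^+ 2.
have i1 : nint (fun z : R => s * D i u * z) by apply: nintZ; exact: nint_id.
have i2 : nint (fun z : R => s ^+ 2 / 2 * H i u * z ^+ 2) by apply: nintZ; exact: nint_X.
have i3 : nint (fun z => F (nudge u i (s * z)) - F u) by apply: nintB => //; exact: nint_cst.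
have i4 := nintB i3 i1.
have -> : gavg s i F u - F u - s ^+ 2 / 2 * H i u = nexp r.
  rewrite /r (nexpB i4 i2) (nexpB i3 i1) (nexpB Fi (nint_cst _)) nexp_cst.
  rewrite (nexpZ _ (nint_X 2)) (nexpZ _ nint_id) m2.
  by move: m1; rewrite /nexp => ->; rewrite mulr0 subr0 mulr1.
have i5 : nint (fun z => C * s ^+ 3 * F u * (`|z| ^+ 3 * expR (C * `|z|))).
  by apply: nintZ; exact: nint_normX.
have -> : C * abs3exp C * s ^+ 3 * F u =
    nexp (fun z => C * s ^+ 3 * F u * (`|z| ^+ 3 * expR (C * `|z|))).
  by rewrite nexpZ; [rewrite -/(abs3exp C); ring|exact: nint_normX].
apply: ler_norm_nexp => // [|z]; first exact: nintB.
have := @taylor2 R (fun y => F (nudge u i y)) (fun y => D i (nudge u i y))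
  (fun y => H i (nudge u i y)) (C * F u) C _ C0 (dF i u) (dD i u) _ (s * z).
rewrite nudge0 => h; rewrite /r.
have -> : F (nudge u i (s * z)) - F u - s * D i u * z - s ^+ 2 / 2 * H i u * z ^+ 2 =
  F (nudge u i (s * z)) - F u - s * z * D i u - (s * z) ^+ 2 / 2 * H i u by field.
apply: (le_trans (h _ _)).
- by rewrite mulr_ge0// ltW.
- by move=> x; apply: (le_trans ((Hl i).2 u i x)); rewrite le_eqVlt; apply/orP; left; apply/eqP; ring.
rewrite normrM (ger0_norm s0) exprMn.
have -> : C * F u * (s ^+ 3 * `|z| ^+ 3) * expR (C * (s * `|z|)) =
  C * s ^+ 3 * F u * (`|z| ^+ 3 * expR (C * (s * `|z|))) by ring.
rewrite ler_wpM2l ?mulr_ge0 ?exprn_ge0 ?(ltW (F0 u))// ler_wpM2l ?exprn_ge0//.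
by rewrite ler_expR ler_wpM2l// ler_piMl.
Qed.

Definition abs0exp : R := nexp (fun z : R => expR (C * `|z|)).

Let abs0exp_ge0 : 0 <= abs0exp.
Proof. by apply: Rintegral_ge0 => z _; rewrite expR_ge0. Qed.

Lemma gavg_lipw_dist C' b s i u : 0 <= s <= 1 -> loglip C' F -> lipw C' F b ->
  `|gavg s i b u - b u| <=
  C' * s * nexp (fun z : R => `|z| ^+ 1 * expR (C' * `|z|)) * F u.
Proof.
move=> /andP[s0 s1] Fl' bl; have [C'0 _ _] := Fl'.
have bi := lipw_nint u i s Fl' bl.
have -> : gavg s i b u - b u = nexp (fun z => b (nudge u i (s * z)) - b u).
  by rewrite nexpB ?nexp_cst//; exact: nint_cst.
have -> : C' * s * nexp (fun z : R => `|z| ^+ 1 * expR (C' * `|z|)) * F u =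
    nexp (fun z => (C' * s * F u) * (`|z| ^+ 1 * expR (C' * `|z|))).
  by rewrite nexpZ; [ring|exact: nint_normX].
apply: ler_norm_nexp => [||z]; first by apply: nintB => //; exact: nint_cst.
  by apply: nintZ; exact: nint_normX.
apply: (le_trans (bl.2 u i (s * z))); rewrite normrM (ger0_norm s0) expr1.
have -> : C' * (s * `|z|) * expR (C' * (s * `|z|)) * F u =
  C' * s * F u * (`|z| * expR (C' * (s * `|z|))) by ring.
rewrite ler_wpM2l ?mulr_ge0 ?(ltW (F0 u))// ler_wpM2l//.
by rewrite ler_expR ler_wpM2l// ler_piMl.
Qed.

Lemma gavg_le s i u : 0 <= s <= 1 -> gavg s i F u <= abs0exp * F u.
Proof.
move=> /andP[s0 s1]; rewrite mulrC -nexpZ; last exact: nint_expabs.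
apply: le_nexp => [||z]; first exact: loglip_nint Fl.
  by apply: nintZ; exact: nint_expabs.
have [_ _ h] := Fl; apply: (le_trans (h _ _ _)).
rewrite mulrC ler_wpM2l ?(ltW (F0 u))// ler_expR ler_wpM2l// normrM (ger0_norm s0).
by rewrite ler_piMl.
Qed.

(** One coordinate at a time.  The remainder of the earlier steps is
averaged along with F and stays proportional to F; replacing the average of a
second derivative by its value costs one more factor s, hence again s^3. *)
Lemma gavgs_taylor l : exists K : R, 0 <= K /\ forall s u, 0 <= s <= 1 ->
  `|gavgs s l F u - F u - s ^+ 2 / 2 * \sum_(i <- l) H i u| <= K * s ^+ 3 * F u.
Proof.
have sl l' : exists C', [/\ C <= C' & lipw C' F (fun u => \sum_(i <- l') H i u)].
  elim: l' => [|i l' [C' [CC' h]]].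
    exists C; split => //; split => [u|u i z]; rewrite !big_nil ?subrr normr0.
      by rewrite mulr_ge0// ltW.
    by rewrite !mulr_ge0 ?expR_ge0// ltW.
  have C'0 : 0 <= C' by exact: le_trans CC'.
  have Fl' := loglipW CC' Fl.
  exists (2 * C'); split; first by lra.
  under eq_fun do rewrite big_cons.
  by apply: lipwD => //; exact: lipwW (Hl i).
elim: l => [|i l [K [K0 IH]]].
  exists 0; split => // s u _; rewrite big_nil mulr0 subr0 /= subrr normr0.
  by rewrite !mul0r.
have [C' [CC' bl]] := sl l.
set b := fun u => _ in bl.
have Fl' := loglipW CC' Fl.
have C'0 : 0 <= C' by exact: le_trans CC'.
set A1 := nexp (fun z : R => `|z| ^+ 1 * expR (C' * `|z|)).
have A10 : 0 <= A1 by apply: Rintegral_ge0 => z _; rewrite mulr_ge0// expR_ge0.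
exists (K * abs0exp + C * abs3exp C + C' * A1); split.
  by rewrite !addr_ge0 ?mulr_ge0 ?abs3exp_ge0.
move=> s u s01; have /andP[s0 s1] := s01.
rewrite big_cons /=.
have fi := loglip_nint u i s (gavgs_loglip s l Fl).
have Fi := loglip_nint u i s Fl.
have bi := lipw_nint u i s Fl' bl.
have bi' := nintZ (s ^+ 2 / 2) bi.
have h1 : `|gavg s i (gavgs s l F) u - gavg s i F u - s ^+ 2 / 2 * gavg s i b u|
    <= K * s ^+ 3 * (abs0exp * F u).
  have -> : gavg s i (gavgs s l F) u - gavg s i F u - s ^+ 2 / 2 * gavg s i b u =
    nexp (fun z => gavgs s l F (nudge u i (s * z)) - F (nudge u i (s * z))
       - s ^+ 2 / 2 * b (nudge u i (s * z))).
    by rewrite (nexpB (nintB fi Fi) bi') (nexpB fi Fi) (nexpZ _ bi).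
  apply: (@le_trans _ _ (K * s ^+ 3 * gavg s i F u)); last first.
    by rewrite ler_wpM2l ?mulr_ge0 ?exprn_ge0// gavg_le.
  rewrite /gavg -nexpZ//; apply: ler_norm_nexp => [||z].
  - by apply: nintB => //; exact: nintB.
  - exact: nintZ.
  - exact: IH.
have h2 := gavg_taylor i u s01.
have h3 := gavg_lipw_dist i u s01 Fl' bl.
have h4 : `|s ^+ 2 / 2 * (gavg s i b u - b u)| <= C' * A1 * s ^+ 3 * F u.
  have s20 : 0 <= s ^+ 2 / 2 by rewrite divr_ge0 ?sqr_ge0.
  rewrite normrM (ger0_norm s20); apply: (le_trans (ler_wpM2l s20 h3)).
  rewrite -/A1.
  have -> : s ^+ 2 / 2 * (C' * s * A1 * F u) = (C' * A1 * s ^+ 3 * F u) / 2 by field.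
  by rewrite ler_pdivrMr// ler_peMr ?ler1n// !mulr_ge0 ?exprn_ge0// ltW.
set X := gavg s i (gavgs s l F) u in h1 *; set Y := gavg s i F u in h1 h2 *.
set Z := gavg s i b u in h1 h4 *; rewrite -/(b u).
have -> : X - F u - s ^+ 2 / 2 * (H i u + b u) = (X - Y - s ^+ 2 / 2 * Z) +
   (Y - F u - s ^+ 2 / 2 * H i u) + (s ^+ 2 / 2 * (Z - b u)) by field.
apply: (le_trans (ler_normD _ _)).
have -> : (K * abs0exp + C * abs3exp C + C' * A1) * s ^+ 3 * F u =
  K * s ^+ 3 * (abs0exp * F u) + C * abs3exp C * s ^+ 3 * F u + C' * A1 * s ^+ 3 * F u.
  by ring.
apply: lerD => //; apply: (le_trans (ler_normD _ _)); exact: lerD.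
Qed.

End swap.

Section comparison.
Context {R : realType} {I : finType}.
Implicit Types (u v : I -> R) (i j : I) (f g b : (I -> R) -> R) (l : seq I).

Lemma iter_loglip C f s l n : loglip C f -> loglip C (iter n (gavgs s l) f).
Proof. by move=> fl; elim: n => //= n IH; exact: gavgs_loglip. Qed.

(** Variances add up. *)
Lemma iter_gavgs C f s l n : loglip C f -> 0 < s ->
  iter n.+1 (gavgs s l) f = gavgs (Num.sqrt n.+1%:R * s) l f.
Proof.
move=> fl s0; elim: n => [|n IH]; first by rewrite /= sqrtr1 mul1r.
rewrite iterS IH; apply: (gavgs_add l fl); rewrite ?mulr_gt0 ?sqrtr_gt0 ?ltr0n//.
by rewrite !exprMn !sqr_sqrtr ?ler0n// -[n.+2]addn1 natrD; ring.
Qed.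

Lemma gavgs_iterC C f s t l1 l2 n : loglip C f ->
  gavgs s l1 (iter n (gavgs t l2) f) = iter n (gavgs t l2) (gavgs s l1 f).
Proof.
move=> fl; elim: n => //= n <-.
by apply: gavgsC; exact: iter_loglip fl.
Qed.

Lemma le_iter_gavgs C f g s l n : loglip C f -> loglip C g ->
  (forall u, f u <= g u) ->
  forall u, iter n (gavgs s l) f u <= iter n (gavgs s l) g u.
Proof.
move=> fl gl fg; elim: n => [//|n IH u] /=.
by apply: (@le_gavgs _ _ C) => //; exact: iter_loglip.
Qed.

Lemma iter_gavgsZ C f a s l n : loglip C f ->
  iter n (gavgs s l) (fun v => a * f v) = (fun v => a * iter n (gavgs s l) f v).
Proof.
move=> fl; elim: n => //= n ->; apply: (@gavgsZ _ _ C).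
exact: iter_loglip.
Qed.

(** Averages of a function with Lipschitz logarithm do not collapse, so an
error proportional to F is also an error proportional to its average. *)
Lemma gavgs_lower C f s l u : loglip C f -> 0 <= s <= 1 ->
  (expR (nexp (fun z : R => - C * `|z|))) ^+ size l * f u <= gavgs s l f u.
Proof.
move=> fl /andP[s0 s1]; have [C0 f0 _] := fl.
set a := expR _; have a0 : 0 < a by exact: expR_gt0.
have absi : nint (fun z : R => - C * `|z|).
  apply: nintZ; apply: (nint_dom (nint_expabs 1)); first exact: normr_measurable.
  by move=> z; rewrite normr_id mul1r -[X in X <= _]expr1 -[X in expR X]mul1r normX_le_expR.
elim: l u => [|i l IH] u /=; first by rewrite expr0 mul1r.
have gl := gavgs_loglip s l fl; have [_ g0 _] := gl.
rewrite exprS -mulrA; apply: (@le_trans _ _ (a * gavgs s l f u)).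
  by rewrite ler_wpM2l// ltW.
apply: (@le_trans _ _ (gavgs s l f u * nexp (fun z : R => expR (- C * `|z|)))).
  by rewrite mulrC ler_wpM2l ?(ltW (g0 u))// nexp_jensen//; exact: nint_expabs.
rewrite -nexpZ; last exact: nint_expabs.
apply: le_nexp => [||z]; first by apply: nintZ; exact: nint_expabs.
  exact: loglip_nint gl.
apply: le_trans (loglip_ge gl _ _ _); rewrite mulrC ler_wpM2r ?(ltW (g0 u))//.
by rewrite ler_expR mulNr lerN2 ler_wpM2l// normrM (ger0_norm s0) ler_piMl.
Qed.

(** A unit average is n+1 averages with s = 1 / sqrt (n+1).  Each of the
l1-averages is exchanged for an l2-average at the price of a factor
1 + K s^3, which is legitimate in the presence of the others because all these
operators commute.  The total price exp (K / sqrt (n+1)) tends to 1. *)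
Lemma gavgs_comparison (C : R) (F : (I -> R) -> R) (D H : I -> (I -> R) -> R)
    (l1 l2 : seq I) :
  loglip C F ->
  (forall i u (z : R),
    is_derive z 1 (fun z => F (nudge u i z)) (D i (nudge u i z))) ->
  (forall i u (z : R),
    is_derive z 1 (fun z => D i (nudge u i z)) (H i (nudge u i z))) ->
  (forall i, lipw C F (H i)) ->
  (forall u, \sum_(i <- l1) H i u <= \sum_(i <- l2) H i u) ->
  forall u, gavgs 1 l1 F u <= gavgs 1 l2 F u.
Proof.
move=> Fl dF dD Hl H12 u.
have [C0 F0 _] := Fl.
have [K1 [K10 h1]] := gavgs_taylor Fl dF dD Hl l1.
have [K2 [K20 h2]] := gavgs_taylor Fl dF dD Hl l2.
set a := (expR (nexp (fun z : R => - C * `|z|))) ^+ size l2.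
have a0 : 0 < a by rewrite exprn_gt0// expR_gt0.
pose K := (K1 + K2) / a.
have K0 : 0 <= K by rewrite divr_ge0 ?addr_ge0// ltW.
have step s v : 0 <= s <= 1 -> gavgs s l1 F v <= (1 + K * s ^+ 3) * gavgs s l2 F v.
  move=> s01; have /andP[s0 s1] := s01.
  have := h1 s v s01; have := h2 s v s01; rewrite !ler_norml.
  move=> /andP[lb _] /andP[_ ub].
  have h3 : s ^+ 2 / 2 * \sum_(i <- l1) H i v <= s ^+ 2 / 2 * \sum_(i <- l2) H i v.
    by rewrite ler_wpM2l// divr_ge0 ?sqr_ge0.
  have h4 : F v <= a^-1 * gavgs s l2 F v.
    by rewrite mulrC ler_pdivlMr// mulrC; exact: gavgs_lower.
  have h5 : (K1 + K2) * s ^+ 3 * F v <= K * s ^+ 3 * gavgs s l2 F v.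
    have -> : K * s ^+ 3 * gavgs s l2 F v =
      (K1 + K2) * s ^+ 3 * (a^-1 * gavgs s l2 F v) by rewrite /K; ring.
    by rewrite ler_wpM2l// mulr_ge0 ?addr_ge0 ?exprn_ge0.
  rewrite mulrDl mul1r; lra.
have main n : gavgs 1 l1 F u <= expR (K / Num.sqrt n.+1%:R) * gavgs 1 l2 F u.
  pose s : R := (Num.sqrt n.+1%:R)^-1.
  have q0 : 0 < Num.sqrt n.+1%:R :> R by rewrite sqrtr_gt0 ltr0n.
  have s0 : 0 < s by rewrite invr_gt0.
  have s1 : s <= 1.
    by rewrite invf_le1// -[leLHS]sqrtr1 ler_wsqrtr// ler1n.
  have s01 : 0 <= s <= 1 by rewrite (ltW s0).
  have e1 l : gavgs 1 l F = iter n.+1 (gavgs s l) F.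
    by rewrite (iter_gavgs _ _ Fl s0) mulfV// gt_eqF.
  set q := 1 + K * s ^+ 3.
  have q1 : 0 < q by rewrite ltr_pwDl// mulr_ge0// exprn_ge0// ltW.
  have it k : forall v, iter k (gavgs s l1) F v <= q ^+ k * iter k (gavgs s l2) F v.
    elim: k => [|k IH] v; first by rewrite expr0 mul1r.
    rewrite iterS.
    have l2k := iter_loglip s l2 k Fl.
    have qk0 : 0 < q ^+ k by exact: exprn_gt0.
    apply: (@le_trans _ _ (gavgs s l1 (fun v => q ^+ k * iter k (gavgs s l2) F v) v)).
      apply: (@le_gavgs _ _ C) => //; first exact: iter_loglip.
      exact: loglipZ.
    rewrite (gavgsZ _ _ _ l2k) (gavgs_iterC _ _ _ _ _ Fl).
    rewrite exprSr -mulrA ler_wpM2l ?(ltW qk0)//.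
    rewrite iterSr -[leRHS]/((fun v => q * iter k (gavgs s l2) (gavgs s l2 F) v) v).
    rewrite -(iter_gavgsZ _ _ _ _ (gavgs_loglip s l2 Fl)).
    apply: (@le_iter_gavgs C); [exact: gavgs_loglip| |by move=> w; exact: step].
    by apply: loglipZ => //; exact: gavgs_loglip.
  rewrite !e1; apply: (le_trans (it _ _)).
  have [_ g0 _] := iter_loglip s l2 n.+1 Fl.
  rewrite ler_wpM2r ?(ltW (g0 u))//.
  have q2 : q <= expR (K * s ^+ 3) by exact: expR_ge1Dx.
  apply: (@le_trans _ _ (expR (K * s ^+ 3) ^+ n.+1)).
    by apply: lerXn2r; rewrite ?nnegrE ?expR_ge0 ?(ltW q1).
  rewrite -expRM_natl ler_expR.
  have -> : K / Num.sqrt n.+1%:R = K * s by [].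
  have -> : n.+1%:R = (s ^+ 2)^-1 :> R.
    by rewrite /s exprVn invrK sqr_sqrtr ?ler0n.
  by rewrite le_eqVlt; apply/orP; left; apply/eqP; field; rewrite gt_eqF.
have [_ g0 _] := gavgs_loglip 1 l2 Fl.
rewrite leNgt; apply/negP => lt12.
set x := gavgs 1 l1 F u in lt12 main; set y := gavgs 1 l2 F u in lt12 main.
have y0 : 0 < y by exact: g0.
have lnr : 0 < ln (x / y).
  by rewrite ln_gt0// ltr_pdivlMr// mul1r.
have [n hn] : exists n, K / Num.sqrt n.+1%:R < ln (x / y).
  exists (Num.truncn ((K / ln (x / y)) ^+ 2)).
  set N := _.+1; have q0 : 0 < Num.sqrt N%:R :> R by rewrite sqrtr_gt0 ltr0n.
  rewrite ltr_pdivrMr// mulrC -ltr_pdivrMr//.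
  apply: (@le_lt_trans _ _ (Num.sqrt ((K / ln (x / y)) ^+ 2))).
    by rewrite sqrtr_sqr ler_norm.
  by rewrite ltr_sqrt ?ltr0n//; exact: truncnS_gt.
have := main n; rewrite leNgt => /negP; apply.
have e : x / y = expR (ln (x / y)).
  by rewrite lnK// posrE divr_gt0//; exact: lt_trans lt12.
by rewrite -ltr_pdivlMr// e ltr_expR.
Qed.

End comparison.

(** * The soft minimum of smooth functions *)

Section blip.
Context {R : realType} {I : finType}.
Implicit Types (u v : I -> R) (i : I) (f g b : (I -> R) -> R).

(** Bounded functions with controlled increments; multiplying a
log-Lipschitz weight by such a function gives a [lipw] function, and this class
is closed under the algebra needed for second derivatives. *)
Definition blip b := exists K : R, [/\ 0 <= K, forall u, `|b u| <= K &
  forall u i z, `|b (nudge u i z) - b u| <= K * `|z| * expR (K * `|z|)].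

Lemma mono_xexp (K K' x : R) : 0 <= K -> K <= K' -> 0 <= x ->
  K * x * expR (K * x) <= K' * x * expR (K' * x).
Proof.
move=> K0 KK' x0; apply: ler_pM; rewrite ?mulr_ge0 ?expR_ge0//.
  by rewrite ler_wpM2r.
by rewrite ler_expR ler_wpM2r.
Qed.

Lemma blip_cst c : blip (fun=> c).
Proof.
by exists `|c|; split => // u i z; rewrite subrr normr0 !mulr_ge0 ?expR_ge0.
Qed.

Lemma blip_lip b (K : R) : 0 <= K -> (forall u, `|b u| <= K) ->
  (forall u i z, `|b (nudge u i z) - b u| <= K * `|z|) -> blip b.
Proof.
move=> K0 b1 b2; exists K; split=> // u i z; apply: (le_trans (b2 _ _ _)).
by rewrite ler_peMr ?mulr_ge0// -expR0 ler_expR mulr_ge0.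
Qed.

Lemma blipD b b' : blip b -> blip b' -> blip (fun u => b u + b' u).
Proof.
move=> [K [K0 b1 b2]] [K' [K'0 b1' b2']].
exists (2 * (K + K')); split=> [|u|u i z]; first by rewrite mulr_ge0// addr_ge0.
  by rewrite (le_trans (ler_normD _ _))//; have := b1 u; have := b1' u; lra.
rewrite opprD addrACA (le_trans (ler_normD _ _))//.
have h : K * `|z| * expR (K * `|z|) <= (K + K') * `|z| * expR ((K + K') * `|z|).
  by apply: mono_xexp => //; rewrite lerDl.
have h' : K' * `|z| * expR (K' * `|z|) <= (K + K') * `|z| * expR ((K + K') * `|z|).
  by apply: mono_xexp => //; rewrite lerDr.
have h2 : (K + K') * `|z| * expR ((K + K') * `|z|) <=
   (K + K') * `|z| * expR (2 * (K + K') * `|z|).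
  rewrite ler_wpM2l ?mulr_ge0 ?addr_ge0// ler_expR ler_wpM2r//.
  by rewrite ler_peMl ?addr_ge0// ler1n.
have := b2 u i z; have := b2' u i z; lra.
Qed.

Lemma blipM b b' : blip b -> blip b' -> blip (fun u => b u * b' u).
Proof.
move=> [K [K0 b1 b2]] [K' [K'0 b1' b2']].
pose M := (K + K' + 2 * K * K' + 1).
have KK0 : 0 <= K * K' by rewrite mulr_ge0.
have M0 : 0 <= M by rewrite /M; lra.
exists M; split=> // [u|u i z].
  rewrite normrM (le_trans (ler_pM _ _ (b1 u) (b1' u)))// /M; lra.
have -> : b (nudge u i z) * b' (nudge u i z) - b u * b' u =
  (b (nudge u i z) - b u) * b' (nudge u i z) + b u * (b' (nudge u i z) - b' u) by ring.
rewrite (le_trans (ler_normD _ _))// !normrM.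
have x0 := normr_ge0 z; set x := `|z| in x0 *.
have e0 : 0 <= expR (M * x) by exact: expR_ge0.
have h1 := ler_pM (normr_ge0 _) (normr_ge0 _) (b2 u i z) (b1' (nudge u i z)).
have h2 := ler_pM (normr_ge0 _) (normr_ge0 _) (b1 u) (b2' u i z).
have h3 : expR (K * x) <= expR (M * x) by rewrite ler_expR ler_wpM2r// /M; lra.
have h4 : expR (K' * x) <= expR (M * x) by rewrite ler_expR ler_wpM2r// /M; lra.
rewrite -/x in h1 h2.
have h5 : K * x * expR (K * x) * K' <= K * K' * x * expR (M * x).
  have -> : K * x * expR (K * x) * K' = K * K' * x * expR (K * x) by ring.
  by rewrite ler_wpM2l// !mulr_ge0.
have h6 : K * (K' * x * expR (K' * x)) <= K * K' * x * expR (M * x).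
  have -> : K * (K' * x * expR (K' * x)) = K * K' * x * expR (K' * x) by ring.
  by rewrite ler_wpM2l// !mulr_ge0.
have h7 : 2 * (K * K') * x * expR (M * x) <= M * x * expR (M * x).
  by rewrite !ler_wpM2r//; rewrite /M; lra.
lra.
Qed.

Lemma blip_sum (J : Type) (s : seq J) (b : J -> (I -> R) -> R) :
  (forall j, blip (b j)) -> blip (fun u => \sum_(j <- s) b j u).
Proof.
move=> bb; elim: s => [|j s IH].
  by under eq_fun do rewrite big_nil; exact: blip_cst.
by under eq_fun do rewrite big_cons; exact: blipD.
Qed.

Lemma blipZ c b : blip b -> blip (fun u => c * b u).
Proof. by move=> bb; apply: blipM => //; exact: blip_cst. Qed.

Lemma loglip_blip C f (K : R) : loglip C f -> (forall u, f u <= K) -> blip f.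
Proof.
move=> fl fK; have [C0 f0 fC] := fl.
have K0 : 0 <= K by apply: le_trans (fK (fun=> 0)); rewrite ltW.
exists (C + C * K + K); split=> [|u|u i z]; first by rewrite !addr_ge0// mulr_ge0.
  by rewrite gtr0_norm// (le_trans (fK u))// lerDr addr_ge0// mulr_ge0.
apply: (le_trans (loglip_dist fl u i z)).
apply: (@le_trans _ _ ((C * K * `|z|) * expR (C * `|z|))).
  have -> : C * K * `|z| * expR (C * `|z|) = C * `|z| * expR (C * `|z|) * K by ring.
  by rewrite ler_wpM2l// !mulr_ge0 ?expR_ge0.
have CK0 : 0 <= C * K by rewrite mulr_ge0.
apply: ler_pM; rewrite ?mulr_ge0 ?expR_ge0//.
  by rewrite ler_wpM2r//; lra.
by rewrite ler_expR ler_wpM2r//; lra.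
Qed.

Lemma blip_lipw C g b : loglip C g -> blip b ->
  exists C', C <= C' /\ lipw C' g (fun u => g u * b u).
Proof.
move=> gl [K [K0 b1 b2]]; have [C0 g0 gC] := gl.
pose M := C + K + C * K.
have CK0 : 0 <= C * K by rewrite mulr_ge0.
have M0 : 0 <= M by rewrite /M; lra.
exists M; split; first by rewrite /M; lra.
split => [u|u i z].
  rewrite normrM (gtr0_norm (g0 u)) mulrC ler_wpM2r ?(ltW (g0 u))//.
  by rewrite (le_trans (b1 u))// /M; lra.
have -> : g (nudge u i z) * b (nudge u i z) - g u * b u =
  (b (nudge u i z) - b u) * g (nudge u i z) + b u * (g (nudge u i z) - g u) by ring.
rewrite (le_trans (ler_normD _ _))// !normrM (gtr0_norm (g0 _)).
have x0 := normr_ge0 z; set x := `|z| in x0 *.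
have h1 := ler_pM (normr_ge0 _) (ltW (g0 _)) (b2 u i z) (gC u i z).
have h2 := ler_pM (normr_ge0 _) (normr_ge0 _) (b1 u) (loglip_dist gl u i z).
rewrite -/x in h1 h2.
have gu0 := ltW (g0 u).
have h3 : K * x * expR (K * x) * (expR (C * x) * g u) <= K * x * expR (M * x) * g u.
  have -> : K * x * expR (K * x) * (expR (C * x) * g u) =
     K * x * (expR (K * x) * expR (C * x)) * g u by ring.
  rewrite -expRD -mulrDl ler_wpM2r// ler_wpM2l ?mulr_ge0// ler_expR ler_wpM2r//.
  by rewrite /M; lra.
have h4 : K * (C * x * expR (C * x) * g u) <= C * K * x * expR (M * x) * g u.
  have -> : K * (C * x * expR (C * x) * g u) = C * K * x * expR (C * x) * g u by ring.
  rewrite ler_wpM2r// ler_wpM2l ?mulr_ge0// ler_expR ler_wpM2r//.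
  by rewrite /M; lra.
have h5 : (K + C * K) * x * expR (M * x) * g u <= M * x * expR (M * x) * g u.
  by rewrite !ler_wpM2r ?expR_ge0//; rewrite /M; lra.
lra.
Qed.

Lemma loglipV C f : loglip C f -> loglip C (fun u => (f u)^-1).
Proof.
move=> fl; have [C0 f0 fC] := fl; split=> // [u|u i z]; first by rewrite invr_gt0.
have h := loglip_ge fl u i z.
rewrite -[expR _]invrK -expRN -invfM lef_pV2 ?posrE ?mulr_gt0 ?expR_gt0//.
Qed.

Lemma loglip_sum (J : finType) C (f : J -> (I -> R) -> R) (j0 : J) :
  (forall j, loglip C (f j)) -> loglip C (fun u => \sum_j f j u).
Proof.
move=> fl; have [C0 _ _] := fl j0.
have f0 j u : 0 < f j u by have [] := fl j.
split=> // [u|u i z].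
  rewrite (bigD1 j0)//= ltr_pwDl//; apply: sumr_ge0 => j _; exact: ltW.
by rewrite mulr_sumr; apply: ler_sum => j _; have [_ _] := fl j.
Qed.

End blip.

Section softmin_line.
Context {R : realType}.
Variables (p : nat) (j0 : 'I_p) (q : R) (l l1 l2 : 'I_p -> R -> R).
Hypothesis q0 : 0 < q.
Hypothesis dl : forall j (z : R), is_derive z 1 (l j) (l1 j z).
Hypothesis dl1 : forall j (z : R), is_derive z 1 (l1 j) (l2 j z).
Let e j z := expR (- q * l j z).
Let S z := \sum_(j < p) e j z.
Let m z := \sum_(j < p) e j z / S z * l1 j z.
Let psi z := expR (q^-1 * ln (S z)).

Let S0 z : 0 < S z.
Proof.
rewrite /S (bigD1 j0)//= ltr_pwDl ?expR_gt0//.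
by apply: sumr_ge0 => j _; exact: expR_ge0.
Qed.

Let de j (z : R) : is_derive z 1 (e j) (- q * l1 j z * e j z).
Proof.
have h := dl j z; apply: is_derive_eq.
by rewrite /GRing.scale/= ?scaler0 /e; ring.
Qed.

Let dS (z : R) : is_derive z 1 S (- q * m z * S z).
Proof.
have eS : S = \sum_(j < p) e j by apply/funext => y; rewrite fct_sumE.
rewrite [X in is_derive _ _ X _]eS.
apply: (@is_derive_eq _ _ _ _ _ _ _ _ (is_derive_sum (fun j => de j z))).
rewrite /m -mulrA mulr_suml mulr_sumr; apply: eq_bigr => j _.
by field; rewrite gt_eqF.
Qed.

Let dpsi (z : R) : is_derive z 1 psi (psi z * - m z).
Proof.
have h := dS z; have hln := is_derive1_ln (S0 z).
have h2 := is_derive1_comp hln h.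
have h3 : is_derive z 1 (fun z => q^-1 * ln (S z)) (q^-1 * ((S z)^-1 * (- q * m z * S z))).
  by apply: (@is_derive_eq _ _ _ _ _ _ _ _ (is_deriveZ q^-1 h2)).
apply: (@is_derive_eq _ _ _ _ _ _ _ _ (is_derive1_comp (is_derive_expR _) h3)).
by rewrite -/(psi z); field; rewrite !gt_eqF.
Qed.

Let dm (z : R) : is_derive z 1 m
  (\sum_(j < p) e j z / S z * (l2 j z - q * l1 j z ^+ 2) + q * m z ^+ 2).
Proof.
have h (j : 'I_p) : is_derive z 1 (fun z => e j z / S z * l1 j z)
    (e j z / S z * (l2 j z - q * l1 j z ^+ 2) + q * m z * (e j z / S z * l1 j z)).
  have h1 := de j z; have h2 := dS z; have h3 := dl1 j z.
  have Sn : S z != 0 by rewrite gt_eqF.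
  have h4 := is_deriveV Sn h2.
  apply: (@is_derive_eq _ _ _ _ _ _ _ _ (is_deriveM (is_deriveM h1 h4) h3)).
  rewrite /GRing.scale/=.
  have -> : (e j * (fun y : R => (S y)^-1)) z = e j z / S z by [].
  by field; rewrite gt_eqF.
have em : m = \sum_(j < p) (fun z => e j z / S z * l1 j z).
  by apply/funext => y; rewrite fct_sumE.
rewrite [X in is_derive _ _ X _]em.
apply: (@is_derive_eq _ _ _ _ _ _ _ _ (is_derive_sum h)).
by rewrite big_split/= -mulr_sumr expr2 mulrA.
Qed.

Lemma softmin_line1 (z : R) : is_derive z 1 psi (psi z * - m z).
Proof. exact: dpsi. Qed.

(** Differentiating the Gibbs weights produces the terms with q: the
square of the mean slope enters with the nonpositive coefficient 1 - q, the
mean of the squared slopes with the coefficient q. *)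
Lemma softmin_line2 (z : R) : is_derive z 1 (fun z => psi z * - m z)
  (psi z * ((1 - q) * m z ^+ 2 + \sum_(j < p) e j z / S z * (q * l1 j z ^+ 2 - l2 j z))).
Proof.
have h1 := dpsi z; have h2 := is_deriveN (dm z).
apply: (@is_derive_eq _ _ _ _ _ _ _ _ (is_deriveM h1 h2)).
rewrite /GRing.scale/=.
have -> : \sum_(j < p) e j z / S z * (q * l1 j z ^+ 2 - l2 j z) =
  - \sum_(j < p) e j z / S z * (l2 j z - q * l1 j z ^+ 2).
  by rewrite -sumrN; apply: eq_bigr => j _; rewrite -mulrN opprB.
have -> : (- m) z = - m z by [].
by ring.
Qed.

End softmin_line.

Section softmin.
Context {R : realType} {I : finType}.
Variables (p : nat) (j0 : 'I_p) (q C1 : R) (L : 'I_p -> (I -> R) -> R)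
  (L1 L2 : 'I_p -> I -> (I -> R) -> R).
Hypothesis q1 : 1 <= q.
Hypothesis C10 : 0 <= C1.
Hypothesis dL : forall j i u (z : R),
  is_derive z 1 (fun z => L j (nudge u i z)) (L1 j i (nudge u i z)).
Hypothesis dL1 : forall j i u (z : R),
  is_derive z 1 (fun z => L1 j i (nudge u i z)) (L2 j i (nudge u i z)).
Hypothesis bL1 : forall j i, blip (L1 j i).
Hypothesis bL2 : forall j i, blip (L2 j i).
Hypothesis L1C : forall j i u, `|L1 j i u| <= C1.

Let q0 : 0 < q. Proof. exact: lt_le_trans q1. Qed.

Definition gibbs_sum (u : I -> R) : R := \sum_(j < p) expR (- q * L j u).
(** The l^q norm of the family exp (- L_j), a smooth function between
exp (- min_j L_j) and p^(1/q) times it. *)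
Definition softmin (u : I -> R) : R := expR (q^-1 * ln (gibbs_sum u)).
Definition gibbs j (u : I -> R) : R := expR (- q * L j u) / gibbs_sum u.
Definition gibbs_mean i (u : I -> R) : R := \sum_(j < p) gibbs j u * L1 j i u.
Definition softmin1 i u : R := softmin u * - gibbs_mean i u.
Definition softmin2 i u : R := softmin u *
  ((1 - q) * gibbs_mean i u ^+ 2 +
   \sum_(j < p) gibbs j u * (q * L1 j i u ^+ 2 - L2 j i u)).

Lemma gibbs_sum_gt0 u : 0 < gibbs_sum u.
Proof.
rewrite /gibbs_sum (bigD1 j0)//= ltr_pwDl ?expR_gt0//.
by apply: sumr_ge0 => j _; exact: expR_ge0.
Qed.

Lemma L_lip j u i z : `|L j (nudge u i z) - L j u| <= C1 * `|z|.
Proof.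
by have := lipschitz_from0 (z := z) (dL j i u) (fun x _ => L1C j i (nudge u i x)); rewrite nudge0.
Qed.

Lemma loglip_gibbs_term j : loglip (q * C1) (fun u => expR (- q * L j u)).
Proof.
apply: loglip_exp => [|u i z]; first by rewrite mulr_ge0// ltW.
have := L_lip j u i z; rewrite ler_norml => /andP[h _].
have := ler_wpM2l (ltW q0) h; lra.
Qed.

Lemma gibbs_sum_loglip : loglip (q * C1) gibbs_sum.
Proof. exact: (loglip_sum j0 loglip_gibbs_term). Qed.

Let S0 := gibbs_sum_gt0.

Lemma softmin_loglip : loglip C1 softmin.
Proof.
apply: loglip_exp => // u i z.
have [_ _ h] := gibbs_sum_loglip.
have : ln (gibbs_sum (nudge u i z)) <= ln (gibbs_sum u) + q * C1 * `|z|.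
  rewrite -[X in _ + X](expRK) -lnM ?posrE ?expR_gt0// ler_ln ?posrE ?mulr_gt0 ?expR_gt0//.
  by rewrite mulrC.
rewrite -(ler_pM2l (x := q^-1)) ?invr_gt0// => /le_trans; apply.
by rewrite mulrDr !mulrA mulVf ?mul1r// gt_eqF.
Qed.

Lemma gibbs_ge0 j u : 0 <= gibbs j u.
Proof. by rewrite divr_ge0 ?expR_ge0// ltW. Qed.

Lemma sum_gibbs u : \sum_(j < p) gibbs j u = 1.
Proof. by rewrite /gibbs -mulr_suml -/(gibbs_sum u) mulfV// gt_eqF. Qed.

Lemma gibbs_blip j : blip (gibbs j).
Proof.
apply: (@loglip_blip _ _ (q * C1 + q * C1) _ 1).
  by apply: loglipM; [exact: loglip_gibbs_term|apply: loglipV; exact: gibbs_sum_loglip].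
move=> u; rewrite -(sum_gibbs u) (bigD1 j)//= lerDl.
by apply: sumr_ge0 => k _; exact: gibbs_ge0.
Qed.

Lemma gibbs_mean_blip i : blip (gibbs_mean i).
Proof. by apply: blip_sum => j; apply: blipM; [exact: gibbs_blip|]. Qed.

Lemma softmin2_lipw i : exists C', C1 <= C' /\ lipw C' softmin (softmin2 i).
Proof.
apply: blip_lipw; first exact: softmin_loglip.
apply: blipD.
  by apply: blipZ; apply: blipM; exact: gibbs_mean_blip.
apply: blip_sum => j; apply: blipM; first exact: gibbs_blip.
apply: blipD; first by apply: blipZ; exact: blipM.
by have := blipZ (-1) (bL2 j i); under eq_fun do rewrite mulN1r.
Qed.

(** Summed over a list of coordinates, the second derivatives of the
soft minimum see the gradients only through their pairwise inner products,
with nonpositive coefficients, and through their norms.  Hence smaller inner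
products with equal norms give a larger average. *)
Lemma softmin_comparison (l1 l2 : seq I) :
  (forall j k u, \sum_(i <- l2) L1 j i u * L1 k i u <=
                 \sum_(i <- l1) L1 j i u * L1 k i u) ->
  (forall j u, \sum_(i <- l2) L1 j i u ^+ 2 = \sum_(i <- l1) L1 j i u ^+ 2) ->
  (forall j u, \sum_(i <- l2) L2 j i u = \sum_(i <- l1) L2 j i u) ->
  forall u, gavgs 1 l1 softmin u <= gavgs 1 l2 softmin u.
Proof.
move=> hK hK0 hM.
pose Ci i := sval (cid (softmin2_lipw i)).
pose C := C1 + \sum_i Ci i.
have Ci0 i : C1 <= Ci i by rewrite /Ci; case: cid => /= ? [].
have Ci00 i : 0 <= Ci i by exact: le_trans (Ci0 i).
have CiC i : Ci i <= C.
  by rewrite /C (bigD1 i)//= addrCA lerDl addr_ge0// sumr_ge0.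
have C1C : C1 <= C by rewrite /C lerDl sumr_ge0.
have sl := loglipW C1C softmin_loglip; have [_ s0 _] := sl.
apply: (@gavgs_comparison _ _ C softmin softmin1 softmin2) => //.
- move=> i u z.
  exact: (softmin_line1 j0 q0 (fun j => dL j i u) z).
- move=> i u z.
  exact: (softmin_line2 j0 q0 (fun j => dL j i u) (fun j => dL1 j i u) z).
- move=> i; apply: lipwW (CiC i) _ => //.
  by rewrite /Ci; case: cid => /= ? [].
move=> u.
have sumE (l : seq I) : \sum_(i <- l) softmin2 i u = softmin u *
   ((1 - q) * (\sum_(j < p) \sum_(k < p) gibbs j u * gibbs k u *
        \sum_(i <- l) L1 j i u * L1 k i u) +
    \sum_(j < p) gibbs j u * (q * (\sum_(i <- l) L1 j i u ^+ 2) -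
       \sum_(i <- l) L2 j i u)).
  rewrite /softmin2 -mulr_sumr big_split/= -mulr_sumr; congr (_ * (_ * _ + _)).
    under [RHS]eq_bigr => j _ do under eq_bigr => k _ do rewrite mulr_sumr.
    under [RHS]eq_bigr => j _ do rewrite exchange_big.
    rewrite exchange_big; apply: eq_bigr => i _.
    rewrite /gibbs_mean expr2 mulr_suml; apply: eq_bigr => j _.
    by rewrite mulr_sumr; apply: eq_bigr => k _; ring.
  rewrite exchange_big; apply: eq_bigr => j _.
  by rewrite -mulr_sumr sumrB mulr_sumr.
rewrite !sumE ler_wpM2l ?(ltW (s0 u))//.
apply: lerD; last by under eq_bigr do rewrite -hK0 -hM.
rewrite ler_wnM2l ?subr_le0//.
apply: ler_sum => j _; apply: ler_sum => k _.
by rewrite ler_wpM2l// mulr_ge0// gibbs_ge0.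
Qed.

End softmin.

(** * Gordon's comparison *)

Section smooth_norm.
Context {R : realType} {m : nat}.
Implicit Types (y : 'I_m -> R) (i : 'I_m) (z : R).

(** The Euclidean norm smoothed at the origin by an extra unit, which
changes it by at most 1; [sdir] is its gradient. *)
Definition snorm y : R := Num.sqrt (1 + \sum_i y i ^+ 2).
Definition sdir i y : R := y i / snorm y.

Lemma sum_sqr_ge0 y : 0 <= \sum_i y i ^+ 2.
Proof. by apply: sumr_ge0 => i _; rewrite sqr_ge0. Qed.

Lemma snorm_ge1 y : 1 <= snorm y.
Proof. by rewrite -[leLHS]sqrtr1 ler_wsqrtr// lerDl sum_sqr_ge0. Qed.

Lemma snorm_gt0 y : 0 < snorm y.
Proof. exact: lt_le_trans (snorm_ge1 y). Qed.

Lemma snorm_sqr y : snorm y ^+ 2 = 1 + \sum_i y i ^+ 2.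
Proof. by rewrite sqr_sqrtr// addr_ge0// sum_sqr_ge0. Qed.

Lemma sum_sdir_sqr_le1 y : \sum_i sdir i y ^+ 2 <= 1.
Proof.
under eq_bigr do rewrite /sdir expr_div_n.
rewrite -mulr_suml snorm_sqr ler_pdivrMr ?mul1r ?lerDr//.
by rewrite ltr_pwDl// sum_sqr_ge0.
Qed.

Lemma sdir_le1 i y : `|sdir i y| <= 1.
Proof.
rewrite -(@expr_le1 _ 2)// real_normK ?num_real//.
apply: le_trans (sum_sdir_sqr_le1 y); rewrite (bigD1 i)//= lerDl.
by apply: sumr_ge0 => k _; rewrite sqr_ge0.
Qed.

Lemma snorm_nudge_sqr y i z : 1 + \sum_k nudge y i z k ^+ 2 =
  (1 + \sum_(k < m | k != i) y k ^+ 2) + (y i + z) ^+ 2.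
Proof.
rewrite (bigD1 i)//= {1}/nudge eqxx addrCA addrC; congr (1 + _ + _).
by apply: eq_bigr => k /negbTE ki; rewrite /nudge ki addr0.
Qed.

Lemma is_derive_snorm y i z :
  is_derive z 1 (fun z => snorm (nudge y i z)) (sdir i (nudge y i z)).
Proof.
pose g (t : R) : R := (1 + \sum_(k < m | k != i) y k ^+ 2) + (y i + t) ^+ 2.
have e : (fun z => snorm (nudge y i z)) = Num.sqrt \o g.
  by apply/funext => t; rewrite /snorm snorm_nudge_sqr.
rewrite [X in is_derive _ _ X _]e.
have g0 : 0 < g z.
  rewrite ltr_pwDl ?sqr_ge0// ltr_pwDl//.
  by apply: sumr_ge0 => k _; rewrite sqr_ge0.
have h : is_derive z 1 g (2 * (y i + z)).
  by apply: is_derive_eq; rewrite /GRing.scale/=; ring.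
have hs : is_derive (g z) 1 Num.sqrt (2 * Num.sqrt (g z))^-1 by exact: is_derive1_sqrt.
apply: (@is_derive_eq _ _ _ _ _ _ _ _ (is_derive1_comp hs h)).
rewrite /sdir {1}/nudge eqxx /snorm snorm_nudge_sqr -/(g z).
by field; rewrite gt_eqF// sqrtr_gt0.
Qed.

Lemma is_derive_sdir y i z :
  is_derive z 1 (fun z => sdir i (nudge y i z))
    ((1 - sdir i (nudge y i z) ^+ 2) / snorm (nudge y i z)).
Proof.
have h1 : is_derive z 1 (fun z => nudge y i z i) 1.
  have -> : (fun z => nudge y i z i) = (fun z => y i + z).
    by apply/funext => t; rewrite /nudge eqxx.
  by apply: is_derive_eq; rewrite add0r mulr1.
have n0 : snorm (nudge y i z) != 0 by rewrite gt_eqF ?snorm_gt0.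
have h2 := @is_deriveV _ (fun z => snorm (nudge y i z)) z _ _ n0 (is_derive_snorm y i z).
apply: (@is_derive_eq _ _ _ _ _ _ _ _ (is_deriveM h1 h2)).
by rewrite /GRing.scale/= /sdir; field.
Qed.

Lemma snorm_lip y i z : `|snorm (nudge y i z) - snorm y| <= `|z|.
Proof.
have := lipschitz_from0 (z := z) (is_derive_snorm y i) (fun x _ => sdir_le1 i (nudge y i x)).
by rewrite nudge0 mul1r.
Qed.

Lemma snormV_lip y i z : `|(snorm (nudge y i z))^-1 - (snorm y)^-1| <= `|z|.
Proof.
have n0 := snorm_gt0 y; have n1 := snorm_gt0 (nudge y i z).
have -> : (snorm (nudge y i z))^-1 - (snorm y)^-1 =
   (snorm y - snorm (nudge y i z)) / (snorm y * snorm (nudge y i z)).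
  by field; rewrite !gt_eqF.
rewrite normrM distrC normfV (gtr0_norm (mulr_gt0 n0 n1)).
rewrite ler_pdivrMr ?mulr_gt0//; apply: (le_trans (snorm_lip y i z)).
by rewrite ler_peMr// mulr_ege1 ?snorm_ge1.
Qed.

Lemma snormV_blip : blip (fun y => (snorm y)^-1).
Proof.
apply: (@blip_lip _ _ _ 1) => // [y|y i z]; last by rewrite mul1r snormV_lip.
by rewrite normfV gtr0_norm ?snorm_gt0// invf_le1 ?snorm_gt0// snorm_ge1.
Qed.

Lemma sdir_blip i : blip (sdir i).
Proof.
apply: (@blip_lip _ _ _ 2) => // [y|y k z].
  by apply: (le_trans (sdir_le1 i y)); rewrite ler1n.
have n0 := snorm_gt0 y; have n1 := snorm_gt0 (nudge y k z).
have -> : sdir i (nudge y k z) - sdir i y =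
  (nudge y k z i - y i) / snorm (nudge y k z) +
  sdir i y * ((snorm y - snorm (nudge y k z)) / snorm (nudge y k z)).
  by rewrite /sdir; field; rewrite !gt_eqF.
have inv1 : (snorm (nudge y k z))^-1 <= 1 by rewrite invf_le1// snorm_ge1.
have h1 : `|(nudge y k z i - y i) / snorm (nudge y k z)| <= `|z|.
  rewrite normrM normfV (gtr0_norm n1).
  apply: (@le_trans _ _ `|nudge y k z i - y i|); first by rewrite ler_piMr.
  by rewrite /nudge addrAC subrr add0r; case: (i == k); rewrite ?normr0.
have h2 : `|sdir i y * ((snorm y - snorm (nudge y k z)) / snorm (nudge y k z))| <= `|z|.
  rewrite normrM -[leRHS]mul1r; apply: ler_pM => //; first exact: sdir_le1.
  rewrite normrM normfV (gtr0_norm n1) distrC -[leRHS]mulr1.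
  by apply: ler_pM => //; [rewrite invr_ge0 ltW|exact: snorm_lip].
by apply: (le_trans (ler_normD _ _)); have := lerD h1 h2; lra.
Qed.

End smooth_norm.

Section gordon.
Context {R : realType}.
Variables (m n p : nat) (a0 : 'I_p) (q : R) (x : 'I_p -> 'I_n -> R).
Hypothesis q1 : 1 <= q.
Hypothesis x1 : forall a, \sum_j x a j ^+ 2 = 1.

(** The four independent Gaussian families of the comparison: the matrix
entries, one common variable, a vector of length m and a vector of length n. *)
Definition gcoord : finType := (('I_m * 'I_n + unit) + ('I_m + 'I_n))%type.
Definition entry_coord (ij : 'I_m * 'I_n) : gcoord := inl (inl ij).
Definition common_coord : gcoord := inl (inr tt).
Definition row_coord (i : 'I_m) : gcoord := inr (inl i).
Definition col_coord (j : 'I_n) : gcoord := inr (inr j).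

Implicit Types (u : gcoord -> R) (a : 'I_p).

(** The vector A x_a + g. *)
Definition gordon_vec a u (i : 'I_m) : R := \sum_j u (entry_coord (i, j)) * x a j + u (row_coord i).
Definition gordon_lin a u : R := u common_coord + \sum_j u (col_coord j) * x a j.
(** Both processes in one function: with g and h set to zero it is
|A x_a| + gamma, with A and gamma set to zero it is |g| + <h, x_a>, up to the
smoothing of the norm. *)
Definition gordon_obj a u : R := snorm (gordon_vec a u) + gordon_lin a u.

Definition slope a (c : gcoord) : R :=
  match c with
  | inl (inl ij) => x a ij.2 | inl (inr _) => 0 | inr (inl _) => 1 | inr (inr _) => 0
  end.
(** The entry of A x_a + g that a coordinate influences. *)
Definition row_of (c : gcoord) : option 'I_m :=
  match c with
  | inl (inl ij) => Some ij.1 | inl (inr _) => None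
  | inr (inl i) => Some i | inr (inr _) => None
  end.
Definition lin_slope a (c : gcoord) : R :=
  match c with
  | inl (inl _) => 0 | inl (inr _) => 1 | inr (inl _) => 0 | inr (inr j) => x a j
  end.

Definition gordon_grad a c u : R :=
  (if row_of c is Some i then slope a c * sdir i (gordon_vec a u) else 0) + lin_slope a c.
Definition gordon_hess a c u : R :=
  if row_of c is Some i then
    slope a c ^+ 2 * ((1 - sdir i (gordon_vec a u) ^+ 2) / snorm (gordon_vec a u)) else 0.

Lemma gordon_vec_nudge a u c z : gordon_vec a (nudge u c z) =
  if row_of c is Some i then nudge (gordon_vec a u) i (slope a c * z) else gordon_vec a u.
Proof.
apply/funext => k; case: c => [[[i j]|[]]|[i|j]]; rewrite /gordon_vec /nudge /=.
- rewrite addr0; under eq_bigr do rewrite mulrDl.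
  rewrite big_split/= addrAC; congr (_ + _).
  have [->|ki] := eqVneq k i.
    rewrite (bigD1 j)//= eqxx big1 ?addr0 1?mulrC// => l lj.
    rewrite (_ : _ == _ = false) ?mul0r//; apply/negP => /eqP[] /eqP.
    by apply/negP.
  rewrite big1// => l _; rewrite (_ : _ == _ = false) ?mul0r//.
  by apply/negP => /eqP[] /eqP; rewrite (negbTE ki).
- by rewrite addr0; congr (_ + _); apply: eq_bigr => l _; rewrite addr0.
- rewrite mul1r -addrA; congr (_ + _); apply: eq_bigr => l _; by rewrite addr0.
- by rewrite addr0; congr (_ + _); apply: eq_bigr => l _; rewrite addr0.
Qed.

Lemma gordon_lin_nudge a u c z : gordon_lin a (nudge u c z) = gordon_lin a u + lin_slope a c * z.
Proof.
case: c => [[[i j]|[]]|[i|j]]; rewrite /gordon_lin /nudge /=.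
- by rewrite addr0 mul0r addr0; congr (_ + _); apply: eq_bigr => l _; rewrite addr0.
- by rewrite mul1r addrAC; congr (_ + _ + _); apply: eq_bigr => l _; rewrite addr0.
- by rewrite addr0 mul0r addr0; congr (_ + _); apply: eq_bigr => l _; rewrite addr0.
- rewrite addr0 -addrA; congr (_ + _).
  under eq_bigr do rewrite mulrDl.
  rewrite big_split/=; congr (_ + _).
  rewrite (bigD1 j)//= eqxx big1 ?addr0 1?mulrC// => l lj.
  rewrite (_ : _ == _ = false) ?mul0r//; apply/negP => /eqP[] /eqP.
  by apply/negP.
Qed.

Lemma is_derive_scale (a z : R) : is_derive z 1 (fun t : R => a * t) a.
Proof. by apply: is_derive_eq; rewrite /GRing.scale/= mulr1. Qed.

Lemma is_derive_gordon_obj a c u (z : R) :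
  is_derive z 1 (fun z => gordon_obj a (nudge u c z)) (gordon_grad a c (nudge u c z)).
Proof.
have hl : is_derive z 1 (fun z => gordon_lin a (nudge u c z)) (lin_slope a c).
  under eq_fun do rewrite gordon_lin_nudge.
  have := is_derive_scale (lin_slope a c) z => h.
  by apply: (@is_derive_eq _ _ _ _ _ _ _ _ (is_deriveD
    (is_derive_cst (gordon_lin a u) z 1) h)); rewrite add0r.
have hv : is_derive z 1 (fun z => snorm (gordon_vec a (nudge u c z)))
   (if row_of c is Some i then slope a c * sdir i (gordon_vec a (nudge u c z)) else 0).
  under eq_fun do rewrite gordon_vec_nudge.
  rewrite gordon_vec_nudge; case: row_of => [i|]; last exact: is_derive_cst.
  have h1 := is_derive_snorm (gordon_vec a u) i (slope a c * z).
  have h2 := is_derive_scale (slope a c) z.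
  have h3 := @is_derive1_comp _ (fun t => snorm (nudge (gordon_vec a u) i t)) _ z _ _ h1 h2.
  by apply: (@is_derive_eq _ _ _ _ _ _ _ _ h3); rewrite mulrC.
by apply: (@is_derive_eq _ _ _ _ _ _ _ _ (is_deriveD hv hl)).
Qed.

Lemma is_derive_gordon_grad a c u (z : R) :
  is_derive z 1 (fun z => gordon_grad a c (nudge u c z)) (gordon_hess a c (nudge u c z)).
Proof.
have hv : is_derive z 1 (fun z => if row_of c is Some i
     then slope a c * sdir i (gordon_vec a (nudge u c z)) else 0) (gordon_hess a c (nudge u c z)).
  under eq_fun do rewrite gordon_vec_nudge.
  rewrite /gordon_hess gordon_vec_nudge; case: row_of => [i|]; last exact: is_derive_cst.
  have h1 := is_derive_sdir (gordon_vec a u) i (slope a c * z).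
  have h2 := is_derive_scale (slope a c) z.
  have h3 := @is_derive1_comp _ (fun t => sdir i (nudge (gordon_vec a u) i t)) _ z _ _ h1 h2.
  apply: (@is_derive_eq _ _ _ _ _ _ _ _ (is_deriveZ (slope a c) h3)).
  by rewrite /GRing.scale/=; ring.
have hl : is_derive z 1 (fun=> lin_slope a c : R) 0 by exact: is_derive_cst.
by apply: (@is_derive_eq _ _ _ _ _ _ _ _ (is_deriveD hv hl)); rewrite addr0.
Qed.

Lemma x_le1 a j : `|x a j| <= 1.
Proof.
rewrite -(@expr_le1 _ 2)// real_normK ?num_real// -(x1 a) (bigD1 j)//= lerDl.
by apply: sumr_ge0 => k _; rewrite sqr_ge0.
Qed.

Lemma slope_le1 a c : `|slope a c| <= 1.
Proof.
by case: c => [[[i j]|[]]|[i|j]] /=; rewrite ?normr0 ?normr1 ?ler01// x_le1.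
Qed.

Lemma blip_gordon_vec a (b : ('I_m -> R) -> R) : blip b -> blip (fun u => b (gordon_vec a u)).
Proof.
move=> [K [K0 b1 b2]]; exists K; split=> // u c z; rewrite gordon_vec_nudge.
case: row_of => [i|]; last by rewrite subrr normr0 !mulr_ge0 ?expR_ge0.
apply: (le_trans (b2 _ _ _)).
have h : `|slope a c * z| <= `|z| by rewrite normrM ler_piMl// slope_le1.
by apply: ler_pM; rewrite ?mulr_ge0 ?expR_ge0 ?ler_expR// ler_wpM2l.
Qed.

Lemma gordon_grad_blip a c : blip (gordon_grad a c).
Proof.
apply: blipD; last exact: blip_cst.
case: row_of => [i|]; last exact: blip_cst.
by apply: blipZ; apply: blip_gordon_vec; exact: sdir_blip.
Qed.

Lemma gordon_hess_blip a c : blip (gordon_hess a c).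
Proof.
rewrite /gordon_hess; case: row_of => [i|]; last exact: blip_cst.
apply: blipZ; apply: (@blip_gordon_vec a (fun y => (1 - sdir i y ^+ 2) / snorm y)).
apply: blipM; last exact: snormV_blip.
apply: blipD; first exact: blip_cst.
have h := blipM (@sdir_blip R m i) (@sdir_blip R m i).
by have := blipZ (-1) h; under eq_fun do rewrite mulN1r -expr2.
Qed.

Definition entry_coords : seq gcoord := map entry_coord (index_enum ('I_m * 'I_n)%type).
Definition matrix_coords : seq gcoord := entry_coords ++ [:: common_coord].
Definition row_coords : seq gcoord := map row_coord (index_enum 'I_m).
Definition col_coords : seq gcoord := map col_coord (index_enum 'I_n).
Definition vector_coords : seq gcoord := row_coords ++ col_coords.

Lemma sum_matrix_coords (f : gcoord -> R) :
  \sum_(c <- matrix_coords) f c = \sum_i \sum_j f (entry_coord (i, j)) + f common_coord.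
Proof.
rewrite big_cat big_seq1 big_map/=; congr (_ + _).
by rewrite (pair_bigA _ (fun i j => f (entry_coord (i, j))))/=; apply: eq_bigr => -[].
Qed.

Lemma sum_vector_coords (f : gcoord -> R) :
  \sum_(c <- vector_coords) f c = \sum_i f (row_coord i) + \sum_j f (col_coord j).
Proof. by rewrite big_cat !big_map. Qed.

(** The covariance inequality of Gordon's comparison, (1 - N) (1 - X) >= 0. *)
Lemma kernel_le (N X : R) : N <= 1 -> X <= 1 -> N + X <= X * N + 1.
Proof. by move=> N1 X1; have := mulr_ge0 (x := 1 - N) (y := 1 - X); lra. Qed.

Lemma dot_le1 (k : nat) (y z : 'I_k -> R) :
  \sum_i y i ^+ 2 <= 1 -> \sum_i z i ^+ 2 <= 1 -> \sum_i y i * z i <= 1.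
Proof.
move=> y1 z1; apply: (@le_trans _ _ (\sum_i (y i ^+ 2 + z i ^+ 2) / 2)).
  apply: ler_sum => i _; have := sqr_ge0 (y i - z i); rewrite sqrrB; lra.
rewrite -mulr_suml big_split/=; lra.
Qed.

Lemma gordon_grad_bounded : exists C1 : R, 0 <= C1 /\ forall a c u, `|gordon_grad a c u| <= C1.
Proof.
pose K a c := sval (cid (gordon_grad_blip a c)).
have K0 a c : 0 <= K a c by rewrite /K; case: cid => /= ? [].
exists (\sum_a \sum_c K a c); split.
  by apply: sumr_ge0 => a _; exact: sumr_ge0.
move=> a c u; apply: (@le_trans _ _ (K a c)); first by rewrite /K; case: cid => /= ? [].
rewrite (bigD1 a)//= (bigD1 c)//= -addrA lerDl addr_ge0// sumr_ge0// => b _.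
exact: sumr_ge0.
Qed.

Lemma softmin_gordon_loglip : exists C, loglip C (softmin q gordon_obj).
Proof.
have [C1 [C10 L1C]] := gordon_grad_bounded.
by exists C1; exact: (softmin_loglip a0 q1 C10 is_derive_gordon_obj L1C).
Qed.

(** For gradient directions n_a, n_b at x_a, x_b, the inner products of the
gradients are <n_a, n_b> <x_a, x_b> + 1 over the coordinates of (A, gamma) and
<n_a, n_b> + <x_a, x_b> over those of (g, h).  They are compared by
[kernel_le] and coincide for a = b because x_a is a unit vector. *)
Lemma softmin_gordon u :
  gavgs 1 matrix_coords (softmin q gordon_obj) u <= gavgs 1 vector_coords (softmin q gordon_obj) u.
Proof.
have [C1 [C10 L1C]] := gordon_grad_bounded.
apply: (softmin_comparison a0 q1 C10 is_derive_gordon_obj is_derive_gordon_grad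
  gordon_grad_blip gordon_hess_blip L1C).
- move=> a b v; rewrite sum_matrix_coords sum_vector_coords /gordon_grad /=.
  under eq_bigr do rewrite !mul1r !addr0.
  under [X in _ + X <= _]eq_bigr do rewrite !add0r.
  under [X in _ <= X + _]eq_bigr do under eq_bigr do rewrite !addr0 mulrACA.
  under [X in _ <= X + _]eq_bigr do rewrite -mulr_suml.
  rewrite -mulr_sumr !add0r mul1r.
  apply: kernel_le; apply: dot_le1; rewrite ?x1 ?sum_sdir_sqr_le1//.
- move=> a v; rewrite sum_matrix_coords sum_vector_coords /gordon_grad /=.
  under eq_bigr do rewrite !mul1r !addr0.
  under [X in _ + X = _]eq_bigr do rewrite !add0r.
  under [X in _ = X + _]eq_bigr do under eq_bigr do rewrite !addr0 exprMn.
  under [X in _ = X + _]eq_bigr do rewrite -mulr_suml.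
  by rewrite -mulr_sumr x1 mul1r add0r expr1n.
- move=> a v; rewrite sum_matrix_coords sum_vector_coords /gordon_hess /=.
  under eq_bigr do rewrite expr1n mul1r.
  under [X in _ = X + _]eq_bigr do rewrite -mulr_suml.
  by rewrite -mulr_sumr x1 mul1r [X in _ + X = _]big1.
Qed.

End gordon.

(** * From independent random variables to averaging operators *)

Section cells.
Context {R : realType}.

(** The half-open intervals of length del with endpoints in del Z, indexed
by natural numbers to fit countable unions. *)
Definition cell (del : R) (k : nat) : set R :=
  if (pickle_inv k : option int) is Some c then `[c%:~R * del, (c + 1)%:~R * del[%classic
  else set0.
Definition cell_pt (del : R) (k : nat) : R :=
  if (pickle_inv k : option int) is Some c then c%:~R * del else 0.

Lemma measurable_cell del k : measurable (cell del k).
Proof. by rewrite /cell; case: pickle_inv => [c|]; [exact: measurable_itv|exact: measurable0]. Qed.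

Lemma cell_close del k z : 0 < del -> cell del k z -> `|z - cell_pt del k| <= del.
Proof.
move=> d0; rewrite /cell /cell_pt; case: pickle_inv => // c.
rewrite /= in_itv/= intrD mulrDl mul1r => /andP[h1 h2].
by rewrite ger0_norm ?subr_ge0//; lra.
Qed.

Lemma cell_cover del : 0 < del -> \bigcup_k cell del k = setT.
Proof.
move=> d0; apply/seteqP; split=> // z _.
exists (pickle (Num.floor (z / del))); first exact: I.
rewrite /cell pickleK_inv /= in_itv/=; apply/andP; split.
  by rewrite -ler_pdivlMr// floor_le_tmp.
by rewrite -ltr_pdivrMr// floorD1_gt.
Qed.

Lemma cell_triv del : 0 < del -> trivIset setT (cell del).
Proof.
move=> d0; apply/trivIsetP => i j _ _ ij; apply/seteqP; split=> // z [].
rewrite /cell.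
have := pickle_invK (T := int) i; case: pickle_inv => [c|//] /= ci.
have := pickle_invK (T := int) j; case: pickle_inv => [c'|//] /= cj.
rewrite !in_itv/= => /andP[h1 h2] /andP[h3 h4].
move: ij; rewrite -ci -cj; suff -> : c = c' by rewrite eqxx.
have lt_cell (a b : int) : a%:~R * del <= z -> z < (b + 1)%:~R * del -> a <= b.
  move=> ha hb; have := le_lt_trans ha hb.
  by rewrite ltr_pM2r// ltr_int ltzD1.
by apply/eqP; rewrite eq_le !lt_cell.
Qed.

Lemma small_cells del : 0 < del -> exists (D : nat -> set R) (v : nat -> R),
  [/\ forall k, measurable (D k), \bigcup_k D k = setT, trivIset setT D &
    forall k z, D k z -> `|z - v k| <= del].
Proof.
move=> d0; exists (cell del), (cell_pt del); split.
- exact: measurable_cell.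
- exact: cell_cover.
- exact: cell_triv.
- by move=> k z; exact: cell_close.
Qed.

End cells.

Section transfer.
Context d (T : measurableType d) (R : realType) (P : probability T R).
Context (J : finType) (Y : J -> {RV P >-> R}).
Hypothesis Ynormal : forall j, standard_normal (Y j).
Hypothesis Yindep : mutually_independent Y.
Local Notation nu := (normal_prob (0 : R) 1).
Implicit Types (u : J -> R) (f : (J -> R) -> R).

Definition cyl (K : {set J}) (B : J -> set R) : set T :=
  \bigcap_(k in [set` K]) (Y k @^-1` B k).

Lemma measurable_cyl (K : {set J}) (B : J -> set R) :
  (forall k, measurable (B k)) -> measurable (cyl K B).
Proof.
move=> mB; apply: fin_bigcap_measurable; first exact: finite_finset.
by move=> k _; rewrite -[X in measurable X]setTI; exact: measurable_funP.
Qed.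

Definition on_list u (s : seq J) (w : T) : J -> R :=
  fun j => u j + (if j \in s then Y j w else 0).

Lemma cylU (K : {set J}) (B : J -> set R) i (D : set R) : i \notin K ->
  cyl (i |: K) (fun k => if k == i then D else B k) = cyl K B `&` Y i @^-1` D.
Proof.
move=> iK; apply/seteqP; split => [w h|w [h1 h2] k /=].
  split => [k /= kK|].
    have := h k; rewrite /= in_setU1 kK orbT => /(_ isT).
    by case: eqP => // ki; rewrite -ki kK in iK.
  by have := h i; rewrite /= in_setU1 !eqxx => /(_ isT).
by rewrite in_setU1; case: eqVneq => [->//|_ /= kK]; exact: h1.
Qed.

Lemma prob_cylU (K : {set J}) (B : J -> set R) i (D : set R) : i \notin K ->
  (forall k, measurable (B k)) -> measurable D ->
  P (cyl K B `&` Y i @^-1` D) = (P (cyl K B) * nu D)%E.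
Proof.
move=> iK mB mD; rewrite -cylU// /cyl !Yindep; last 2 first.
- by move=> k _.
- by move=> k _; case: eqP.
rewrite big_setU1//= eqxx muleC; congr (_ * _)%E.
  by apply: eq_bigr => k kK; case: eqP => // ki; rewrite -ki kK in iK.
exact: (Ynormal i mD).
Qed.

Lemma measurable_on_list C f u s : loglip C f ->
  measurable_fun setT (fun w => f (on_list u s w)).
Proof.
move=> fl; apply: (measurable_loglip (X := fun j w => u j + (if j \in s then Y j w else 0)) fl).
by move=> j; apply: measurable_funD => //; case: (j \in s).
Qed.

Lemma on_list_cons u s i w : i \notin s ->
  on_list u (i :: s) w = on_list (nudge u i (Y i w)) s w.
Proof.
move=> is_; apply/funext => j; rewrite /on_list /nudge inE.
have [->|ji] /= := eqVneq j i; first by rewrite (negbTE is_) addr0.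
by rewrite addr0.
Qed.

Lemma nudge_close C f u i s (z y del : R) w : loglip C f -> `|z - y| <= del ->
  f (on_list (nudge u i z) s w) <= expR (C * del) * f (on_list (nudge u i y) s w).
Proof.
move=> fl zy; have [C0 f0 fC] := fl.
have -> : on_list (nudge u i z) s w = nudge (on_list (nudge u i y) s w) i (z - y).
  by apply/funext => j; rewrite /on_list /nudge; case: eqP => _; ring.
apply: (le_trans (fC _ _ _)); rewrite ler_wpM2r ?(ltW (f0 _))//.
by rewrite ler_expR ler_wpM2l.
Qed.

(** Independence is a product rule for events, so the variables are
revealed one at a time.  The line is cut into cells of length del; on the
event that Y_i lies in a given cell, Y_i is replaced by a point of that cell
at the cost of a factor exp (C del), and this event is absorbed into the
cylinder for the remaining variables.  Then del tends to 0. *)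
Lemma integral_cyl_le C f s : loglip C f -> uniq s ->
  forall (K : {set J}) (B : J -> set R) u,
    (forall i, i \in s -> i \notin K) -> (forall k, measurable (B k)) ->
  (\int[P]_(w in cyl K B) (f (on_list u s w))%:E <=
    P (cyl K B) * (gavgs 1 s f u)%:E)%E.
Proof.
move=> fl; have [C0 f0 fC] := fl.
elim: s => [_|i s IH /= /andP[is_ us]] K B u sK mB.
  have -> : (fun w => (f (on_list u [::] w))%:E) = cst (f u)%:E.
    by apply/funext => w /=; congr (f _)%:E; apply/funext => j; rewrite /on_list addr0.
  rewrite integral_cst; last exact: measurable_cyl.
  by rewrite muleC; apply: lexx.
have iK : i \notin K by apply: sK; rewrite mem_head.
have sK' k : k \in s -> k \notin i |: K.
  move=> ks; rewrite in_setU1 negb_or sK ?inE ?ks ?orbT// andbT.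
  by apply: contra is_ => /eqP <-.
set G := gavgs 1 s f.
have Gl : loglip C G by exact: gavgs_loglip.
have [_ G0 _] := Gl.
have mcK := measurable_cyl K mB.
have mG : measurable_fun setT (fun z : R => G (nudge u i z)).
  by apply: (measurable_nudge u i Gl); exact: measurable_id.
have bound del : 0 < del -> (\int[P]_(w in cyl K B) (f (on_list u (i :: s) w))%:E <=
    (expR (2 * C * del))%:E * (P (cyl K B) * (gavgs 1 (i :: s) f u)%:E))%E.
  move=> d0.
  have [D [v [mD UD tD Dv]]] := small_cells d0.
  pose E k := cyl K B `&` Y i @^-1` D k.
  have mYc k : measurable (Y i @^-1` D k).
    by rewrite -[X in measurable X]setTI; apply: measurable_funP => //; exact: mD.
  have mE k : measurable (E k) by exact: measurableI.
  have UE : cyl K B = \bigcup_k E k.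
    by rewrite -setI_bigcupr -preimage_bigcup UD preimage_setT setIT.
  have tE : trivIset setT E.
    apply: trivIset_setIl => a b _ _ [w [wa wb]]; apply: tD => //.
    by exists (Y i w).
  have e0 : (0 <= (expR (C * del))%:E)%E by rewrite lee_fin expR_ge0.
  have term k : (\int[P]_(w in E k) (f (on_list u (i :: s) w))%:E <=
     (expR (2 * C * del))%:E * (P (cyl K B) *
       \int[nu]_(z in D k) (G (nudge u i z))%:E))%E.
    have le1 : (\int[P]_(w in E k) (f (on_list u (i :: s) w))%:E <=
        \int[P]_(w in E k) ((expR (C * del))%:E * (f (on_list (nudge u i (v k)) s w))%:E))%E.
      apply: ge0_le_integral => //.
      - by move=> w _; rewrite lee_fin ltW.
      - by apply/measurable_EFinP/measurable_funTS; exact: measurable_on_list fl.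
      - apply/measurable_EFinP/measurable_funTS; apply: measurable_funM => //.
        exact: measurable_on_list fl.
      - move=> w [_ wk]; rewrite -EFinM lee_fin on_list_cons//.
        by apply: (nudge_close _ _ _ _ fl); exact: Dv.
    apply: (le_trans le1).
    rewrite ge0_integralZl//; last 2 first.
    - by apply/measurable_EFinP/measurable_funTS; exact: measurable_on_list fl.
    - by move=> w _; rewrite lee_fin ltW.
    have mB' : forall j, measurable (if j == i then D k else B j).
      by move=> j; case: eqP => // _; exact: mD.
    have := IH us (i |: K) (fun j => if j == i then D k else B j) (nudge u i (v k)) sK' mB'.
    rewrite cylU// => le2.
    apply: le_trans; first by apply: lee_wpmul2l; [exact: e0|exact: le2].
    rewrite prob_cylU//.
    have le3 : (nu (D k) * (G (nudge u i (v k)))%:E <=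
      (expR (C * del))%:E * \int[nu]_(z in D k) (G (nudge u i z))%:E)%E.
      rewrite -ge0_integralZl//; last 3 first.
      - exact: mD.
      - by apply/measurable_EFinP/measurable_funTS.
      - by move=> z _; rewrite lee_fin ltW.
      rewrite muleC -integral_cst; last exact: mD.
      apply: ge0_le_integral => //.
      - exact: mD.
      - by move=> z _; rewrite lee_fin ltW.
      - by apply/measurable_EFinP; apply: measurable_funTS; exact: measurable_funM.
      - move=> z zk; rewrite -EFinM lee_fin.
        have -> : nudge u i (v k) = nudge (nudge u i z) i (v k - z).
          by rewrite nudge_nudge addrC subrK.
        have [_ _ GC] := Gl; apply: (le_trans (GC _ _ _)).
        rewrite ler_wpM2r ?(ltW (G0 _))// ler_expR ler_wpM2l// distrC.
        exact: Dv.
    have Pfin : P (cyl K B) \is a fin_num by exact: fin_num_measure.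
    have P0 : (0 <= P (cyl K B))%E by exact: measure_ge0.
    rewrite -muleA; apply: le_trans.
      by apply: lee_wpmul2l; [exact: e0|apply: lee_wpmul2l; [exact: P0|exact: le3]].
    have -> : 2 * C * del = C * del + C * del by ring.
    rewrite expRD EFinM -!muleA; apply: lee_wpmul2l => //.
    by rewrite muleCA; apply: lexx.
  have mf s' u0 A : measurable_fun A (fun w => (f (on_list u0 s' w))%:E).
    by apply/measurable_EFinP/measurable_funTS; exact: measurable_on_list fl.
  have ge0f s' u0 w : (0 <= (f (on_list u0 s' w))%:E)%E by rewrite lee_fin ltW.
  rewrite {1}UE ge0_integral_bigcup//.
  apply: (@le_trans _ _ (\sum_(k <oo) (expR (2 * C * del))%:E * (P (cyl K B) *
       \int[nu]_(z in D k) (G (nudge u i z))%:E))%E).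
    by apply: lee_nneseries => // k _ _; exact: integral_ge0.
  have Gi0 k : (0 <= \int[nu]_(z in D k) (G (nudge u i z))%:E)%E.
    by apply: integral_ge0 => z _; rewrite lee_fin ltW.
  have Pfin : P (cyl K B) \is a fin_num by exact: fin_num_measure.
  have P0 : (0 <= P (cyl K B))%E by exact: measure_ge0.
  rewrite nneseriesZl; last by move=> k _; exact: mule_ge0.
  rewrite -(fineK Pfin) nneseriesZl//.
  rewrite -ge0_integral_bigcup//; last 2 first.
  - by apply/measurable_EFinP/measurable_funTS.
  - by move=> z _; rewrite lee_fin ltW.
  rewrite UD /=.
  rewrite /gavg -nexpE; last exact: loglip_nint Gl.
  by under [X in (_ <= _ * (_ * X))%E]eq_integral do rewrite mul1r.
set A := (\int[P]_(w in cyl K B) _)%E in bound *.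
have Pfin : P (cyl K B) \is a fin_num by exact: fin_num_measure.
rewrite -(fineK Pfin) -EFinM in bound *.
set b := fine _ * _ in bound *.
have b0 : 0 <= b.
  have [_ h _] := gavgs_loglip 1 (i :: s) fl.
  by apply: mulr_ge0; [rewrite fine_ge0 ?measure_ge0|exact: ltW (h u)].
apply/lee_addgt0Pr => e e0.
have [del d0 hdel] : exists2 del, 0 < del & expR (2 * C * del) * b <= b + e.
  (* The choice of del makes exp (2 C del) at most 1 + e / (b + 1). *)
  have q0 : 0 < e / (b + 1) by rewrite divr_gt0// ltr_wpDl.
  have l0 : 0 < ln (1 + e / (b + 1)) by rewrite ln_gt0// ltrDl.
  have c0 : 0 < 2 * C + 1 by rewrite ltr_wpDl// mulr_ge0.
  exists (ln (1 + e / (b + 1)) / (2 * C + 1)); first exact: divr_gt0.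
  apply: (@le_trans _ _ ((1 + e / (b + 1)) * b)).
    rewrite ler_wpM2r// -[leRHS]lnK ?posrE ?addr_gt0// ler_expR mulrA mulrAC.
    by rewrite ler_piMl ?(ltW l0)// ler_pdivrMr// mul1r lerDl.
  rewrite mulrDl mul1r lerD2l mulrAC ler_pdivrMr ?ltr_wpDl//.
  by rewrite ler_wpM2l ?(ltW e0)// lerDl.
by apply: (le_trans (bound _ d0)); rewrite -EFinM lee_fin.
Qed.

Lemma integral_le_gavgs C f : loglip C f ->
  (\int[P]_w (f (fun j => Y j w))%:E <= (gavgs 1 (index_enum J) f (fun=> 0))%:E)%E.
Proof.
move=> fl; have := @integral_cyl_le C f (index_enum J) fl (index_enum_uniq J)
  finset.set0 (fun=> setT) (fun=> 0) _ _.
have -> : cyl finset.set0 (fun=> setT) = setT.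
  by apply/seteqP; split=> // w _ k /=; rewrite finset.in_set0.
rewrite probability_setT mul1e => h.
have -> : (fun w => (f (fun j => Y j w))%:E) =
    (fun w => (f (on_list (fun=> 0) (index_enum J) w))%:E).
  by apply/funext => w; congr (f _)%:E; apply/funext => j; rewrite /on_list add0r mem_index_enum.
by apply: h => // i _; rewrite finset.in_set0.
Qed.

End transfer.

Section embedding.
Context {R : realType} {I J : finType}.
Variables (E : (J -> R) -> (I -> R)) (e : J -> I).
Hypothesis Ee : forall y j z, E (nudge y j z) = nudge (E y) (e j) z.

Lemma loglip_embed C f : loglip C f -> loglip C (fun y => f (E y)).
Proof. by move=> [C0 f0 fC]; split=> // y j z; rewrite Ee. Qed.

Lemma gavgs_embed s l f y : gavgs s (map e l) f (E y) = gavgs s l (fun y => f (E y)) y.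
Proof.
elim: l y => //= j l IH y; rewrite /gavg; congr nexp; apply/funext => z.
by rewrite -Ee IH.
Qed.

End embedding.

(** * Small values on finitely many unit vectors *)

Section euclidean_norm.
Context {R : realType} (n : nat).
Implicit Types (v : 'cV[R]_n).

Lemma l2norm_ge0 v : 0 <= l2norm v.
Proof. exact: sqrtr_ge0. Qed.

Lemma l2norm_sqr v : l2norm v ^+ 2 = \sum_i v i 0 ^+ 2.
Proof. by rewrite sqr_sqrtr// sumr_ge0// => i _; rewrite sqr_ge0. Qed.

Lemma l2normZ (a : R) v : 0 <= a -> l2norm (a *: v) = a * l2norm v.
Proof.
move=> a0; rewrite /l2norm; under eq_bigr do rewrite mxE exprMn.
by rewrite -mulr_sumr sqrtrM ?sqr_ge0// sqrtr_sqr ger0_norm.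
Qed.

Lemma min_l2norm_ge0 (m : nat) (M : 'M[R]_(m, n)) (S : set 'cV[R]_n) :
  0 <= min_l2norm M S.
Proof.
have [->|/set0P[x xS]] := eqVneq S set0.
  by rewrite /min_l2norm image_set0 inf0.
apply: lb_le_inf; first by exists (l2norm (M *m x)), x.
by move=> _ [y _ <-]; exact: sqrtr_ge0.
Qed.

End euclidean_norm.

Section small_probability.
Context d (T : measurableType d) (R : realType) (P : probability T R).
Context (m n : nat) (A : 'M[{RV P >-> R}]_(m, n)).
Hypothesis Aiid : iid_standard_normal A.

Lemma mul_realization w (X : 'cV[R]_n) i :
  (realization A w *m X) i 0 = \sum_j A i j w * X j 0.
Proof. by rewrite mxE; apply: eq_bigr => j _; rewrite mxE. Qed.

Lemma measurable_l2norm (X : 'cV[R]_n) :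
  measurable_fun setT (fun w => l2norm (realization A w *m X)).
Proof.
have ms : measurable_fun setT (Num.sqrt : R -> R).
  by apply: continuous_measurable_fun; exact: sqrt_continuous.
apply: (measurableT_comp ms).
apply: measurable_sum => i; apply: measurable_funX.
under eq_fun do rewrite mul_realization.
apply: measurable_sum => j; apply: measurable_funM => //.
Qed.

Lemma measurable_small (X : 'cV[R]_n) t :
  measurable [set w | l2norm (realization A w *m X) < t].
Proof.
rewrite -[X in measurable X]setTI.
have := measurable_l2norm X measurableT (measurable_itv `]-oo, t[).
by congr measurable; rewrite !setTI; apply/seteqP; split => w /=; rewrite in_itv.
Qed.

Section points.
Variables (p : nat) (a0 : 'I_p) (X : 'I_p -> 'cV[R]_n).
Hypothesis X1 : forall a, l2norm (X a) = 1.
Let x a j := X a j 0.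
Let q : R := p%:R.

Let x1 a : \sum_j x a j ^+ 2 = 1.
Proof. by rewrite -(l2norm_sqr (X a)) X1 expr1n. Qed.

Let q1 : 1 <= q.
Proof. by rewrite ler1n; case: p a0 => [[]|]. Qed.

Let q0 : 0 < q. Proof. exact: lt_le_trans q1. Qed.

Definition from_matrix (y : 'I_m * 'I_n -> R) : gcoord m n -> R :=
  fun c => if c is inl (inl ij) then y ij else 0.

Lemma from_matrix_nudge y ij z :
  from_matrix (nudge y ij z) = nudge (from_matrix y) (entry_coord ij) z.
Proof.
by apply/funext => -[[kl|[]]|[k|l]]; rewrite /nudge /= ?addr0.
Qed.

Definition softmin_norm : (gcoord m n -> R) -> R := softmin q (gordon_obj x).

Let Sl : exists C, loglip C softmin_norm.
Proof. exact: (softmin_gordon_loglip _ a0 q1 x1). Qed.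

Let S0 (u : gcoord m n -> R) : 0 < gibbs_sum q (gordon_obj x) u.
Proof. exact: gibbs_sum_gt0. Qed.

Lemma softmin_norm_ge a u : expR (- gordon_obj x a u) <= softmin_norm u.
Proof.
rewrite /softmin_norm /softmin ler_expR -(ler_pM2l q0) mulrA mulfV ?gt_eqF// mul1r.
rewrite -[leLHS]expRK ler_ln ?posrE ?expR_gt0//.
rewrite /gibbs_sum (bigD1 a)//= mulrN mulNr lerDl.
by apply: sumr_ge0 => b _; exact: expR_ge0.
Qed.

(** The common variable multiplies the soft minimum by exp (- Z), whose
mean exp (1/2) is at least one. *)
Lemma gavg_common_coord u : softmin_norm u <= gavg 1 (common_coord m n) softmin_norm u.
Proof.
have e z : softmin_norm (nudge u (common_coord m n) (1 * z)) = softmin_norm u * expR ((-1) * z).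
  rewrite mul1r /softmin_norm /softmin -expRD.
  have -> : gibbs_sum q (gordon_obj x) (nudge u (common_coord m n) z) =
      expR (- q * z) * gibbs_sum q (gordon_obj x) u.
    rewrite /gibbs_sum mulr_sumr; apply: eq_bigr => a _; rewrite -expRD; congr expR.
    by rewrite /gordon_obj gordon_vec_nudge gordon_lin_nudge /= mul1r; ring.
  congr expR; rewrite lnM ?posrE ?expR_gt0//.
  by rewrite expRK; field; rewrite gt_eqF.
rewrite /gavg; under eq_fun do rewrite e.
have [_ [_ s0 _]] := Sl.
rewrite nexpZ ?nexp_expM; last exact: nint_expM.
rewrite ler_peMr ?(ltW (s0 u))//; apply: le_trans (expR_ge1Dx _).
by rewrite lerDl divr_ge0// sqr_ge0.
Qed.

(** Markov's inequality for the soft minimum of |A x_a|: where some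
|A x_a| is below t it is at least exp (- (t + 1)), the extra unit coming from
the smoothing of the norm. *)
Lemma prob_small_le t :
  (P (\bigcup_(a in setT) [set w | (l2norm (realization A w *m X a) < t)%R]) <=
    (expR (t + 1) * gavgs 1 (vector_coords m n) softmin_norm (fun=> 0))%:E)%E.
Proof.
have [C Cl] := Sl; have [C0 s0 _] := Cl.
pose F y := softmin_norm (from_matrix y).
have Fl : loglip C F := loglip_embed from_matrix_nudge Cl.
set E := \bigcup_(a in setT) _.
have mE : measurable E.
  apply: fin_bigcup_measurable; first exact: finite_finset.
  by move=> a _; exact: measurable_small.
pose Y (ij : 'I_m * 'I_n) := A ij.1 ij.2.
have mF : measurable_fun setT (fun w => F (fun ij => Y ij w)).
  by apply: (measurable_loglip (X := fun ij w => Y ij w) Fl) => ij.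
have step1 : (\int[P]_w (F (fun ij => Y ij w))%:E <=
    (gavgs 1 (vector_coords m n) softmin_norm (fun=> 0))%:E)%E.
  apply: (le_trans (@integral_le_gavgs _ T R P _ Y (fun ij => Aiid.1 ij.1 ij.2) Aiid.2 C F Fl)).
  rewrite lee_fin -(gavgs_embed from_matrix_nudge 1 _ softmin_norm).
  have -> : from_matrix (fun=> 0) = fun=> 0.
    by apply/funext => -[[?|?]|[?|?]].
  apply: le_trans (softmin_gordon a0 q1 x1 (fun=> 0)).
  rewrite /matrix_coords gavgs_cat; apply: (@le_gavgs _ _ C) => //=.
    exact: (gavg_loglip 1 (common_coord m n) Cl).
  exact: gavg_common_coord.
rewrite EFinM -[leLHS]mul1e.
have e0 : 0 < expR (- (t + 1)) by exact: expR_gt0.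
have step2 : ((expR (- (t + 1)))%:E * P E <= \int[P]_w (F (fun ij => Y ij w))%:E)%E.
  rewrite -integral_cst//.
  apply: (@le_trans _ _ (\int[P]_(w in E) (F (fun ij => Y ij w))%:E)%E).
    apply: ge0_le_integral => //.
    - by move=> w _; rewrite lee_fin expR_ge0.
    - by apply/measurable_EFinP; apply: measurable_funTS; exact: mF.
    - move=> w [a _ /= wa]; rewrite lee_fin; apply: le_trans (softmin_norm_ge a _).
      rewrite ler_expR lerN2.
      have vE : gordon_vec x a (from_matrix (fun ij => Y ij w)) =
          fun i => (realization A w *m X a) i 0.
        apply/funext => i; rewrite mul_realization /gordon_vec /= addr0.
        by apply: eq_bigr.
      rewrite /gordon_obj vE /gordon_lin /= add0r big1 ?addr0; last by move=> j _; rewrite mul0r.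
      apply: (@le_trans _ _ (l2norm (realization A w *m X a) + 1)); last by rewrite lerD2r ltW.
      rewrite /snorm /l2norm; set S := \sum_i _.
      have Sge0 : 0 <= S by apply: sumr_ge0 => i _; rewrite sqr_ge0.
      rewrite -(@ler_pXn2r _ 2) ?nnegrE ?addr_ge0 ?sqrtr_ge0// sqrrD !sqr_sqrtr ?addr_ge0//.
      by have := sqrtr_ge0 S; rewrite mulr1 expr1n => ?; lra.
  apply: ge0_subset_integral => //.
    by apply/measurable_EFinP.
  by move=> w _; rewrite lee_fin; exact: ltW (s0 _).
have h := le_trans step2 step1.
have ee : ((expR (t + 1))%:E * (expR (- (t + 1)))%:E = 1)%E.
  by rewrite -EFinM -expRD subrr expR0.
by rewrite -ee -muleA; apply: lee_wpmul2l => //; rewrite lee_fin expR_ge0.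
Qed.

End points.
End small_probability.

(** * Separable upper bounds for the vector side *)

Section separable.
Context {R : realType} {I : finType}.
Variables (C : R) (phi : I -> R -> R).
Hypothesis C0 : 0 <= C.
Hypothesis phi0 : forall c t, 0 < phi c t.
Hypothesis phiC : forall c t z, phi c (t + z) <= expR (C * `|z|) * phi c t.
Let F (u : I -> R) := \prod_c phi c (u c).

Lemma prod_loglip : loglip C F.
Proof.
split=> // [u|u i z]; first by apply: prodr_gt0.
rewrite /F (bigD1 i)//= [in leRHS](bigD1 i)//= mulrA.
have -> : \prod_(c | c != i) phi c (nudge u i z c) = \prod_(c | c != i) phi c (u c).
  by apply: eq_bigr => c /negbTE ci; rewrite /nudge ci addr0.
rewrite ler_wpM2r//; first by apply: prodr_ge0 => c _; rewrite ltW.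
by rewrite /nudge eqxx.
Qed.

Let F_nudge u i z : F (nudge u i z) = (\prod_(c | c != i) phi c (u c)) * phi i (u i + z).
Proof.
rewrite /F (bigD1 i)//= mulrC; congr (_ * _); last by rewrite /nudge eqxx.
by apply: eq_bigr => c /negbTE ci; rewrite /nudge ci addr0.
Qed.

Lemma phi_nint i t : nint (fun z => phi i (t + z)).
Proof.
pose u : I -> R := fun=> t.
have h := loglip_nint u i 1 prod_loglip.
set a := \prod_(c | c != i) phi c (u c).
have a0 : 0 < a by apply: prodr_gt0.
have := nintZ a^-1 h; congr nint; apply/funext => z.
by rewrite mul1r F_nudge mulrA mulVf ?mul1r// gt_eqF.
Qed.

Lemma gavgs_prod l u : uniq l -> gavgs 1 l F u =
  \prod_c (if c \in l then nexp (fun z => phi c (u c + z)) else phi c (u c)).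
Proof.
elim: l u => [//|i l IH] u /= /andP[il ul].
transitivity (nexp (fun z => (\prod_(c | c != i) (if c \in l
    then nexp (fun z => phi c (u c + z)) else phi c (u c))) * phi i (u i + z))).
  rewrite /gavg; congr nexp; apply/funext => z; rewrite IH// (bigD1 i)//= (negbTE il).
  rewrite mulrC; congr (_ * phi i _); last by rewrite /nudge eqxx mul1r.
  by apply: eq_bigr => c /negbTE ci; rewrite /nudge ci addr0.
rewrite nexpZ; last exact: phi_nint.
rewrite [RHS](bigD1 i)//= mem_head mulrC; congr (_ * _).
by apply: eq_bigr => c ci; rewrite inE (negbTE ci).
Qed.

End separable.

Section scalar_bounds.
Context {R : realType}.

Lemma expR_le_quad (x : R) : 0 <= x -> expR x <= 1 + x + x ^+ 2 * expR x.
Proof.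
move=> x0.
have h : expR x <= 1 + x * expR x.
  have := expR_ge1Dx (- x); rewrite -(ler_pM2l (expR_gt0 x)) -expRD subrr expR0.
  by rewrite mulrDr mulr1; lra.
by have := ler_wpM2l x0 h; rewrite expr2 -mulrA mulrDr mulr1; lra.
Qed.

Lemma expRN_le_quad (y : R) : 0 <= y -> expR (- y) <= 1 - y + y ^+ 2.
Proof.
move=> y0; have y1 : 0 < 1 + y by rewrite ltr_pwDl.
apply: (@le_trans _ _ (1 + y)^-1).
  by rewrite expRN lef_pV2 ?posrE ?expR_gt0// expR_ge1Dx.
rewrite -[leLHS]mul1r ler_pdivrMr//.
have -> : (1 - y + y ^+ 2) * (1 + y) = 1 + y ^+ 3 by ring.
by rewrite lerDl exprn_ge0.
Qed.

(** A function of Huber's type, quadratic near the origin and linear at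
infinity, lowered by tau / (2 r) and cut at 0.  It is Lipschitz, so its
exponential has a Lipschitz logarithm. *)
Definition huber (r tau z : R) : R :=
  Num.max 0 (Num.min (z ^+ 2 / (2 * r)) `|z| - tau / (2 * r)).

Definition trunc_abs (M z : R) : R := Num.min `|z| M.

Lemma huber_ge0 r tau z : 0 <= huber r tau z.
Proof. by rewrite le_max lexx. Qed.

Lemma huber_le r tau z : 0 < r -> 0 <= tau -> huber r tau z <= `|z| /\
  huber r tau z <= z ^+ 2 / (2 * r) /\
  huber r tau z <= Num.max (z ^+ 2 - tau) 0 / (2 * r).
Proof.
move=> r0 t0; have r2 : 0 < 2 * r by rewrite mulr_gt0.
have tr0 : 0 <= tau / (2 * r) by rewrite divr_ge0// ltW.
have h1 : Num.min (z ^+ 2 / (2 * r)) `|z| <= `|z| by rewrite ge_min lexx orbT.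
have h2 : Num.min (z ^+ 2 / (2 * r)) `|z| <= z ^+ 2 / (2 * r) by rewrite ge_min lexx.
rewrite /huber !ge_max normr_ge0 /=; split; first by lra.
rewrite !divr_ge0 ?sqr_ge0 ?(ltW r2)//=; last by rewrite le_max lexx orbT.
split; first by lra.
apply: (@le_trans _ _ ((z ^+ 2 - tau) / (2 * r))); first by rewrite mulrBl; lra.
by rewrite ler_pM2r ?invr_gt0// le_max lexx.
Qed.

(** Completing the square: - h y <= r y^2 / 2 + h^2 / (2 r), while |h|
bounds the left-hand side as |y| <= 1.  Summed over the support of a unit
vector, the terms in y^2 add up to r / 2. *)
Lemma huber_lin r tau h y : 0 < r -> 0 <= tau -> `|y| <= 1 ->
  - (h * y) <= r / 2 * y ^+ 2 + tau / (2 * r) + huber r tau h.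
Proof.
move=> r0 t0 y1; have r2 : 0 < 2 * r by rewrite mulr_gt0.
have key : - (h * y) <= r / 2 * y ^+ 2 + Num.min (h ^+ 2 / (2 * r)) `|h|.
  have [h1|h1] := leP (h ^+ 2 / (2 * r)) `|h|.
    have := sqr_ge0 (r * y + h); rewrite -(pmulr_lge0 _ (x := (2 * r)^-1)) ?invr_gt0//.
    have -> : (r * y + h) ^+ 2 / (2 * r) = r / 2 * y ^+ 2 + h * y + h ^+ 2 / (2 * r).
      by field; rewrite gt_eqF.
    lra.
  apply: (@le_trans _ _ `|h|); last by rewrite lerDr mulr_ge0 ?sqr_ge0// divr_ge0// ltW.
  by rewrite (le_trans (ler_norm _))// normrN normrM ler_piMr.
apply: (le_trans key); rewrite -addrA lerD2l addrC -lerBlDr.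
by rewrite le_max lexx orbT.
Qed.

Lemma huber_lip r tau s t : 0 < r -> huber r tau (s + t) <= huber r tau s + 2 * `|t|.
Proof.
move=> r0; have r2 : 0 < 2 * r by rewrite mulr_gt0.
have key : Num.min ((s + t) ^+ 2 / (2 * r)) `|s + t| <=
    Num.min (s ^+ 2 / (2 * r)) `|s| + 2 * `|t|.
  have nst := ler_normD s t.
  have t0 := normr_ge0 t.
  have [h|h] := leP (s ^+ 2 / (2 * r)) `|s|; last first.
    by rewrite ge_min; apply/orP; right; lra.
  have s2 : s ^+ 2 = `|s| ^+ 2 by rewrite real_normK ?num_real.
  have st2 : (s + t) ^+ 2 = `|s + t| ^+ 2 by rewrite real_normK ?num_real.
  have := normr_ge0 s; have := normr_ge0 (s + t).
  move: h; rewrite s2 st2 => h; move: h nst t0.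
  set a := `|s + t|; set b := `|s|; set c := `|t| => h nst c0 a0 b0.
  have b2r : b <= 2 * r.
    have [->|bn] := eqVneq b 0; first exact: ltW.
    have b00 : 0 < b by rewrite lt_def bn.
    by move: h; rewrite ler_pdivrMr// expr2 ler_pM2l.
  have [ar|ar] := leP a (2 * r).
    rewrite ge_min; apply/orP; left.
    have -> : a ^+ 2 / (2 * r) = b ^+ 2 / (2 * r) + (a - b) * (a + b) / (2 * r).
      by field; rewrite gt_eqF.
    rewrite lerD2l ler_pdivrMr//.
    have [ab|ab] := leP a b.
      apply: (@le_trans _ _ 0); last by rewrite !mulr_ge0// ltW.
      by rewrite mulr_le0_ge0 ?subr_le0// addr_ge0.
    apply: (@le_trans _ _ (c * (2 * (2 * r)))); last by rewrite le_eqVlt; apply/orP; left; apply/eqP; ring.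
    apply: ler_pM; rewrite ?subr_ge0 ?addr_ge0// ?(ltW ab)//; lra.
  rewrite ge_min; apply/orP; right.
  have h3 : 2 * r - b ^+ 2 / (2 * r) <= 2 * (2 * r - b).
    have : 0 <= (2 * r - b) ^+ 2 / (2 * r) by rewrite divr_ge0 ?sqr_ge0// ltW.
    have -> : (2 * r - b) ^+ 2 / (2 * r) = 2 * r - 2 * b + b ^+ 2 / (2 * r).
      by field; rewrite gt_eqF.
    by lra.
  by lra.
rewrite /huber ge_max; apply/andP; split.
  by rewrite addr_ge0 ?mulr_ge0// le_max lexx.
apply: (@le_trans _ _ (Num.min (s ^+ 2 / (2 * r)) `|s| - tau / (2 * r) + 2 * `|t|)).
  by lra.
by rewrite lerD2r le_max lexx orbT.
Qed.

Lemma trunc_abs_lip M s t : 0 <= M ->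
  - trunc_abs M (s + t) ^+ 2 <= - trunc_abs M s ^+ 2 + 2 * M * `|t|.
Proof.
move=> M0.
have nst := ler_normD (s + t) (- t); rewrite addrK normrN in nst.
have w0 z : 0 <= trunc_abs M z <= M.
  by rewrite /trunc_abs le_min M0 normr_ge0 /= ge_min lexx orbT.
have h : trunc_abs M s <= trunc_abs M (s + t) + `|t|.
  rewrite /trunc_abs; have [h1|h1] := leP `|s + t| M.
    by rewrite ge_min; apply/orP; left.
  by rewrite ge_min; apply/orP; right; rewrite lerDl.
move: h; have /andP[] := w0 s; have /andP[] := w0 (s + t).
set a := trunc_abs M (s + t); set b := trunc_abs M s => a0 aM b0 bM h.
have t0 := normr_ge0 t.
have : b ^+ 2 - a ^+ 2 <= 2 * M * `|t|; last by lra.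
rewrite subr_sqr; have [ab|ab] := leP b a.
  apply: (@le_trans _ _ 0); last by rewrite !mulr_ge0.
  by rewrite mulr_le0_ge0 ?subr_le0 ?addr_ge0.
have -> : 2 * M * `|t| = `|t| * (2 * M) by ring.
by apply: ler_pM; rewrite ?subr_ge0 ?addr_ge0 ?(ltW ab)//; lra.
Qed.

End scalar_bounds.

Section scalar_integrals.
Context {R : realType}.

Definition excess (tau : R) : R := nexp (fun z => Num.max (z ^+ 2 - tau) 0).
Definition abs4exp : R := nexp (fun z : R => `|z| ^+ 4 * expR (1 * `|z|)).
Definition moment4 : R := nexp (fun z : R => z ^+ 4).

Lemma continuous_huber (r tau : R) : continuous (huber r tau).
Proof.
move=> z.
have cn : {for z, continuous (fun z : R => `|z|)} by exact: norm_continuous.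
have cs : {for z, continuous (fun z : R => z ^+ 2 / (2 * r))}.
  by apply: cvgM; [exact: exprn_continuous|exact: cvg_cst].
have c0 (a : R) : {for z, continuous (fun=> a : R)} by exact: cvg_cst.
apply: (@continuous_max R R (fun=> 0)
  (fun z => Num.min (z ^+ 2 / (2 * r)) `|z| - tau / (2 * r)) z) => //.
by apply: cvgB; [exact: (continuous_min cs cn)|exact: c0].
Qed.

Lemma excess_nint (tau : R) : nint (fun z : R => Num.max (z ^+ 2 - tau) 0).
Proof.
have i := nintD (nint_X 2) (nint_cst `|tau|).
apply: (nint_dom i).
  by apply: measurable_maxr => //; exact: measurable_funB.
move=> z; rewrite ger0_norm ?le_max ?lexx ?orbT//.
rewrite ge_max addr_ge0 ?sqr_ge0// andbT lerD2l.
by rewrite -normrN ler_norm.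
Qed.

(** For large r the exponent is of order 1 / r, so a second order
expansion of the exponential suffices. *)
Lemma nexp_huber_le (r tau : R) : 0 < r -> 0 <= tau ->
  nint (fun z => expR (huber r tau z)) /\
  nexp (fun z => expR (huber r tau z)) <=
    expR (excess tau / (2 * r) + abs4exp / (4 * r ^+ 2)).
Proof.
move=> r0 t0.
have i0 : nint (fun z => expR (huber r tau z)).
  apply: (nint_dom (nint_expabs 1)).
    apply: measurableT_comp => //; apply: continuous_measurable_fun; exact: continuous_huber.
  move=> z; rewrite ger0_norm ?expR_ge0// ler_expR mul1r.
  by have [] := huber_le z r0 t0.
split => //.
have i1 := excess_nint tau.
have i2 := @nint_normX R 4 1.
pose g (z : R) := 1 + (2 * r)^-1 * Num.max (z ^+ 2 - tau) 0 +
   (4 * r ^+ 2)^-1 * (`|z| ^+ 4 * expR (1 * `|z|)).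
have i3 := nintZ (2 * r)^-1 i1.
have i4 := nintZ (4 * r ^+ 2)^-1 i2.
have i5 := nintD (nint_cst 1) i3.
have e : nexp g = 1 + (excess tau / (2 * r) + abs4exp / (4 * r ^+ 2)).
  rewrite /g (nexpD i5 i4) (nexpD (nint_cst _) i3) nexp_cst (nexpZ _ i1) (nexpZ _ i2).
  by rewrite -/(excess tau) -/abs4exp addrA; congr (_ + _ + _); rewrite mulrC.
apply: le_trans (expR_ge1Dx _); rewrite -e; apply: le_nexp => //.
  exact: nintD.
move=> z; have [h1 [h2 h3]] := huber_le z r0 t0; have h0 := huber_ge0 r tau z.
apply: (le_trans (expR_le_quad h0)); rewrite /g; apply: lerD.
  by rewrite lerD2l mulrC.
have -> : (4 * r ^+ 2)^-1 * (`|z| ^+ 4 * expR (1 * `|z|)) =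
   (z ^+ 2 / (2 * r)) ^+ 2 * expR `|z|.
  have -> : `|z| ^+ 4 = z ^+ 4 by rewrite -normrX ger0_norm// exprn_even_ge0.
  by rewrite mul1r; field; rewrite gt_eqF.
apply: ler_pM; rewrite ?sqr_ge0 ?expR_ge0 ?ler_expR//.
by rewrite ler_pXn2r// nnegrE ?divr_ge0 ?sqr_ge0// mulr_ge0// ltW.
Qed.

(** The expansion exp (- y) <= 1 - y + y^2, where truncation at M loses at
most E Z^4 / M^2 of the second moment. *)
Lemma nexp_trunc_le (l M : R) : 0 <= l -> 0 < M ->
  nint (fun z => expR (- (l * trunc_abs M z ^+ 2))) /\
  nexp (fun z => expR (- (l * trunc_abs M z ^+ 2))) <=
    expR (- l * (1 - moment4 / M ^+ 2) + l ^+ 2 * moment4).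
Proof.
move=> l0 M0.
have mt : measurable_fun setT (fun z : R => trunc_abs M z).
  by apply: measurable_minr => //; exact: normr_measurable.
have w0 z : 0 <= trunc_abs M z by rewrite le_min normr_ge0 ltW.
have i0 : nint (fun z => expR (- (l * trunc_abs M z ^+ 2))).
  apply: (nint_dom (nint_cst 1)).
    apply: measurableT_comp => //; apply: measurableT_comp => //.
    by apply: measurable_funM => //; exact: measurable_funX.
  move=> z; rewrite ger0_norm ?expR_ge0// -expR0 ler_expR oppr_le0.
  by rewrite mulr_ge0 ?sqr_ge0.
split=> //.
have i2 := @nint_X R 2; have i4 := @nint_X R 4.
have j2 := nintZ (- l) i2; have j4 := nintZ (l / M ^+ 2 + l ^+ 2) i4.
have j5 := nintD (nint_cst 1) j2.
have e : nexp (fun z : R => 1 + - l * z ^+ 2 + (l / M ^+ 2 + l ^+ 2) * z ^+ 4) =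
    1 + (- l * (1 - moment4 / M ^+ 2) + l ^+ 2 * moment4).
  rewrite (nexpD j5 j4) (nexpD (nint_cst _) j2) nexp_cst (nexpZ _ i2) (nexpZ _ i4).
  by rewrite normal_moments.2 -/moment4; ring.
apply: le_trans (expR_ge1Dx _); rewrite -e; apply: le_nexp => //; first exact: nintD.
move=> z; set w := trunc_abs M z.
apply: (le_trans (expRN_le_quad _)); first by rewrite mulr_ge0 ?sqr_ge0.
have wz : w ^+ 2 <= z ^+ 2.
  have -> : z ^+ 2 = `|z| ^+ 2 by rewrite real_normK ?num_real.
  by rewrite ler_pXn2r ?nnegrE ?w0// /w ge_min lexx.
have w4 : w ^+ 4 <= z ^+ 4.
  have -> : w ^+ 4 = (w ^+ 2) ^+ 2 by ring.
  have -> : z ^+ 4 = (z ^+ 2) ^+ 2 by ring.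
  by rewrite ler_pXn2r ?nnegrE ?sqr_ge0.
have M2 : 0 < M ^+ 2 by rewrite exprn_gt0.
have zw : z ^+ 2 <= w ^+ 2 + z ^+ 4 / M ^+ 2.
  rewrite /w /trunc_abs; have [h|h] := leP `|z| M.
    by rewrite real_normK ?num_real// lerDl divr_ge0 ?exprn_even_ge0// ltW.
  apply: (@le_trans _ _ (z ^+ 4 / M ^+ 2)); last by rewrite lerDr ltW.
  rewrite ler_pdivlMr//; have -> : z ^+ 4 = z ^+ 2 * z ^+ 2 by ring.
  rewrite ler_wpM2l ?sqr_ge0//.
  have -> : z ^+ 2 = `|z| ^+ 2 by rewrite real_normK ?num_real.
  by rewrite ler_pXn2r ?nnegrE ?(ltW M0)// ltW.
have h1 := ler_wpM2l l0 zw.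
have h2 := ler_wpM2l (sqr_ge0 l) w4.
have -> : (l * w ^+ 2) ^+ 2 = l ^+ 2 * w ^+ 4 by ring.
have -> : (l / M ^+ 2 + l ^+ 2) * z ^+ 4 = l * (z ^+ 4 / M ^+ 2) + l ^+ 2 * z ^+ 4.
  by ring.
by rewrite mulrDr in h1; lra.
Qed.

End scalar_integrals.

Lemma prod_gcoord (R : realType) (m n : nat) (F : gcoord m n -> R) :
  \prod_c F c = (\prod_(b : 'I_m * 'I_n + unit) F (inl b)) *
    ((\prod_i F (row_coord n i)) * (\prod_j F (col_coord m j))).
Proof. by rewrite big_sumType/=; congr (_ * _); rewrite big_sumType. Qed.

Section rhs.
Context {R : realType} (m n p k : nat) (a0 : 'I_p) (X : 'I_p -> 'cV[R]_n).
Hypothesis X1 : forall a, l2norm (X a) = 1.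
Hypothesis Xk : forall a, l0norm (X a) = k.
Variables (r tau l M rho : R).
Hypotheses (r0 : 0 < r) (tau0 : 0 <= tau) (l0 : 0 <= l) (M0 : 0 < M) (rho0 : 0 <= rho).
Let x a j := X a j 0.
Let B : R := r / 2 + k%:R * tau / (2 * r).

Let phi1 (c : gcoord m n) (t : R) : R :=
  if c is inr (inr _) then expR (huber r tau t) else 1.
Let phi2 (c : gcoord m n) (t : R) : R :=
  match c with
  | inr (inr _) => expR (huber r tau t)
  | inr (inl _) => expR (- (l * trunc_abs M t ^+ 2))
  | _ => 1
  end.
Let C : R := 2 + 2 * l * M.

Let C0 : 0 <= C. Proof. by rewrite addr_ge0 ?mulr_ge0// ltW. Qed.

Let huberC t z : expR (huber r tau (t + z)) <= expR (C * `|z|) * expR (huber r tau t).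
Proof.
rewrite -expRD ler_expR; apply: (le_trans (huber_lip tau t z r0)).
rewrite addrC lerD2r ler_wpM2r// /C lerDl !mulr_ge0// ltW//.
Qed.

Let truncC t z : expR (- (l * trunc_abs M (t + z) ^+ 2)) <=
  expR (C * `|z|) * expR (- (l * trunc_abs M t ^+ 2)).
Proof.
rewrite -expRD ler_expR.
have h := ler_wpM2l l0 (trunc_abs_lip t z (ltW M0)).
have : 0 <= 2 * `|z| by rewrite mulr_ge0.
by rewrite /C; lra.
Qed.

Let oneC (t z : R) : 1 <= expR (C * `|z|) * 1 :> R.
Proof. by rewrite mulr1 -[leLHS]expR0 ler_expR mulr_ge0. Qed.

Let phi1_gt0 c t : 0 < phi1 c t.
Proof. by case: c => [?|[?|?]] /=; rewrite ?expR_gt0. Qed.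
Let phi2_gt0 c t : 0 < phi2 c t.
Proof. by case: c => [?|[?|?]] /=; rewrite ?expR_gt0. Qed.
Let phi1C c t z : phi1 c (t + z) <= expR (C * `|z|) * phi1 c t.
Proof. by case: c => [?|[?|?]] /=; [exact: (oneC t)|exact: (oneC t)|exact: huberC]. Qed.
Let phi2C c t z : phi2 c (t + z) <= expR (C * `|z|) * phi2 c t.
Proof. by case: c => [?|[?|?]] /=; [exact: (oneC t)|exact: truncC|exact: huberC]. Qed.

Let F1 (u : gcoord m n -> R) := \prod_c phi1 c (u c).
Let F2 (u : gcoord m n -> R) := \prod_c phi2 c (u c).

Let F1E u : F1 u = expR (\sum_j huber r tau (u (col_coord m j))).
Proof.
rewrite /F1 prod_gcoord /= [X in X * _]big1// [X in _ * (X * _)]big1// !mul1r.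
by rewrite expR_sum.
Qed.

Let F2E u : F2 u = expR (- (l * \sum_i trunc_abs M (u (row_coord n i)) ^+ 2)) *
  expR (\sum_j huber r tau (u (col_coord m j))).
Proof.
rewrite /F2 prod_gcoord /= [X in X * _]big1// mul1r.
by rewrite mulr_sumr -sumrN !expR_sum.
Qed.

Let huber_const : R := excess tau / (2 * r) + abs4exp / (4 * r ^+ 2).
Let trunc_const : R := - l * (1 - moment4 / M ^+ 2) + l ^+ 2 * moment4.

Lemma vector_coords_uniq : uniq (vector_coords m n).
Proof.
rewrite cat_uniq !map_inj_uniq ?index_enum_uniq//=; last 2 first.
- by move=> i j [].
- by move=> i j [].
rewrite andbT; apply/hasPn => c /mapP[j _ ->].
by apply/negP => /mapP[i _].
Qed.

Let avg1 : gavgs 1 (vector_coords m n) F1 (fun=> 0) <= expR (n%:R * huber_const).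
Proof.
rewrite (gavgs_prod C0 phi1_gt0 phi1C)//; last exact: vector_coords_uniq.
apply: (@le_trans _ _ (\prod_(c : gcoord m n)
   (if c is inr (inr _) then expR huber_const else 1))).
  apply: ler_prod => c _; apply/andP; split.
    by case: ifP => _; [apply: Rintegral_ge0 => z _; rewrite ltW|rewrite ltW].
  have [i1 h1] := nexp_huber_le r0 tau0.
  case: c => [c|[i|j]] /=.
  - by case: ifP => // _; rewrite nexp_cst.
  - by case: ifP => // _; rewrite nexp_cst.
  - have -> : inr (inr j) \in vector_coords m n.
      by rewrite mem_cat; apply/orP; right; apply/mapP; exists j; rewrite ?mem_index_enum.
    by under eq_fun do rewrite add0r.
rewrite prod_gcoord /= [X in X * _]big1// [X in _ * (X * _)]big1// !mul1r.
by rewrite prodr_const card_ord -expRM_natl.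
Qed.

Let avg2 : gavgs 1 (vector_coords m n) F2 (fun=> 0) <=
  expR (m%:R * trunc_const) * expR (n%:R * huber_const).
Proof.
rewrite (gavgs_prod C0 phi2_gt0 phi2C)//; last exact: vector_coords_uniq.
apply: (@le_trans _ _ (\prod_(c : gcoord m n)
   (match c with inr (inr _) => expR huber_const | inr (inl _) => expR trunc_const
     | _ => 1 end))).
  apply: ler_prod => c _; apply/andP; split.
    by case: ifP => _; [apply: Rintegral_ge0 => z _; rewrite ltW|rewrite ltW].
  have [i1 h1] := nexp_huber_le r0 tau0.
  have [i2 h2] := nexp_trunc_le l0 M0.
  case: c => [c|[i|j]] /=.
  - by case: ifP => // _; rewrite nexp_cst.
  - have -> : inr (inl i) \in vector_coords m n.
      by rewrite mem_cat; apply/orP; left; apply/mapP; exists i; rewrite ?mem_index_enum.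
    by under eq_fun do rewrite add0r.
  - have -> : inr (inr j) \in vector_coords m n.
      by rewrite mem_cat; apply/orP; right; apply/mapP; exists j; rewrite ?mem_index_enum.
    by under eq_fun do rewrite add0r.
rewrite prod_gcoord /= [X in X * _]big1// mul1r.
by rewrite !prodr_const !card_ord -!expRM_natl.
Qed.

Let x1 a : \sum_j x a j ^+ 2 = 1.
Proof. by rewrite -(l2norm_sqr (X a)) X1 expr1n. Qed.

Let lin_ge a (h : 'I_n -> R) :
  - (\sum_j h j * x a j) <= B + \sum_j huber r tau (h j).
Proof.
have r2 : 0 < 2 * r by rewrite mulr_gt0.
have tr0 : 0 <= tau / (2 * r) by rewrite divr_ge0// ltW.
rewrite -sumrN; apply: (@le_trans _ _ (\sum_j (r / 2 * x a j ^+ 2 +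
   (if x a j != 0 then tau / (2 * r) else 0) + huber r tau (h j)))).
  apply: ler_sum => j _; case: eqP => [->|_] /=.
    by rewrite mulr0 oppr0 expr0n mulr0 addr0 add0r huber_ge0.
  by apply: huber_lin => //; exact: x_le1.
rewrite !big_split/= lerD2r -mulr_sumr x1 mulr1 /B lerD2l.
rewrite -big_mkcond/= sumr_const -(Xk a) /l0norm cardsE.
by rewrite -mulrA [leRHS]mulr_natl.
Qed.

Let rhs_pointwise u : (forall ij, u (entry_coord ij) = 0) -> u (common_coord m n) = 0 ->
  softmin_norm X u <= expR (1 + B - rho) * F1 u + expR (1 + B + l * rho ^+ 2) * F2 u.
Proof.
move=> uA uG.
pose g : 'I_m -> R := fun i => u (row_coord n i).
pose H := \sum_j huber r tau (u (col_coord m j)).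
pose N := Num.sqrt (\sum_i g i ^+ 2).
have SN0 : 0 <= \sum_i g i ^+ 2 by exact: sum_sqr_ge0.
have p0 : 0 < p%:R :> R by rewrite ltr0n; case: p a0 => [[]|].
have le1 : softmin_norm X u <= expR (1 - N + B + H).
  rewrite /softmin_norm /softmin ler_expR.
  rewrite -(ler_pM2l p0) mulrA mulfV ?gt_eqF// mul1r.
  have S0 : 0 < gibbs_sum p%:R (gordon_obj x) u by exact: gibbs_sum_gt0.
  rewrite -[leRHS]expRK ler_ln ?posrE ?expR_gt0//.
  apply: (@le_trans _ _ (\sum_(a < p) expR (p%:R * (- N + B + H)))).
    apply: ler_sum => a _; rewrite ler_expR mulNr -mulrN ler_pM2l//.
    have vE : gordon_vec x a u = g.
      by apply/funext => i; rewrite /gordon_vec big1 ?add0r// => j _; rewrite uA mul0r.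
    rewrite /gordon_obj vE /gordon_lin uG add0r.
    have h1 := lin_ge a (fun j => u (col_coord m j)); rewrite -/H in h1.
    have h2 : N <= snorm g by rewrite /N /snorm ler_wsqrtr// lerDr.
    by lra.
  (* The p terms cost the factor p^(1/p), at most e. *)
  rewrite sumr_const card_ord -[leLHS]mulr_natl.
  have -> : p%:R * (1 - N + B + H) = p%:R + p%:R * (- N + B + H) by ring.
  rewrite expRD ler_wpM2r ?expR_ge0//.
  by apply: le_trans (expR_ge1Dx _); rewrite lerDr.
apply: (le_trans le1); rewrite F1E F2E -/H mulrA -!expRD.
have [h|h] := leP rho N.
  apply: (@le_trans _ _ (expR (1 + B - rho + H))); last by rewrite lerDl expR_ge0.
  by rewrite ler_expR; lra.
apply: (@le_trans _ _ (expR (1 + B + l * rho ^+ 2 -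
   l * (\sum_i trunc_abs M (u (row_coord n i)) ^+ 2) + H))); last by rewrite lerDr expR_ge0.
rewrite ler_expR.
have N0 : 0 <= N by exact: sqrtr_ge0.
have h3 : \sum_i trunc_abs M (u (row_coord n i)) ^+ 2 <= rho ^+ 2.
  apply: (@le_trans _ _ (N ^+ 2)).
    rewrite sqr_sqrtr//; apply: ler_sum => i _.
    rewrite -[leRHS]real_normK ?num_real// ler_pXn2r ?nnegrE//.
      by rewrite /trunc_abs ge_min lexx.
    by rewrite le_min normr_ge0 ltW.
  by rewrite ler_pXn2r ?nnegrE// ltW.
have h4 := ler_wpM2l l0 h3; lra.
Qed.

(** The two terms correspond to |g| >= rho and |g| < rho.  On the second
event the indicator is at most exp (l (rho^2 - sum_i min (|g_i|, M)^2)), which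
is again a product of functions of single variables. *)
Lemma rhs_bound : gavgs 1 (vector_coords m n) (softmin_norm X) (fun=> 0) <=
  expR (1 + B) * expR (n%:R * huber_const) *
    (expR (- rho) + expR (l * rho ^+ 2 + m%:R * trunc_const)).
Proof.
have q1 : 1 <= p%:R :> R by rewrite ler1n; case: p a0 => [[]|].
have [C' Sl] := softmin_gordon_loglip m a0 q1 x1.
have F1l : loglip C F1 := prod_loglip C0 phi1_gt0 phi1C.
have F2l : loglip C F2 := prod_loglip C0 phi2_gt0 phi2C.
set e1 := expR (1 + B - rho); set e2 := expR (1 + B + l * rho ^+ 2).
have G1l := loglipZ (expR_gt0 (1 + B - rho)) F1l.
have G2l := loglipZ (expR_gt0 (1 + B + l * rho ^+ 2)) F2l.
have Gl := loglipD G1l G2l.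
have CC : C <= C + C' by rewrite lerDl; case: Sl.
have CC' : C' <= C + C' by rewrite lerDr.
apply: (@le_trans _ _ (gavgs 1 (vector_coords m n) (fun u => e1 * F1 u + e2 * F2 u) (fun=> 0))).
  apply: (@le_gavgs_on _ _ (C + C') _ _ 1 _
    (fun u => (forall ij, u (entry_coord ij) = 0) /\ u (common_coord m n) = 0)).
  - exact: loglipW Sl.
  - exact: loglipW Gl.
  - move=> u c z; rewrite mem_cat => /orP[] /mapP[i _ ->] [uA uG].
      by split => [ij|]; rewrite /nudge ?uA ?uG addr0.
    by split => [ij|]; rewrite /nudge ?uA ?uG addr0.
  - by move=> u [uA uG]; exact: rhs_pointwise.
  - by [].
rewrite (gavgsD 1 _ G1l G2l) (gavgsZ _ _ _ F1l) (gavgsZ _ _ _ F2l).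
rewrite mulrDr; apply: lerD.
  apply: (le_trans (ler_wpM2l (expR_ge0 _) avg1)).
  by rewrite /e1 expRD le_eqVlt; apply/orP; left; apply/eqP; ring.
apply: (le_trans (ler_wpM2l (expR_ge0 _) avg2)).
by rewrite /e2 !expRD le_eqVlt; apply/orP; left; apply/eqP; ring.
Qed.

End rhs.

(** * Reduction of the sparse sphere to a countable set *)

Lemma cvg_bigsum (R : realType) (J : Type) (s : seq J) (u : J -> nat -> R) (l : J -> R) :
  (forall j, u j @ \oo --> l j) ->
  (fun N => \sum_(j <- s) u j N) @ \oo --> \sum_(j <- s) l j.
Proof.
move=> ul; elim: s => [|j s IH].
  by under eq_fun do rewrite big_nil; rewrite big_nil; exact: cvg_cst.
by under eq_fun do rewrite big_cons; rewrite big_cons; exact: cvgD.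
Qed.

Section dense_points.
Context {R : realType} (n k : nat).
Hypothesis k0 : (0 < k)%N.
Implicit Types (v x : 'cV[R]_n).

Lemma l2norm_gt0 v : l0norm v = k -> 0 < l2norm v.
Proof.
move=> vk; have : (0 < l0norm v)%N by rewrite vk.
rewrite /l0norm card_gt0 => /finset.set0Pn[i]; rewrite inE => vi.
rewrite sqrtr_gt0 (bigD1 i)//= ltr_pwDl ?sumr_ge0//; last by move=> j _; rewrite sqr_ge0.
by rewrite exprn_even_gt0.
Qed.

Definition normalize v : 'cV[R]_n := (l2norm v)^-1 *: v.

Lemma normalize_S_ric v : l0norm v = k -> S_ric k (normalize v).
Proof.
move=> vk; have v0 := l2norm_gt0 vk; split.
  by rewrite l2normZ ?invr_ge0 ?(ltW v0)// mulVf// gt_eqF.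
rewrite -vk /l0norm; apply: eq_card => i; rewrite !inE mxE mulf_eq0.
by rewrite invr_eq0 gt_eqF.
Qed.

Lemma S_ric_nonempty : (k <= n)%N -> exists x, S_ric k x.
Proof.
move=> kn; exists (normalize (\col_i (if (i < k)%N then 1 else 0))).
apply: normalize_S_ric; rewrite /l0norm.
rewrite (_ : [set i | _]%SET = [set widen_ord kn i | i : 'I_k]%SET).
  rewrite card_imset ?card_ord// => i j /(congr1 val) /= ij; exact: val_inj.
apply/setP => i; rewrite inE mxE; apply/idP/imsetP => [|[j _ ->] /=]; last first.
  by rewrite ltn_ord oner_neq0.
case: ltnP => [ik _|]; last by rewrite eqxx.
by exists (Ordinal ik) => //; exact: val_inj.
Qed.

(** A rational vector close to x, with the same zero entries as x, has the
right sparsity after normalisation.  The condition on |A q| / |q| is tested by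
the polynomial c^2 |v|^2 - |A v|^2, which is positive at x. *)
Lemma S_ric_rat_dense (m : nat) (A : 'M[R]_(m, n)) x (c : R) :
  S_ric k x -> l2norm (A *m x) < c ->
  exists q : 'cV[rat]_n, l0norm (map_mx ratr q : 'cV[R]_n) = k /\
    l2norm (A *m normalize (map_mx ratr q)) < c.
Proof.
move=> [x1 xk] Axc.
have c0 : 0 < c by exact: le_lt_trans (l2norm_ge0 _) Axc.
have ap N j : {q : rat | `|ratr q - x j 0| <= N.+1%:R^-1 /\ (ratr q == 0 :> R) = (x j 0 == 0)}.
  apply: cid; have : 0 < N.+1%:R^-1 :> R by rewrite invr_gt0.
  set e := N.+1%:R^-1 => e0.
  have [x0|x0|->] := ltgtP (x j 0) 0.
  - have [|q] := @rat_in_itvoo R (x j 0 - e) (x j 0); first by lra.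
    rewrite in_itv/= => /andP[h1 h2]; exists q; split.
      by rewrite ler_norml; apply/andP; split; lra.
    by rewrite !lt_eqF//; exact: lt_trans x0.
  - have [|q] := @rat_in_itvoo R (x j 0) (x j 0 + e); first by lra.
    rewrite in_itv/= => /andP[h1 h2]; exists q; split.
      by rewrite ler_norml; apply/andP; split; lra.
    by rewrite !gt_eqF//; exact: lt_trans h1.
  - by exists 0; rewrite rmorph0 subr0 normr0 eqxx ltW.
pose y N : 'cV[R]_n := \col_j ratr (sval (ap N j)).
have cvy j : (fun N => y N j 0) @ \oo --> x j 0.
  apply: (@squeeze_cvgr _ _ _ _ (fun N => x j 0 - N.+1%:R^-1) (fun N => x j 0 + N.+1%:R^-1)).
  - apply: nearW => N; have [h _] := svalP (ap N j).
    rewrite mxE; move: h; set e := N.+1%:R^-1.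
    by rewrite ler_norml => /andP[h1 h2]; apply/andP; split; lra.
  - by rewrite -[X in _ --> X]subr0; apply: cvgB; [exact: cvg_cst|exact: cvg_harmonic].
  - by rewrite -[X in _ --> X]addr0; apply: cvgD; [exact: cvg_cst|exact: cvg_harmonic].
pose g (v : 'cV[R]_n) : R := c ^+ 2 * (\sum_j v j 0 ^+ 2) - \sum_i (\sum_j A i j * v j 0) ^+ 2.
have gE v : g v = c ^+ 2 * l2norm v ^+ 2 - l2norm (A *m v) ^+ 2.
  rewrite /g !l2norm_sqr; congr (_ - _); apply: eq_bigr => i _; by rewrite mxE.
have cvg2 (u : nat -> R) (l : R) : u @ \oo --> l -> (fun N => u N ^+ 2) @ \oo --> l ^+ 2.
  by move=> ul; under eq_fun do rewrite expr2; rewrite expr2; exact: cvgM.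
have gy : (fun N => g (y N)) @ \oo --> g x.
  apply: cvgB.
    apply: cvgM; first exact: cvg_cst.
    by apply: cvg_bigsum => j; exact: cvg2.
  apply: cvg_bigsum => i; apply: (cvg2 (fun N => \sum_j A i j * y N j 0)).
  by apply: cvg_bigsum => j; apply: cvgM; [exact: cvg_cst|exact: cvy].
have gx : 0 < g x.
  rewrite gE x1 expr1n mulr1 subr_gt0 ltr_pXn2r// ?nnegrE ?l2norm_ge0//; exact: ltW.
have [N _ /(_ N (leqnn N)) /= hN] := cvgr_gt _ gy _ gx.
exists (\col_j sval (ap N j)).
have ->  : map_mx ratr (\col_j sval (ap N j)) = y N.
  by apply/matrixP => i j; rewrite !mxE.
have yk : l0norm (y N) = k.
  rewrite -xk /l0norm; apply: eq_card => j; rewrite !inE mxE.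
  by have [_ ->] := svalP (ap N j).
have y0 := l2norm_gt0 yk.
split=> //; rewrite /normalize -scalemxAr l2normZ ?invr_ge0 ?(ltW y0)//.
rewrite mulrC ltr_pdivrMr//.
rewrite -(@ltr_pXn2r _ 2) ?nnegrE ?mulr_ge0 ?l2norm_ge0 ?(ltW c0)//.
by rewrite -subr_gt0 exprMn -gE.
Qed.

Lemma S_ric_dense_seq : (k <= n)%N -> exists pt : nat -> 'cV[R]_n,
  (forall i, S_ric k (pt i)) /\
  forall (m : nat) (A : 'M[R]_(m, n)) x (c : R), S_ric k x -> l2norm (A *m x) < c ->
    exists i, l2norm (A *m pt i) < c.
Proof.
move=> kn; have [x0 x0S] := S_ric_nonempty kn.
pose pt i := if unpickle i is Some q then
    if l0norm (map_mx ratr (q : 'cV[rat]_n) : 'cV[R]_n) == k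
    then normalize (map_mx ratr q) else x0
  else x0.
exists pt; split=> [i|m A x c xS Axc].
  by rewrite /pt; case: unpickle => // q; case: eqP => // qk; exact: normalize_S_ric.
have [q [qk qc]] := S_ric_rat_dense xS Axc.
by exists (pickle q); rewrite /pt pickleK qk eqxx.
Qed.

End dense_points.

Section sphere_probability.
Context d (T : measurableType d) (R : realType) (P : probability T R).
Context (m n k : nat) (A : 'M[{RV P >-> R}]_(m, n)).
Hypothesis Aiid : iid_standard_normal A.
Hypotheses (k0 : (0 < k)%N) (kn : (k <= n)%N).

Lemma min_l2norm_lt (M : 'M[R]_(m, n)) (t : R) :
  min_l2norm M (S_ric k) < t <-> exists2 x, S_ric k x & l2norm (M *m x) < t.
Proof.
have [x0 x0S] := @S_ric_nonempty R n k k0 kn.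
have lb0 : has_inf [set l2norm (M *m x) | x in S_ric k].
  split; first by exists (l2norm (M *m x0)), x0.
  by exists 0 => _ [y _ <-]; exact: l2norm_ge0.
split=> [h|[x xS]]; last first.
  apply: le_lt_trans; apply: ge_inf; last by exists x.
  by case: lb0.
have e0 : 0 < t - min_l2norm M (S_ric k) by rewrite subr_gt0.
have [_ [x xS <-] hx] := inf_adherent e0 lb0.
by exists x => //; move: hx; rewrite /min_l2norm addrC subrK.
Qed.

(** The event is the increasing union, over N, of the same event for the
first N+1 points of a dense sequence, and the bound does not depend on N. *)
Lemma min_l2norm_lt_prob (r tau l M rho t : R) :
  0 < r -> 0 <= tau -> 0 <= l -> 0 < M -> 0 <= rho ->
  measurable [set w | min_l2norm (realization A w) (S_ric k) < t] /\
  (P [set w | (min_l2norm (realization A w) (S_ric k) < t)%R] <=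
    (expR (t + 1) * (expR (1 + (r / 2 + k%:R * tau / (2 * r))) *
      expR (n%:R * (excess tau / (2 * r) + abs4exp / (4 * r ^+ 2))) *
      (expR (- rho) + expR (l * rho ^+ 2 +
         m%:R * (- l * (1 - moment4 / M ^+ 2) + l ^+ 2 * moment4)))))%:E)%E.
Proof.
move=> r0 tau0 l0 M0 rho0; set bound := (expR (t + 1) * _).
have [pt [ptS ptD]] := @S_ric_dense_seq R n k k0 kn.
pose E i := [set w | l2norm (realization A w *m pt i) < t].
have mE i : measurable (E i) by exact: measurable_small.
have -> : [set w | min_l2norm (realization A w) (S_ric k) < t] = \bigcup_i E i.
  apply/seteqP; split => w /=.
    by move=> /min_l2norm_lt[x xS /(ptD _ _ _ _ xS)[i hi]]; exists i.
  by move=> [i _ hi]; apply/min_l2norm_lt; exists (pt i).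
split; first exact: bigcupT_measurable.
pose F N := \bigcup_(a in [set: 'I_N.+1]) E a.
have mF N : measurable (F N).
  by apply: fin_bigcup_measurable => //; exact: finite_finset.
have -> : \bigcup_i E i = \bigcup_N F N.
  apply/seteqP; split => w [i _ hi].
    by exists i => //; exists ord_max.
  by case: hi => a _ ha; exists a.
have FP N : (P (F N) <= bound%:E)%E.
  have := @prob_small_le _ T R P m n A Aiid N.+1 ord0 (fun a => pt a) (fun a => (ptS a).1) t.
  move=> /le_trans; apply; rewrite lee_fin ler_wpM2l ?expR_ge0//.
  by apply: (@rhs_bound R m n N.+1 k ord0) => // a; [exact: (ptS a).1|exact: (ptS a).2].
have ndF : {homo F : a b / (a <= b)%N >-> a `<=` b}.
  move=> a b ab w [i _ hi]; have ib : (i < b.+1)%N by exact: leq_trans (ltn_ord i) _.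
  by exists (Ordinal ib).
have ndF' : {homo F : a b / (a <= b)%N >-> (a <= b)%O}.
  by move=> a b /ndF h; exact/subsetPset.
have h := nondecreasing_cvg_mu mF (bigcupT_measurable F mF) ndF' (mu := P).
by apply: cvge_le h; exact: nearW.
Qed.

End sphere_probability.

(** * Asymptotics of the probability bound *)

(** With r = s sqrt n and s^2 = beta tau + ex, the three terms of order
sqrt n combine to s sqrt n, which is (s / sqrt alpha) sqrt m up to a constant. *)
Lemma exponent_bound (R : realType) (s al be tau ex K xi n m k : R) :
  0 < s -> 0 < al -> 0 <= tau -> 0 <= K -> 1 <= n -> 0 <= m ->
  s ^+ 2 = be * tau + ex -> k <= be * n + 1 -> al * n <= m + 1 ->
  xi * Num.sqrt m + 1 + (1 + (s * Num.sqrt n / 2 + k * tau / (2 * (s * Num.sqrt n)))) +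
    n * (ex / (2 * (s * Num.sqrt n)) + K / (4 * (s * Num.sqrt n) ^+ 2)) <=
  (2 + tau / (2 * s) + K / (4 * s ^+ 2) + s / Num.sqrt al) +
    (xi + s / Num.sqrt al) * Num.sqrt m.
Proof.
move=> s0 al0 t0 K0 n1 m0 s2 kn aln.
have n0 : 0 < n by exact: lt_le_trans n1.
set y := Num.sqrt n; have y0 : 0 < y by rewrite sqrtr_gt0.
have yn : y ^+ 2 = n by rewrite sqr_sqrtr// ltW.
have y1 : 1 <= y by rewrite -[leLHS]sqrtr1 ler_wsqrtr.
set g := Num.sqrt al; have g0 : 0 < g by rewrite sqrtr_gt0.
set z := Num.sqrt m; have z0 : 0 <= z by exact: sqrtr_ge0.
have h1 : k * tau / (2 * (s * y)) <= be * tau * y / (2 * s) + tau / (2 * s).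
  apply: (@le_trans _ _ ((be * n + 1) * tau / (2 * (s * y)))).
    by rewrite ler_pM2r ?invr_gt0 ?mulr_gt0// ler_wpM2r.
  have -> : (be * n + 1) * tau / (2 * (s * y)) = be * tau * y / (2 * s) + tau / (2 * s) / y.
    by rewrite -yn; field; rewrite !gt_eqF.
  by rewrite lerD2l ler_pdivrMr// ler_peMr// divr_ge0// mulr_ge0// (ltW s0).
have h2 : n * (ex / (2 * (s * y)) + K / (4 * (s * y) ^+ 2)) =
    ex * y / (2 * s) + K / (4 * s ^+ 2).
  by rewrite -yn; field; rewrite !gt_eqF.
have h3 : be * tau * y / (2 * s) + ex * y / (2 * s) = s * y / 2.
  have -> : be * tau * y / (2 * s) + ex * y / (2 * s) = (be * tau + ex) * y / (2 * s) by ring.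
  by rewrite -s2; field; rewrite gt_eqF.
have h4 : s * y <= s / g + s / g * z.
  have -> : s / g + s / g * z = s * ((1 + z) / g) by ring.
  rewrite ler_pM2l// ler_pdivlMr//.
  rewrite -(@ler_pXn2r _ 2) ?nnegrE ?mulr_ge0 ?addr_ge0 ?(ltW y0) ?(ltW g0)//.
  rewrite exprMn yn sqr_sqrtr ?(ltW al0)// sqrrD sqr_sqrtr// mulrC.
  by apply: (le_trans aln); rewrite expr1n mul1r; lra.
rewrite h2; lra.
Qed.

Lemma exp_tail (R : realType) (kap del y : R) : 0 < kap <= 1 -> 0 < del ->
  2 / kap <= y -> 2 / (kap * del) <= y ->
  expR (- (kap * y)) + expR (y - kap * y ^+ 2) <= del.
Proof.
move=> /andP[k0 k1] d0 h1 h2.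
have y0 : 0 < y by apply: lt_le_trans h1; rewrite divr_gt0.
have ky0 : 0 < kap * y by rewrite mulr_gt0.
have h3 : expR (y - kap * y ^+ 2) <= expR (- (kap * y)).
  rewrite ler_expR.
  have : y * 2 <= y * (kap * y) by rewrite ler_pM2l// mulrC -ler_pdivrMr.
  have : kap * y <= y by rewrite ler_piMl// ltW.
  by rewrite expr2; lra.
have h4 : expR (- (kap * y)) <= del / 2.
  rewrite expRN -[del / 2]invrK lef_pV2 ?posrE ?expR_gt0 ?invr_gt0 ?divr_gt0//.
  apply: le_trans (expR_ge1Dx _).
  have : (del / 2)^-1 <= kap * y; last by lra.
  rewrite invf_div.
  have -> : 2 / del = kap * (2 / (kap * del)) by field; rewrite !gt_eqF.
  by rewrite ler_pM2l.
lra.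
Qed.

Section asymptotics.
Context {R : realType} (alpha beta : R).
Hypotheses (beta_gt0 : 0 < beta) (alpha_gt0 : 0 < alpha)
  (beta_lt_alpha : beta < alpha) (alpha_lt1 : alpha < 1).

Let e : R := erfinv (1 - beta).
Let V : R := beta + 2 * e / (Num.sqrt pi * expR (e ^+ 2)).

Let e_spec : 0 < e /\ erf e = 1 - beta.
Proof.
have b1 : beta < 1 by exact: lt_trans alpha_lt1.
by apply: erfinv_spec; rewrite subr_gt0 b1 /= ltrBlDr ltrDl beta_gt0.
Qed.

Let V0 : 0 < V.
Proof.
have [e0 _] := e_spec.
by rewrite ltr_wpDr// divr_ge0 ?mulr_ge0 ?expR_ge0 ?sqrtr_ge0// ltW.
Qed.

Let V_excess : Num.sqrt V ^+ 2 = beta * (2 * e ^+ 2) + excess (2 * e ^+ 2).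
Proof.
have [e0 ee] := e_spec.
rewrite sqr_sqrtr ?(ltW V0)// /excess truncated_moment// ee /V; ring.
Qed.

(** Let s^2 = V, gap = 1 - xi - s / sqrt alpha > 0 and y = sqrt m.  The exponent
of the first factor is (1 - gap) y + O(1).  For rho = (1 - gap / 2) y the
first event contributes exp (- (gap / 2) y + O(1)).  The second one
contributes exp (- kap y^2 + O(y)) with kap = l gap / 4 for small l, because
the truncated second moment of a coordinate of g exceeds (rho / y)^2. *)
Lemma small_min_prob (xi del : R) : 0 <= xi -> xi < lric_bound alpha beta -> 0 < del ->
  exists N0 : nat, forall n m k : nat, (N0 <= n)%N ->
    `|k%:R - beta * n%:R| < 1 -> `|m%:R - alpha * n%:R| < 1 ->
    [/\ (0 < k)%N, (k <= n)%N, (0 < m)%N &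
    forall d (T : measurableType d) (P : probability T R) (A : 'M[{RV P >-> R}]_(m, n)),
      iid_standard_normal A ->
      (P [set w | (min_l2norm (realization A w) (@S_ric R n k) < xi * Num.sqrt m%:R)%R]
        <= del%:E)%E].
Proof.
move=> xi0 xib del0; have [e0 ee] := e_spec.
have [hb ha hba ha1] := And4 beta_gt0 alpha_gt0 beta_lt_alpha alpha_lt1.
set s := Num.sqrt V; have s0 : 0 < s by rewrite sqrtr_gt0.
set a := Num.sqrt alpha; have a0 : 0 < a by rewrite sqrtr_gt0.
have xib' : xi < 1 - s / a.
  by move: xib; rewrite /lric_bound -/e -/V -/s -/a mul1r mulrC.
pose gap := 1 - xi - s / a.
have gap0 : 0 < gap by rewrite /gap; lra.
have sa0 : 0 < s / a by rewrite divr_gt0.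
have gap1 : gap <= 1 by rewrite /gap; lra.
have m40 : 0 <= moment4 :> R.
  by apply: Rintegral_ge0 => z _; rewrite exprn_even_ge0.
have k40 : 0 <= abs4exp :> R.
  by apply: Rintegral_ge0 => z _; rewrite mulr_ge0 ?expR_ge0.
pose tau := 2 * e ^+ 2.
have tau0 : 0 <= tau by rewrite mulr_ge0// sqr_ge0.
pose D := 2 + tau / (2 * s) + abs4exp / (4 * s ^+ 2) + s / a.
(* M and l are chosen so that moment4 / M^2 and l * moment4 are both at
   most gap / 8. *)
pose M2 := 8 * (moment4 + 1) / gap.
have M20 : 0 < M2 by rewrite divr_gt0// mulr_gt0// ltr_wpDl.
pose M := Num.sqrt M2.
have M0 : 0 < M by rewrite sqrtr_gt0.
pose l := gap / (8 * (moment4 + 1)).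
have l0 : 0 < l by rewrite divr_gt0// mulr_gt0// ltr_wpDl.
have l1 : l <= 1.
  by rewrite ler_pdivrMr ?mul1r ?mulr_gt0 ?ltr_wpDl//; lra.
pose kap := l * gap / 4.
have kap0 : 0 < kap by rewrite divr_gt0// mulr_gt0.
have kap1 : kap <= 1.
  by rewrite /kap ler_pdivrMr// mul1r; have := ler_pM (ltW l0) (ltW gap0) l1 gap1; lra.
have kgap : kap <= gap / 2.
  by rewrite /kap; have := ler_wpM2r (ltW gap0) l1; lra.
pose del' := del / expR D.
have del'0 : 0 < del' by rewrite divr_gt0// expR_gt0.
pose Y := Num.max (2 / kap) (2 / (kap * del')).
have Y0 : 0 <= Y by rewrite le_max divr_ge0// ltW.
pose N0 := (Num.truncn ((Y ^+ 2 + 1) / alpha) + Num.truncn (1 / beta) +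
   Num.truncn (1 / (1 - beta)) + Num.truncn (1 / alpha)).+1.
exists N0 => n m k Nn hk hm.
have nN : N0%:R <= n%:R :> R by rewrite ler_nat.
have nlow (x : R) : 0 <= x -> (Num.truncn x < N0)%N -> x <= n%:R.
  move=> x0 xN; apply: le_trans nN; apply: ltW.
  apply: (lt_le_trans (truncnS_gt x)); by rewrite ler_nat.
have b1 : 0 < 1 - beta by lra.
have n1 : (Y ^+ 2 + 1) / alpha <= n%:R.
  apply: nlow; first by rewrite divr_ge0 ?addr_ge0 ?sqr_ge0// ltW.
  by rewrite ltnS -!addnA leq_addr.
have n2 : 1 / beta <= n%:R.
  apply: nlow; first by rewrite divr_ge0// ltW.
  by rewrite ltnS -!addnA addnCA leq_addr.
have n3 : 1 / (1 - beta) <= n%:R.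
  apply: nlow; first by rewrite divr_ge0// ltW.
  by rewrite ltnS -addnA addnC -addnA leq_addr.
have n4 : 1 / alpha <= n%:R.
  apply: nlow; first by rewrite divr_ge0// ltW.
  by rewrite ltnS leq_addl.
move: hk hm; rewrite !ltr_norml => /andP[hk1 hk2] /andP[hm1 hm2].
rewrite ler_pdivrMr// in n1; rewrite ler_pdivrMr// in n2.
rewrite ler_pdivrMr// in n3; rewrite ler_pdivrMr// in n4.
have k0 : (0 < k)%N by rewrite -(ltr0n R); lra.
have kn : (k <= n)%N.
  by rewrite -ltnS -(ltr_nat R) -[n.+1]addn1 natrD; lra.
have m0 : (0 < m)%N by rewrite -(ltr0n R); lra.
split=> // d T P A Aiid.
have n0 : (0 < n)%N by exact: leq_trans kn.
have rn0 : 0 < s * Num.sqrt n%:R by rewrite mulr_gt0// sqrtr_gt0 ltr0n.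
pose rho := (1 - gap / 2) * Num.sqrt m%:R.
have rho0 : 0 <= rho by rewrite mulr_ge0 ?sqrtr_ge0//; lra.
have [_ h] := @min_l2norm_lt_prob d T R P m n k A Aiid k0 kn _ tau l M rho
  (xi * Num.sqrt m%:R) rn0 tau0 (ltW l0) M0 rho0.
apply: (le_trans h); rewrite lee_fin => {h}.
set y := Num.sqrt m%:R in rho rho0 *.
have yge : Y <= y.
  rewrite -(@ler_pXn2r _ 2) ?nnegrE ?sqrtr_ge0// sqr_sqrtr ?ler0n//; lra.
have y0 : 0 <= y by exact: sqrtr_ge0.
have y2 : y ^+ 2 = m%:R by rewrite sqr_sqrtr.
have reassoc (x1 x2 x3 x4 : R) : x1 * (x2 * x3 * x4) = x1 * x2 * x3 * x4 by ring.
rewrite reassoc -!expRD.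
apply: (@le_trans _ _ (expR (D + (1 - gap) * y) *
   (expR (- rho) + expR (- (kap * y ^+ 2))))).
  apply: ler_pM; rewrite ?addr_ge0 ?expR_ge0//.
    rewrite ler_expR.
    have := @exponent_bound R s alpha beta tau (excess tau) abs4exp xi n%:R m%:R k%:R
      s0 alpha_gt0 tau0 k40 _ _ V_excess _ _.
    rewrite -/a -/y -/D.
    have -> : (1 - gap) = xi + s / a by rewrite /gap; ring.
    apply; [by rewrite ler1n|by [] |lra|lra].
  rewrite lerD2l ler_expR.
  have c0 : 0 < moment4 + 1 :> R by rewrite ltr_wpDl.
  have c1 : moment4 <= moment4 + 1 :> R by rewrite lerDl.
  have hM : moment4 / M ^+ 2 <= gap / 8.
    rewrite /M sqr_sqrtr ?(ltW M20)// ler_pdivrMr//.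
    have -> : gap / 8 * M2 = moment4 + 1 by rewrite /M2; field; rewrite gt_eqF.
    by [].
  have hl : l * moment4 <= gap / 8.
    have -> : gap / 8 = l * (moment4 + 1) by rewrite /l; field; rewrite gt_eqF.
    by rewrite ler_wpM2l// ltW.
  rewrite -y2 /rho exprMn.
  have -> : l * ((1 - gap / 2) ^+ 2 * y ^+ 2) +
    y ^+ 2 * (- l * (1 - moment4 / M ^+ 2) + l ^+ 2 * moment4) =
    y ^+ 2 * (l * ((1 - gap / 2) ^+ 2 - 1 + moment4 / M ^+ 2 + l * moment4)) by ring.
  have -> : - (kap * y ^+ 2) = y ^+ 2 * (l * (- (gap / 4))) by rewrite /kap; ring.
  rewrite ler_wpM2l ?sqr_ge0// ler_wpM2l ?(ltW l0)//.
  have g2 : gap ^+ 2 <= gap by rewrite expr2 ler_piMr// ltW.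
  have -> : (1 - gap / 2) ^+ 2 = 1 - gap + gap ^+ 2 / 4 by field.
  lra.
have fin : expR (- (kap * y)) + expR (y - kap * y ^+ 2) <= del'.
  apply: exp_tail => //; first by rewrite kap0.
    by apply: le_trans yge; rewrite le_max lexx.
  by apply: le_trans yge; rewrite le_max lexx orbT.
apply: (@le_trans _ _ (expR D * (expR (- (kap * y)) + expR (y - kap * y ^+ 2)))).
  rewrite expRD -mulrA ler_wpM2l ?expR_ge0// mulrDr -!expRD; apply: lerD.
    rewrite ler_expR /rho.
    have := ler_wpM2r y0 kgap; lra.
  rewrite ler_expR.
  have : 0 <= gap * y by rewrite mulr_ge0// ltW.
  lra.
apply: (le_trans (ler_wpM2l (expR_ge0 D) fin)).
by rewrite /del' mulrC divfK// gt_eqF// expR_gt0.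
Qed.

End asymptotics.

(** * Limits of probabilities and expectations *)

Lemma measurable_min_l2norm d (T : measurableType d) (R : realType) (P : probability T R)
    (m n k : nat) (A : 'M[{RV P >-> R}]_(m, n)) :
  iid_standard_normal A -> (0 < k)%N -> (k <= n)%N ->
  measurable_fun [set: T] (fun w => min_l2norm (realization A w) (@S_ric R n k)).
Proof.
move=> Aiid k0 kn; apply: (measurability _ (RGenInftyO.measurableE R)).
move=> _ [_ [t ->] <-]; rewrite setTI.
have [+ _] := @min_l2norm_lt_prob d T R P m n k A Aiid k0 kn 1 0 0 1 0 t
  ltr01 (lexx _) (lexx _) ltr01 (lexx _).
by congr (measurable _); apply/seteqP; split=> w /=; rewrite in_itv.
Qed.

Lemma cvg_probability1 (R : realType) (u : (\bar R)^nat) :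
  (forall del : R, 0 < del -> \forall n \near \oo, ((1 - del)%:E <= u n <= 1)%E) ->
  u @ \oo --> 1%E.
Proof.
move=> h; apply/fine_cvgP; split.
  near=> n; have /andP[h1 h2] : ((1 - 1)%:E <= u n <= 1)%E by near: n; exact: h.
  by rewrite fin_numE; case: (u n) h1 h2.
apply/cvgrPdist_le => e e0; near=> n.
have : ((1 - e)%:E <= u n <= 1)%E by near: n; exact: h.
rewrite /comp; case: (u n) => [r||]; rewrite ?leNye_eq ?leye_eq ?andbF// !lee_fin.
by move=> /andP[h1 h2] /=; rewrite ger0_norm ?subr_ge0// lerBlDl addrC -lerBlDl.
Unshelve. all: by end_near. Qed.

Lemma limn_einf_ge (R : realType) (u : (\bar R)^nat) (b : R) :
  (forall c : R, c < b -> \forall n \near \oo, (c%:E <= u n)%E) ->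
  (b%:E <= limn_einf u)%E.
Proof.
move=> h; apply/lee_subgt0Pr => e e0; rewrite -EFinB.
have [|N _ hN] := h (b - e); first by rewrite ltrBlDr ltrDl.
rewrite limn_einf_lim; apply: lime_ge; first exact: is_cvg_einfs.
exists N => // n /= Nn; apply: le_ereal_inf_tmp => _ [j /= nj <-].
by apply: hN => /=; exact: leq_trans nj.
Qed.

(** Markov's inequality, for a function that need not be packaged as a
random variable. *)
Lemma le_expectation_probability d (T : measurableType d) (R : realType)
    (P : probability T R) (X : T -> R) (t : R) :
  measurable_fun [set: T] X -> (forall w, 0 <= X w) -> 0 <= t ->
  (t%:E * P [set w | (t <= X w)%R] <= 'E_P[X])%E.
Proof.
move=> mX X0 t0; rewrite unlock.
have mE : measurable [set w | t <= X w].
  have -> : [set w | t <= X w] = X @^-1` `[t, +oo[.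
    by apply/seteqP; split=> w /=; rewrite in_itv/= andbT.
  by rewrite -[X in measurable X]setTI; exact: mX.
apply: (@le_trans _ _ (\int[P]_(w in [set w | (t <= X w)%R]) (X w)%:E)%E).
  rewrite -integral_cst//; apply: ge0_le_integral => //.
  by apply/measurable_EFinP; exact: measurable_funTS.
apply: ge0_subset_integral => //; first exact/measurable_EFinP.
by move=> w _; rewrite lee_fin.
Qed.

Section lower_bound.
Context {R : realType} (alpha beta : R).
Hypotheses (beta_gt0 : 0 < beta) (alpha_gt0 : 0 < alpha)
  (beta_lt_alpha : beta < alpha) (alpha_lt1 : alpha < 1).
Context (k m : nat -> nat)
  (hk : forall n : nat, `|(k n)%:R - beta * n%:R| < 1)
  (hm : forall n : nat, `|(m n)%:R - alpha * n%:R| < 1)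
  (d : nat -> measure_display) (T : forall n : nat, measurableType (d n))
  (P : forall n : nat, probability (T n) R)
  (A : forall n : nat, 'M[{RV (P n) >-> R}]_(m n, n))
  (hA : forall n : nat, iid_standard_normal (A n)).

Let xi (n : nat) (w : T n) : R :=
  min_l2norm (realization (A n) w) (@S_ric R n (k n)).

Lemma large_min_prob (c del : R) : 0 <= c -> c < lric_bound alpha beta -> 0 < del ->
  \forall n \near \oo, [/\ (0 < m n)%N, measurable_fun [set: T n] (@xi n) &
    ((1 - del)%:E <= P n [set w | (c * Num.sqrt (m n)%:R <= xi w)%R] <= 1)%E].
Proof.
move=> c0 cb del0.
have [N0 hN] := small_min_prob beta_gt0 alpha_gt0 beta_lt_alpha alpha_lt1 c0 cb del0.
exists N0 => // n /= Nn.
have [k0 kn m0 /(_ _ _ _ _ (hA n)) hP] := hN n (m n) (k n) Nn (hk n) (hm n).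
have mxi : measurable_fun [set: T n] (@xi n) by exact: measurable_min_l2norm.
have mE : measurable [set w : T n | xi w < c * Num.sqrt (m n)%:R].
  have -> : [set w : T n | xi w < c * Num.sqrt (m n)%:R] =
      @xi n @^-1` `]-oo, c * Num.sqrt (m n)%:R[.
    by apply/seteqP; split=> w /=; rewrite in_itv.
  by rewrite -[X in measurable X]setTI; exact: mxi.
split=> //.
have -> : [set w : T n | c * Num.sqrt (m n)%:R <= xi w] =
    ~` [set w | xi w < c * Num.sqrt (m n)%:R].
  by apply/seteqP; split=> w /=; rewrite leNgt => /negP.
apply/andP; split; last by apply: probability_le1; exact: measurableC.
by rewrite probability_setC// EFinB leeB.
Qed.

(** Let c be nonnegative and less than the bound b, and c' = (c + b) / 2.
Eventually the minimum exceeds c' sqrt m with probability at least c / c', so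
its mean is at least c sqrt m by Markov's inequality. *)
Lemma limn_einf_expectation :
  ((lric_bound alpha beta)%:E <=
    limn_einf (fun n => 'E_(P n)[@xi n] / (Num.sqrt (m n)%:R)%:E))%E.
Proof.
have E0 n : (0 <= 'E_(P n)[@xi n])%E.
  by apply: expectation_ge0 => w; exact: min_l2norm_ge0.
apply: limn_einf_ge => c cb.
set b := lric_bound alpha beta in cb.
have [c0|c0] := ltP c 0.
  apply: nearW => n; apply: (@le_trans _ _ 0%E); first by rewrite lee_fin ltW.
  by rewrite mule_ge0// inve_ge0 lee_fin sqrtr_ge0.
pose c' := (c + b) / 2.
have cc' : c < c' by rewrite /c'; lra.
have c'b : c' < b by rewrite /c'; lra.
have c'0 : 0 < c' by exact: le_lt_trans cc'.
have del0 : 0 < (c' - c) / c' by rewrite divr_gt0// subr_gt0.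
apply: filterS (large_min_prob (ltW c'0) c'b del0) => n [m0 mxi /andP[hP _]].
have s0 : 0 < Num.sqrt (m n)%:R :> R by rewrite sqrtr_gt0 ltr0n.
rewrite inver gt_eqF// lee_pdivlMr//.
have t0 : 0 <= c' * Num.sqrt (m n)%:R by rewrite mulr_ge0 ?sqrtr_ge0// ltW.
have xi0 (w : T n) : 0 <= xi w by exact: min_l2norm_ge0.
apply: le_trans (le_expectation_probability (P n) mxi xi0 t0).
apply: (@le_trans _ _ ((c' * Num.sqrt (m n)%:R)%:E * (1 - (c' - c) / c')%:E)%E); last first.
  by apply: lee_wpmul2l => //; rewrite lee_fin.
rewrite -!EFinM lee_fin [leRHS]mulrAC ler_pM2r//.
have -> : c' * (1 - (c' - c) / c') = c by field; rewrite gt_eqF.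
by [].
Qed.

Lemma cvg_min_prob (c : R) : c < lric_bound alpha beta ->
  lim_ge (fun n => P n [set w | (c * Num.sqrt (m n)%:R <= xi w)%R]) 1%E.
Proof.
move=> cb.
suff h : (fun n => P n [set w | (c * Num.sqrt (m n)%:R <= xi w)%R]) @ \oo --> 1%E.
  by split; [apply/cvg_ex; exists 1%E|rewrite (cvg_lim _ h)].
have [c0|c0] := ltP c 0.
  under eq_fun => n.
    rewrite (_ : [set w | _] = setT) ?probability_setT; last first.
      apply/seteqP; split=> // w _ /=.
      by apply: le_trans (min_l2norm_ge0 _ _); rewrite mulr_le0_ge0 ?sqrtr_ge0// ltW.
    over.
  exact: cvg_cst.
apply: cvg_probability1 => del del0.
by apply: filterS (large_min_prob c0 cb del0) => n [].
Qed.

End lower_bound.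

Theorem lemma5 (R : realType) (alpha beta : R)
    (beta_gt0 : 0 < beta) (alpha_gt0 : 0 < alpha)
    (beta_lt_alpha : beta < alpha) (alpha_lt1 : alpha < 1)
    (* k = beta n and m = alpha n, up to rounding to an integer *)
    (k m : nat -> nat)
    (hk : forall n : nat, `|(k n)%:R - beta * n%:R| < 1)
    (hm : forall n : nat, `|(m n)%:R - alpha * n%:R| < 1)
    (d : nat -> measure_display) (T : forall n : nat, measurableType (d n))
    (P : forall n : nat, probability (T n) R)
    (A : forall n : nat, 'M[{RV (P n) >-> R}]_(m n, n))
    (hA : forall n : nat, iid_standard_normal (A n)) :
  let xi (n : nat) (w : T n) : R :=
    min_l2norm (realization (A n) w) (@S_ric R n (k n)) in
  (((lric_bound alpha beta)%:E <=
    limn_einf (fun n => 'E_(P n)[xi n] / (Num.sqrt (m n)%:R)%:E))%E) /\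
  (forall xi_l : R, xi_l < lric_bound alpha beta ->
    let claim1 := lim_ge (fun n => P n [set w |
      xi_l * Num.sqrt (m n)%:R <=
      inf [set l2norm (realization (A n) w *m x) | x in @S_ric R n (k n)]]) 1%E in
    let claim2 := lim_ge (fun n => P n [set w |
      xi_l * Num.sqrt (m n)%:R <= xi n w]) 1%E in
    let claim3 := lim_ge (fun n => P n [set w |
      xi_l ^+ 2 * (m n)%:R <= xi n w ^+ 2]) 1%E in
    claim1 /\ (claim1 <-> claim2) /\ (0 <= xi_l -> (claim2 <-> claim3))).
Proof.
move=> xi; split; first exact: limn_einf_expectation.
move=> xi_l xi_lb claim1 claim2 claim3.
split; first exact: (cvg_min_prob beta_gt0 alpha_gt0 beta_lt_alpha alpha_lt1).
split=> // xi_l0; rewrite /claim2 /claim3.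
have E n : [set w | xi_l * Num.sqrt (m n)%:R <= xi n w] =
    [set w | xi_l ^+ 2 * (m n)%:R <= xi n w ^+ 2].
  apply/seteqP; split=> w /=;
    by rewrite -[X in _ ^+ 2 * X](@sqr_sqrtr _ (m n)%:R) ?ler0n// -exprMn
      ler_pXn2r// nnegrE ?mulr_ge0 ?sqrtr_ge0 ?min_l2norm_ge0.
by under eq_fun do rewrite E.
Qed.
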